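(* Let $(L,\triangleright)$ be a graded left pre-Lie algebra over a field of characteristic zero with associated graded Lie algebra $(L,[\cdot,\cdot])$, and let $d$ be a degree one derivation of $(L,[\cdot,\cdot])$ with $d^2=0$. Then the diagram $$\begin{array}{ccccc} C^*(\Delta_1,\partial\Delta_1;L,d)_{Lie}&\longrightarrow& C^*(\Delta_1;L,d)_{Lie}&\longrightarrow& C^*(\partial\Delta_1;L,d)_{Lie}\\ {\scriptstyle E}\big\downarrow&&{\scriptstyle\widetilde E}\big\downarrow&&\big\Vert\\ C^*(\Delta_1,\partial\Delta_1;L,d)_{p-Lie}&\longrightarrow& C^*(\Delta_1;L,d)_{p-Lie}&\longrightarrow& C^*(\partial\Delta_1;L,d)_{p-Lie}\end{array}$$ is an isomorphism of $L_\infty$ extensions; i.e. $E$ and $\widetilde E$ are $L_\infty$ isomorphisms and the diagram commutes.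
   Context: All spaces are $\mathbb{Z}$-graded over a field $\mathbb{K}$ of characteristic zero, with the Koszul sign rule; $V[k]^i=V^{k+i}$. **Coalgebras and $L_\infty[1]$ algebras.** $SV=\oplus_{n\ge0}V^{\odot n}$ is the symmetric coalgebra (unshuffle coproduct), $p:SV\to V$ the projection. Coderivations $Q\in\operatorname{Coder}(SV)$ and morphisms of coaugmented coalgebras $F:SV\to SW$ are determined by their Taylor coefficients $Q_n=q_n:V^{\odot n}\to V$ ($n\ge0$) and $f_n:V^{\odot n}\to W$ ($n\ge1$), i.e. the components of $pQ$, $pF$; these can be arbitrary. $\operatorname{Coder}(SV)$ is a graded Lie algebra via the graded commutator. An $L_\infty[1]$ structure on $V$ is a degree one coderivation $Q$ of $SV$ with $q_0=0$ and $Q^2=0$; an $L_\infty[1]$ morphism $(V,Q)\to(W,R)$ is a morphism of coaugmented coalgebras commuting with $Q,R$; it is strict if $f_n=0$ for $n\ge2$. An $L_\infty$ algebra structure on $V$ is, by d\'ecalage, the same as an $L_\infty[1]$ structure on $V[1]$, and similarly for morphisms; all $L_\infty$ algebras below are described by the corresponding $L_\infty[1]$ algebras. A dg Lie algebra $(M,\delta,[\cdot,\cdot])$ corresponds to the $L_\infty[1]$ structure on $M[1]$ with $q_1(s^{-1}x)=-s^{-1}\delta x$, $q_2(s^{-1}x\odot s^{-1}y)=(-1)^{|x|}s^{-1}[x,y]$, $q_n=0$ for $n\ge3$ ($s^{-1}:M\to M[1]$ the shift); a morphism of dg Lie algebras gives a strict morphism. **Extensions.** Given an $L_\infty[1]$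 algebra $(I,Q)$, a dg Lie algebra $(M,\delta,[\cdot,\cdot])$, and a morphism of dg Lie algebras $f:M\to(\operatorname{Coder}(SI),[Q,-],[\cdot,\cdot])$, the $L_\infty[1]$ extension with base $M[1]$ and fiber $I$ classified by $f$ is $I\to M[1]\times I\to M[1]$ (inclusion and projection), where $M[1]\times I$ has the $L_\infty[1]$ structure whose only nonzero components are: $\widetilde q_k(i_1\odot\cdots\odot i_k)=(0,q_k(i_1\odot\cdots\odot i_k))$; $\widetilde q_1(s^{-1}m)=(-s^{-1}\delta m,\,f(m)_0(1))$; $\widetilde q_2(s^{-1}m\odot s^{-1}m')=((-1)^{|m|}s^{-1}[m,m'],0)$; $\widetilde q_{1+k}(s^{-1}m\otimes i_1\odot\cdots\odot i_k)=(0,f(m)_k(i_1\odot\cdots\odot i_k))$ for $k\ge1$. **Pre-Lie data.** A graded left pre-Lie algebra $(L,\triangleright)$ is a graded space with a degree zero bilinear product whose associator $A(x,y,z)=(x\triangleright y)\triangleright z-x\triangleright(y\triangleright z)$ satisfies $A(x,y,z)=(-1)^{|x||y|}A(y,x,z)$; its Lie bracket is $[x,y]=x\triangleright y-(-1)^{|x||y|}y\triangleright x$; $\nabla_x(y)=x\triangleright y$. For $x\in L$, let $s(x)\in\operatorname{Coder}(SL)$ have Taylor coefficients $s(x)_0(1)=x$, $s(x)_1=\nabla_x$, $s(x)_n=0$ for $n\ge2$. Let $(UL,\ast)$ be the universal enveloping algebra of $(L,[\cdot,\cdot])$, $\eta:UL\to SL$ the coalgebra isomorphism $\eta(1)=1$,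 $\eta(x_1\ast\cdots\ast x_n)=s(x_1)\cdots s(x_n)(1)$, and $\operatorname{sym}:SL\to UL$ the coalgebra isomorphism $\operatorname{sym}(1)=1$, $\operatorname{sym}(x_1\odot\cdots\odot x_n)=\frac1{n!}\sum_{\sigma\in S_n}\varepsilon(\sigma)x_{\sigma(1)}\ast\cdots\ast x_{\sigma(n)}$ ($\varepsilon(\sigma)$ the Koszul sign). Put $s^\bot(x):=\eta(-\ast x)\eta^{-1}\in\operatorname{Coder}(SL)$, where $-\ast x$ is $u\mapsto(-1)^{|x||u|}u\ast x$. The exponential automorphism is $E:=\eta\circ\operatorname{sym}:SL\to SL$, with Taylor coefficients $e_n$ (so $e_1=\operatorname{id}_L$). Regarding $d$ as a linear coderivation of $SL$ (only Taylor coefficient $d:L\to L$), put $\mathcal{K}(d):=EdE^{-1}$; this is an $L_\infty[1]$ structure on $L$. **The bottom extension.** The map $s-s^\bot:(L,d,[\cdot,\cdot])\times(L,d,[\cdot,\cdot])\to(\operatorname{Coder}(SL),[\mathcal{K}(d),-],[\cdot,\cdot])$, $(x,y)\mapsto s(x)-s^\bot(y)$, is a morphism of dg Lie algebras. The bottom row $C^*(\Delta_1,\partial\Delta_1;L,d)_{p-Lie}\to C^*(\Delta_1;L,d)_{p-Lie}\to C^*(\partial\Delta_1;L,d)_{p-Lie}$ is the $L_\infty$ extension it classifies: the base is the dg Lie algebra $L\times L$, and the fiber is $L[-1]$ with the $L_\infty$ structure corresponding to the $L_\infty[1]$ structure $\mathcal{K}(d)$ on $L$. **The top extension.** For $x\in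 L$ let $\Phi(x),\Phi^\bot(x)\in\operatorname{Coder}(SL)$ have Taylor coefficients $\Phi(x)_0(1)=x=\Phi^\bot(x)_0(1)$ and, for $n\ge1$, $\Phi(x)_n(x_1\odot\cdots\odot x_n)=\frac{(-1)^nB_n}{n!}\sum_{\sigma\in S_n}\varepsilon(\sigma)[\cdots[x,x_{\sigma(1)}]\cdots,x_{\sigma(n)}]$, $\Phi^\bot(x)_n(x_1\odot\cdots\odot x_n)=\frac{B_n}{n!}\sum_{\sigma\in S_n}\varepsilon(\sigma)[\cdots[x,x_{\sigma(1)}]\cdots,x_{\sigma(n)}]$, where $B_n$ are the Bernoulli numbers ($B_0=1$, $B_1=-\frac12$, $B_2=\frac16,\ldots$). The map $\Phi-\Phi^\bot:(L,d,[\cdot,\cdot])\times(L,d,[\cdot,\cdot])\to(\operatorname{Coder}(SL),[d,-],[\cdot,\cdot])$, $(x,y)\mapsto\Phi(x)-\Phi^\bot(y)$, is a morphism of dg Lie algebras. The top row $C^*(\Delta_1,\partial\Delta_1;L,d)_{Lie}\to C^*(\Delta_1;L,d)_{Lie}\to C^*(\partial\Delta_1;L,d)_{Lie}$ is the $L_\infty$ extension it classifies: the base is the dg Lie algebra $L\times L$, and the fiber is $(L[-1],-d)$ as an abelian $L_\infty$ algebra, i.e. it corresponds to the $L_\infty[1]$ structure on $L$ given by the linear coderivation $d$. **Vertical maps.** The left one is the morphism with Taylor coefficients $e_n$, i.e. $E:(SL,d)\to(SL,\mathcal{K}(d))$. The map $\widetilde E$ is given, on the corresponding $L_\infty[1]$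 algebras $(L\times L)[1]\times L$, by the Taylor coefficients $\widetilde e_1(w,a)=(w,e_1(a))=(w,a)$ and $\widetilde e_n((w_1,a_1)\odot\cdots\odot(w_n,a_n))=(0,e_n(a_1\odot\cdots\odot a_n))$ for $n\ge2$. (The notation reflects that the underlying complexes are those of non-degenerate cochains on $\Delta_1$, on $\Delta_1$ relative to $\partial\Delta_1$, and on $\partial\Delta_1$, with coefficients in $(L,d)$.) *)

(* Defs.v *)
From HB Require Import structures.
From mathcomp Require Import all_boot all_order all_algebra.
From mathcomp Require Import perm.
From mathcomp Require Import boolp.

Set Implicit Arguments.
Unset Strict Implicit.
Unset Printing Implicit Defensive.

Import GRing.Theory.
Local Open Scope ring_scope.
Local Open Scope quotient_scope.

Definition ksign (K : fieldType) (n : int) : K := (-1) ^+ `|n|%N.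

(* A relator is a formal linear combination of generators, to be made zero.
   Equality in the presented module is equality of the images in every module
   in which all the relators vanish. *)
Section Presented.
Variables (K : fieldType) (X : choiceType) (R : seq (K * X) -> Prop).

Definition lincomb (W : lmodType K) (f : X -> W) (l : seq (K * X)) : W :=
  \sum_(t <- l) t.1 *: f t.2.

Definition kills (W : lmodType K) (f : X -> W) : Prop :=
  forall r, R r -> lincomb f r = 0.

Definition peq (l1 l2 : seq (K * X)) : bool :=
  `[< forall (W : lmodType K) (f : X -> W),
        kills f -> lincomb f l1 = lincomb f l2 >].

Fact peq_refl : reflexive peq. Proof. by move=> l; apply/asboolP. Qed.
Fact peq_sym : symmetric peq.
Proof. by move=> a b; apply/asboolP/asboolP=> h W f kf; rewrite (h W f kf). Qed.
Fact peq_trans : transitive peq.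
Proof.
move=> b a c /asboolP h1 /asboolP h2; apply/asboolP=> W f kf.
by rewrite (h1 W f kf) (h2 W f kf).
Qed.
Canonical peq_equiv := EquivRel peq peq_refl peq_sym peq_trans.

Definition pmod : Type := {eq_quot peq}.
HB.instance Definition _ := Choice.on pmod.
HB.instance Definition _ := EqQuotient.on pmod.

Definition pcls (l : seq (K * X)) : pmod := \pi_pmod l.
Definition pgen (x : X) : pmod := pcls [:: (1, x)].

Definition pscale_seq (c : K) (l : seq (K * X)) := [seq (c * t.1, t.2) | t <- l].

Definition pzero : pmod := pcls [::].
Definition padd (u v : pmod) : pmod := pcls (repr u ++ repr v).
Definition pscale (c : K) (u : pmod) : pmod := pcls (pscale_seq c (repr u)).
Definition popp (u : pmod) : pmod := pscale (-1) u.

Lemma lincomb_cat (W : lmodType K) (f : X -> W) a b :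
  lincomb f (a ++ b) = lincomb f a + lincomb f b.
Proof. exact: big_cat. Qed.

Lemma lincomb_scale (W : lmodType K) (f : X -> W) c l :
  lincomb f (pscale_seq c l) = c *: lincomb f l.
Proof.
by rewrite /lincomb big_map scaler_sumr; apply: eq_bigr=> t _; rewrite scalerA.
Qed.

Lemma pclsP a b :
  (forall (W : lmodType K) (f : X -> W), kills f -> lincomb f a = lincomb f b) ->
  pcls a = pcls b.
Proof. by move=> h; apply/eqmodP/asboolP. Qed.

Lemma lincomb_repr (W : lmodType K) (f : X -> W) l :
  kills f -> lincomb f (repr (pcls l)) = lincomb f l.
Proof.
have /eqmodP/asboolP h : \pi_pmod (repr (pcls l)) = \pi_pmod l by rewrite reprK.
exact: h.
Qed.

Lemma pmod_ext (u v : pmod) :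
  (forall (W : lmodType K) (f : X -> W),
     kills f -> lincomb f (repr u) = lincomb f (repr v)) -> u = v.
Proof. by move=> /pclsP; rewrite /pcls !reprK. Qed.

Local Ltac pext := move=> *; apply: pmod_ext => W f kf;
  rewrite /popp ?(lincomb_repr, lincomb_cat, lincomb_scale) //.

Fact paddA : associative padd. Proof. by pext; rewrite addrA. Qed.
Fact paddC : commutative padd. Proof. by pext; rewrite addrC. Qed.
Fact padd0 : left_id pzero padd.
Proof. by pext; rewrite /lincomb big_nil add0r. Qed.
Fact paddN : left_inverse pzero popp padd.
Proof. by pext; rewrite /lincomb big_nil scaleN1r addNr. Qed.
HB.instance Definition _ :=
  GRing.isZmodule.Build pmod paddA paddC padd0 paddN.

Fact pscaleA a b u : pscale a (pscale b u) = pscale (a * b) u.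
Proof. by pext; rewrite scalerA. Qed.
Fact pscale1 : left_id 1 pscale. Proof. by pext; rewrite scale1r. Qed.
Fact pscaleDr : right_distributive pscale padd.
Proof. by pext; rewrite scalerDr. Qed.
Fact pscaleDl u : {morph pscale^~ u : a b / a + b >-> padd a b}.
Proof. by pext; rewrite scalerDl. Qed.
HB.instance Definition _ :=
  GRing.Zmodule_isLmodule.Build K pmod pscaleA pscale1 pscaleDr pscaleDl.

(* The linear map on the presented module with prescribed values on the
   generators; the zero map if these values do not respect the relations. *)
Definition plin (W : lmodType K) (f : X -> W) (u : pmod) : W :=
  if `[< kills f >] then lincomb f (repr u) else 0.

Lemma plin_gen (W : lmodType K) (f : X -> W) x : kills f -> plin f (pgen x) = f x.
Proof.
move=> kf; rewrite /plin asboolT // lincomb_repr //.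
by rewrite /lincomb big_seq1 scale1r.
Qed.

Lemma plin_linear (W : lmodType K) (f : X -> W) : linear (plin f).
Proof.
move=> a u v; rewrite /plin; case: asboolP => [kf|_]; last first.
  by rewrite scaler0 addr0.
change (a *: u + v) with (padd (pscale a u) v).
by rewrite !(lincomb_repr, lincomb_cat, lincomb_scale).
Qed.

Lemma pgen_kills : kills pgen.
Proof.
have pgenE l : lincomb pgen l = pcls l.
  apply: pmod_ext => W f kf; rewrite lincomb_repr //.
  rewrite /lincomb; elim: l => [|[c x] l IH].
    by rewrite !big_nil; apply: etrans (lincomb_repr [::] kf) _; apply: big_nil.
  rewrite !big_cons -{}IH.
  rewrite -[LHS]/(lincomb f (repr (padd (pscale c (pgen x)) _))).
  rewrite !(lincomb_repr, lincomb_cat, lincomb_scale) //.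
  by rewrite {1}/lincomb big_seq1 scale1r.
move=> r Rr; rewrite pgenE; apply: pclsP => W f kf.
by rewrite (kf r Rr) /lincomb big_nil.
Qed.

End Presented.

Arguments pmod {K X} R.
Arguments pgen {K X} R x.
Arguments plin {K X R W} f u.

Section Tensor.
Variables (K : fieldType).

Inductive tens_rel (A B : lmodType K) : seq (K * (A * B)) -> Prop :=
| TensL c a a' b :
    tens_rel [:: (1, (c *: a + a', b)); (- c, (a, b)); (-1, (a', b))]
| TensR c a b b' :
    tens_rel [:: (1, (a, c *: b + b')); (- c, (a, b)); (-1, (a, b'))].

Definition tens (A B : lmodType K) : lmodType K := pmod (@tens_rel A B).
Definition ten (A B : lmodType K) (a : A) (b : B) : tens A B :=
  pgen (@tens_rel A B) (a, b).
Definition tmap (A B A' B' : lmodType K) (F : A -> A') (G : B -> B') :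
    tens A B -> tens A' B' :=
  plin (fun t => ten (F t.1) (G t.2)).

End Tensor.

(* A space with its decomposition as the direct sum of its homogeneous
   components; [gproj i] is the projection onto the component of degree [i]. *)
Record gspace (K : fieldType) := GSpace {
  gcar :> lmodType K;
  gproj : int -> gcar -> gcar;
  gproj_linear : forall i, linear (gproj i);
  gproj_gproj : forall i j v, gproj i (gproj j v) = if i == j then gproj j v else 0;
  gproj_sum : forall v, exists2 s : seq int, uniq s & v = \sum_(i <- s) gproj i v
}.

Definition homog (K : fieldType) (V : gspace K) (i : int) (v : V) : bool :=
  gproj i v == v.

Definition deg_map (K : fieldType) (V W : gspace K) (k : int) (g : V -> W) : Prop :=
  linear g /\ forall i v, homog i v -> homog (i + k) (g v).

(* Homogeneous elements, with their degree. *)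
Definition hel (K : fieldType) (V : gspace K) : Type :=
  {x : int * V | homog x.1 x.2}.
HB.instance Definition _ K V := Choice.on (@hel K V).

Section Hel.
Variables (K : fieldType).
Implicit Types V W : gspace K.

Definition deg V (x : hel V) : int := (val x).1.
Definition vec V (x : hel V) : V := (val x).2.

Fact gproj_homog V i (v : V) : homog i (gproj i v).
Proof. by rewrite /homog gproj_gproj eqxx. Qed.

(* [v] as an element of degree [i]; always used with [v] homogeneous of
   degree [i], so that the projection is the identity. *)
Definition mkhel V (i : int) (v : V) : hel V :=
  exist (fun x : int * V => homog x.1 x.2) (i, gproj i v) (gproj_homog i v).

Lemma vec_mkhel V i (v : V) : homog i v -> vec (mkhel i v) = v.
Proof. by move/eqP. Qed.

Definition hmap V W (g : V -> W) (x : hel V) : hel W := mkhel (deg x) (g (vec x)).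

(* [V[k]], with [V[k]^i = V^(k+i)]; the shift maps are identities on vectors. *)
Fact shift_gproj_gproj V k i j (v : V) :
  gproj (k + i) (gproj (k + j) v) = if i == j then gproj (k + j) v else 0.
Proof. by rewrite gproj_gproj (inj_eq (addrI k)). Qed.
Fact shift_gproj_sum V k (v : V) :
  exists2 s : seq int, uniq s & v = \sum_(i <- s) gproj (k + i) v.
Proof.
have [s us vs] := gproj_sum v; exists [seq i - k | i <- s].
  by rewrite map_inj_uniq // => x y; apply: addIr.
by rewrite big_map {1}vs; apply: eq_bigr => i _; rewrite addrC subrK.
Qed.
Definition shift V (k : int) : gspace K :=
  @GSpace K V (fun i v => gproj (k + i) v)
    (fun i => @gproj_linear K V (k + i))
    (@shift_gproj_gproj V k) (@shift_gproj_sum V k).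

(* [s^-1 m |-> m] *)
Definition unshift V (x : hel (shift V 1)) : hel V := @mkhel V (1 + deg x) (vec x).

Fact gprod_linear V W i :
  linear (fun v : (V * W)%type => (gproj i v.1, gproj i v.2)).
Proof. by move=> a u v; rewrite /= !gproj_linear. Qed.
Fact gprod_gproj V W i j (v : (V * W)%type) :
  (gproj i (gproj j v.1), gproj i (gproj j v.2)) =
  if i == j then (gproj j v.1, gproj j v.2) else 0.
Proof. by rewrite !gproj_gproj; case: eqP. Qed.
Lemma gproj0 V i : gproj i (0 : V) = 0.
Proof.
have := @gproj_linear K V i (-1) 0 0.
by rewrite scaler0 addr0 scaleN1r addNr.
Qed.
Lemma gproj_out V (v : V) s i :
  v = \sum_(j <- s) gproj j v -> i \notin s -> gproj i v = 0.
Proof.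
move=> ->; elim: s {1}v => [|j s IH] w; first by rewrite big_nil gproj0.
rewrite in_cons negb_or => /andP[ij js]; rewrite big_cons.
have := @gproj_linear K V i 1 (gproj j w) (\sum_(k <- s) gproj k w).
by rewrite !scale1r => ->; rewrite gproj_gproj (negPf ij) add0r IH.
Qed.
Fact gprod_sum V W (v : (V * W)%type) :
  exists2 s : seq int, uniq s & v = \sum_(i <- s) (gproj i v.1, gproj i v.2).
Proof.
have widen (U : gspace K) (u : U) (s t : seq int) : uniq s -> uniq t ->
    {subset s <= t} -> u = \sum_(i <- s) gproj i u -> u = \sum_(i <- t) gproj i u.
  move=> us ut st e; rewrite [RHS](bigID (mem s)) /= [X in _ + X]big1; last first.
    by move=> i; apply: gproj_out e.
  rewrite addr0 -big_filter {1}e; apply: perm_big; apply: uniq_perm => //.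
    exact: filter_uniq.
  by move=> x; rewrite mem_filter; case: (boolP (x \in s)) => // /st ->.
have [s us e1] := gproj_sum v.1; have [t ut e2] := gproj_sum v.2.
exists (undup (s ++ t)); first exact: undup_uniq.
have -> (r : seq int) : \sum_(i <- r) (gproj i v.1, gproj i v.2) =
    (\sum_(i <- r) gproj i v.1, \sum_(i <- r) gproj i v.2).
  by elim: r => [|i r IH]; rewrite ?big_nil // !big_cons IH.
rewrite [LHS]surjective_pairing; congr (_, _).
  by apply: (widen V _ s) => //; [exact: undup_uniq |
    move=> x xs; rewrite mem_undup mem_cat xs].
by apply: (widen W _ t) => //; [exact: undup_uniq |
  move=> x xs; rewrite mem_undup mem_cat xs orbT].
Qed.
Definition gprod V W : gspace K :=
  @GSpace K (V * W)%type (fun i v => (gproj i v.1, gproj i v.2))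
    (@gprod_linear V W) (@gprod_gproj V W) (@gprod_sum V W).

End Hel.

Definition word (K : fieldType) (V : gspace K) : Type := seq (hel V).
HB.instance Definition _ K V := Choice.on (@word K V).

Section Words.
Variables (K : fieldType) (V : gspace K).
Implicit Types (w : word V).

Definition wdeg w : int := \sum_(x <- w) deg x.

(* All the unshuffles [(e, a, b)] of [w], with Koszul sign [(-1)^e]. *)
Fixpoint unshuffles w : seq (int * word V * word V) :=
  if w is x :: w' then
    flatten [seq [:: (t.1.1, x :: t.1.2, t.2);
                     (t.1.1 + deg x * wdeg t.1.2, t.1.2, x :: t.2)]
            | t <- unshuffles w']
  else [:: (0, [::], [::])].

Definition wperm w (s : 'S_(size w)) : word V :=
  [seq tnth (in_tuple w) (s i) | i <- enum 'I_(size w)].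

Definition koszul w (s : 'S_(size w)) : K :=
  ksign K (\sum_(i < size w) \sum_(j < size w | (i < j)%N && (s j < s i)%N)
             deg (tnth (in_tuple w) (s i)) * deg (tnth (in_tuple w) (s j))).

End Words.

Section Sym.
Variables (K : fieldType).
Implicit Types V W : gspace K.

(* [SV] is the quotient of the space of words by multilinearity and graded
   commutativity; the word [x1 ... xn] is [x1 (.) ... (.) xn]. *)
Inductive sym_rel V : seq (K * word V) -> Prop :=
| SymLin c (x y z : hel V) (u v : word V) :
    deg x = deg z -> deg y = deg z -> vec z = c *: vec x + vec y ->
    sym_rel [:: (1, u ++ z :: v); (- c, u ++ x :: v); (-1, u ++ y :: v)]
| SymSwap (x y : hel V) (u v : word V) :
    sym_rel [:: (1, u ++ x :: y :: v);
                (- ksign K (deg x * deg y), u ++ y :: x :: v)].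

Definition Sym V : lmodType K := pmod (@sym_rel V).
Definition sgen V (w : word V) : Sym V := pgen (@sym_rel V) w.
Definition sone V : Sym V := sgen [::].

Definition Delta V : Sym V -> tens (Sym V) (Sym V) :=
  plin (fun w => \sum_(t <- unshuffles w)
          ksign K t.1.1 *: ten (sgen t.1.2) (sgen t.2)).
Definition scounit V : Sym V -> K^o := plin (fun w : word V => (w == [::])%:R).
Definition sproj1 V : Sym V -> V :=
  plin (fun w : word V => if w is [:: x] then vec x else 0).

Definition spart V (n : int) : Sym V -> Sym V :=
  plin (fun w : word V => if wdeg w == n then sgen w else 0).
Definition shomog V (n : int) (u : Sym V) : Prop := spart n u = u.

(* [u |-> (-1)^(k|u|) u] *)
Definition stwist V (k : int) : Sym V -> Sym V :=
  plin (fun w : word V => ksign K (k * wdeg w) *: sgen w).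

Definition sdeg_map V W (k : int) (F : Sym V -> Sym W) : Prop :=
  linear F /\ forall n u, shomog n u -> shomog (n + k) (F u).

(* Since [(id (x) Q)(u (x) v) = (-1)^(k|u|) u (x) Q v], the co-Leibniz rule
   involves [stwist]. *)
Definition is_coder V (k : int) (Q : Sym V -> Sym V) : Prop :=
  sdeg_map k Q /\
  forall u, Delta (Q u) = tmap Q id (Delta u) + tmap (@stwist V k) Q (Delta u).

Definition is_coalg_mor V W (F : Sym V -> Sym W) : Prop :=
  [/\ sdeg_map 0 F, forall u, Delta (F u) = tmap F F (Delta u),
      forall u, scounit (F u) = scounit u & F (sone V) = sone W].

Definition taylor V W (F : Sym V -> Sym W) (w : word V) : W := sproj1 (F (sgen w)).

(* The coderivation of degree [k] with Taylor coefficients [q]: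
   [Q(x1 ... xn) = sum +- q(x_I) (.) x_(I^c)] over the unshuffles. *)
Definition coder V (k : int) (q : word V -> V) : Sym V -> Sym V :=
  plin (fun w => \sum_(t <- unshuffles w)
          ksign K t.1.1 *: sgen (mkhel (k + wdeg t.1.2) (q t.1.2) :: t.2)).

Definition lincoef V (g : V -> V) (w : word V) : V :=
  if w is [:: x] then g (vec x) else 0.

(* The strict morphism [S g] induced by a linear map [g] of degree zero. *)
Definition smap V W (g : V -> W) : Sym V -> Sym W :=
  plin (fun w => sgen (map (hmap g) w)).

Definition is_Linf V (Q : Sym V -> Sym V) : Prop :=
  [/\ is_coder 1 Q, taylor Q [::] = 0 & forall u, Q (Q u) = 0].

Definition is_Linf_mor V W (Q : Sym V -> Sym V) (R : Sym W -> Sym W)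
    (F : Sym V -> Sym W) : Prop :=
  is_coalg_mor F /\ forall u, F (Q u) = R (F u).

Definition is_Linf_iso V W (Q : Sym V -> Sym V) (R : Sym W -> Sym W)
    (F : Sym V -> Sym W) : Prop :=
  is_Linf_mor Q R F /\
  exists G : Sym W -> Sym V, [/\ is_Linf_mor R Q G, cancel F G & cancel G F].

(* [I -> B x I -> B]; [i |-> (0, i)] and [(b, i) |-> b] are strict morphisms. *)
Definition incl (B I : gspace K) (a : I) : gprod B I := (0 : B, a).
Definition proj (B I : gspace K) (x : gprod B I) : B := x.1.

Definition is_Linf_extension (B I : gspace K) (QI : Sym I -> Sym I)
    (QX : Sym (gprod B I) -> Sym (gprod B I)) (QB : Sym B -> Sym B) : Prop :=
  [/\ is_Linf QI, is_Linf QX, is_Linf QB,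
      is_Linf_mor QI QX (smap (@incl B I)) &
      is_Linf_mor QX QB (smap (@proj B I))].

(* An isomorphism, over the identity of the base, between two extensions with
   the same underlying spaces. *)
Definition is_extension_iso (B I : gspace K) (QI : Sym I -> Sym I)
    (QX : Sym (gprod B I) -> Sym (gprod B I)) (QB : Sym B -> Sym B)
    (RI : Sym I -> Sym I) (RX : Sym (gprod B I) -> Sym (gprod B I))
    (F : Sym I -> Sym I) (Ft : Sym (gprod B I) -> Sym (gprod B I)) : Prop :=
  [/\ is_Linf_extension QI QX QB /\ is_Linf_extension RI RX QB,
      is_Linf_iso QI RI F, is_Linf_iso QX RX Ft,
      forall u, Ft (smap (@incl B I) u) = smap (@incl B I) (F u) &
      forall u, smap (@proj B I) (Ft u) = smap (@proj B I) u].

(* The data [(M, delta, [,])] of a dg Lie algebra, the bracket being given on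
   homogeneous elements. The axioms are not recorded: they do not enter the
   construction of the extension, only the proof that its square is zero. *)
Record dgl := Dgl {
  dgl_sp :> gspace K;
  dgl_d : dgl_sp -> dgl_sp;
  dgl_br : hel dgl_sp -> hel dgl_sp -> dgl_sp
}.

Definition dgl_coef (M : dgl) (w : word (shift M 1)) : shift M 1 :=
  match w with
  | [:: x] => - dgl_d (vec (unshift x))
  | [:: x; y] => ksign K (deg (unshift x)) *: dgl_br (unshift x) (unshift y)
  | _ => 0
  end.
Definition dgl_Linf (M : dgl) : Sym (shift M 1) -> Sym (shift M 1) :=
  coder 1 (@dgl_coef M).

(* The letters of [w] are pairs [(s^-1 m, i)]. The unshuffles [(e, [:: x], b)]
   move each letter [x] in turn to the front, for the terms
   [f(m)_k(i1 (.) ... (.) ik)]; [f(m)_0(1)] is the case of a single letter. *)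
Definition ext_coef (M : dgl) (I : gspace K) (QI : Sym I -> Sym I)
    (f : hel M -> Sym I -> Sym I) (w : word (gprod (shift M 1) I)) :
    gprod (shift M 1) I :=
  let bases := map (hmap (@proj (shift M 1) I)) in
  let fibers := map (hmap (fun x : gprod (shift M 1) I => x.2)) in
  (dgl_coef (bases w),
   taylor QI (fibers w) +
   \sum_(t <- unshuffles w)
     if bases t.1.2 is [:: m]
     then ksign K t.1.1 *: taylor (f (unshift m)) (fibers t.2) else 0).
Definition ext_Linf (M : dgl) (I : gspace K) (QI : Sym I -> Sym I)
    (f : hel M -> Sym I -> Sym I) :
    Sym (gprod (shift M 1) I) -> Sym (gprod (shift M 1) I) :=
  coder 1 (ext_coef QI f).

End Sym.
Arguments dgl_Linf {K} M _.

Record preLie (K : fieldType) := PreLie {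
  pl_sp :> gspace K;
  pl_op : pl_sp -> pl_sp -> pl_sp;
  pl_linl : forall y, linear (pl_op^~ y);
  pl_linr : forall x, linear (pl_op x);
  pl_deg : forall i j x y, homog i x -> homog j y -> homog (i + j) (pl_op x y);
  pl_assoc : forall (x y : hel pl_sp) (z : pl_sp),
    let A a b c := pl_op (pl_op a b) c - pl_op a (pl_op b c) in
    A (vec x) (vec y) z = ksign K (deg x * deg y) *: A (vec y) (vec x) z
}.

(* Bernoulli numbers with [B_1 = -1/2], by the recursion
   [B_m = [m = 0] - \sum_(k < m) 'C(m, k) B_k / (m - k + 1)]. *)
Fixpoint bernoulli_seq (F : fieldType) (n : nat) : seq F :=
  if n is m.+1 then
    let B := bernoulli_seq F m in
    rcons B ((m == 0)%:R - \sum_(k < m) 'C(m, k)%:R * B`_k / (m - k).+1%:R)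
  else [::].
Definition bernoulli (F : fieldType) (n : nat) : F := (bernoulli_seq F n.+1)`_n.

Definition inverse_map (A B : nmodType) (F : A -> B) (y : B) : A :=
  if pselect (exists x, F x = y) is left h then projT1 (cid h) else 0.

Section PreLieTheory.
Variables (K : fieldType) (L : preLie K).

Definition lbr (x y : hel L) : L :=
  pl_op (vec x) (vec y) - ksign K (deg x * deg y) *: pl_op (vec y) (vec x).
Definition hbr (x y : hel L) : hel L := mkhel (deg x + deg y) (lbr x y).

Definition is_dg_derivation (d : L -> L) : Prop :=
  [/\ deg_map 1 d,
      forall x y : hel L,
        d (lbr x y) = lbr (mkhel (deg x + 1) (d (vec x))) y
                      + ksign K (deg x) *: lbr x (mkhel (deg y + 1) (d (vec y)))
    & forall x, d (d x) = 0].

Definition s_coef (x : hel L) (w : word L) : L :=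
  match w with
  | [::] => vec x
  | [:: y] => pl_op (vec x) (vec y)
  | _ => 0
  end.
Definition s (x : hel L) : Sym L -> Sym L := coder (deg x) (s_coef x).

(* The universal enveloping algebra: the quotient of the tensor algebra by
   [x y - (-1)^(|x||y|) y x - [x, y]]. The product is the concatenation of
   words, so that the word [x1 ... xn] is [x1 * ... * xn]. *)
Inductive env_rel : seq (K * word L) -> Prop :=
| EnvLin c (x y z : hel L) (u v : word L) :
    deg x = deg z -> deg y = deg z -> vec z = c *: vec x + vec y ->
    env_rel [:: (1, u ++ z :: v); (- c, u ++ x :: v); (-1, u ++ y :: v)]
| EnvBr (x y : hel L) (u v : word L) :
    env_rel [:: (1, u ++ x :: y :: v);
                (- ksign K (deg x * deg y), u ++ y :: x :: v);
                (-1, u ++ hbr x y :: v)].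

Definition Env : lmodType K := pmod env_rel.
Definition egen (w : word L) : Env := pgen env_rel w.

Definition eta : Env -> Sym L :=
  plin (fun w : word L => foldr (fun x u => s x u) (sone L) w).

Definition sym : Sym L -> Env :=
  plin (fun w : word L =>
    (size w)`!%:R^-1 *: \sum_(p : 'S_(size w)) koszul p *: egen (wperm p)).

(* [u |-> (-1)^(|x||u|) u * x] *)
Definition env_rmul (x : hel L) : Env -> Env :=
  plin (fun w : word L => ksign K (deg x * wdeg w) *: egen (rcons w x)).

Definition s_bot (x : hel L) (u : Sym L) : Sym L :=
  eta (env_rmul x (inverse_map eta u)).

Definition E (u : Sym L) : Sym L := eta (sym u).

Definition lin_coder (d : L -> L) : Sym L -> Sym L := coder 1 (lincoef d).
Definition calK (d : L -> L) (u : Sym L) : Sym L :=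
  E (lin_coder d (inverse_map E u)).

(* For the empty word these coefficients are [x], as [B_0 = 1]. *)
Definition Phi_bot_coef (x : hel L) (w : word L) : L :=
  (bernoulli K (size w) / (size w)`!%:R) *:
    \sum_(p : 'S_(size w)) koszul p *: vec (foldl hbr x (wperm p)).
Definition Phi_coef (x : hel L) (w : word L) : L :=
  (-1) ^+ size w *: Phi_bot_coef x w.
Definition Phi (x : hel L) : Sym L -> Sym L := coder (deg x) (Phi_coef x).
Definition Phi_bot (x : hel L) : Sym L -> Sym L := coder (deg x) (Phi_bot_coef x).

Definition hfst (m : hel (gprod L L)) : hel L :=
  hmap (fun x : gprod L L => x.1) m.
Definition hsnd (m : hel (gprod L L)) : hel L :=
  hmap (fun x : gprod L L => x.2) m.

Definition LxL (d : L -> L) : dgl K :=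
  @Dgl K (gprod L L) (fun m => (d m.1, d m.2))
    (fun m m' => (lbr (hfst m) (hfst m'), lbr (hsnd m) (hsnd m'))).

Definition pLie_map (m : hel (gprod L L)) (u : Sym L) : Sym L :=
  s (hfst m) u - s_bot (hsnd m) u.
Definition Lie_map (m : hel (gprod L L)) (u : Sym L) : Sym L :=
  Phi (hfst m) u - Phi_bot (hsnd m) u.

(* The underlying graded space [(L x L)[1] x L] of the [L_oo[1]] algebras
   corresponding to the non-degenerate cochains on [Delta_1]. *)
Definition cochains : gspace K := gprod (shift (gprod L L) 1) L.

Definition cochains_Lie (d : L -> L) : Sym cochains -> Sym cochains :=
  @ext_Linf K (LxL d) L (lin_coder d) Lie_map.
Definition cochains_pLie (d : L -> L) : Sym cochains -> Sym cochains :=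
  @ext_Linf K (LxL d) L (calK d) pLie_map.

Definition Etilde_coef (w : word cochains) : cochains :=
  let fibers := map (hmap (fun x : cochains => x.2)) w in
  ((if w is [:: x] then (vec x).1 else 0), taylor E fibers).

End PreLieTheory.

(* Main.v *)
From HB Require Import structures.
From mathcomp Require Import all_boot all_order all_algebra.
From mathcomp Require Import perm ring zify boolp functions.
Require Import Defs.
Set Implicit Arguments.
Unset Strict Implicit.
Unset Printing Implicit Defensive.
Import GRing.Theory.
Local Open Scope ring_scope.

(** Inside the convolution algebra of maps from [S L] to the enveloping algebra
    [U], symmetrization is the exponential of the inclusion [y] of the letters:
    [n!] times its value on a word of length [n] is the [n]-th power of [y].
    Left and right convolution by [y] are commuting operators [l] and [r]; their
    powers, applied to the constant [x], are the products of symmetrized words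
    with [x] on either side, and the powers of [r - l] are the iterated brackets
    that define [Phi x] and [Phi_bot x].  Composing [sym] with a coderivation
    inserts its corestriction at every place of the exponential, and this is
    multiplication by the quotient of [e^r - e^l] by [r - l].  So the classical
    expansions of [t / (e^t - 1)] and [t / (1 - e^(-t))] at [t = r - l], namely
    [mixed_bernoulli] and [mixed_bernoulli_swap], say that [sym] carries
    [Phi_bot x] and [Phi x] to right and left multiplication by [x] ([sym_Phi_bot],
    [sym_Phi]).

    The pre-Lie identity says that [x |-> s x] is an action of the Lie algebra
    ([s_hbr]), so [eta] is well defined and turns left multiplication by [x] into
    [s x].  The exponential [E] is [eta] after [sym]; it is unipotent for the
    length of words, hence bijective ([E_inj], [E_surj]).  As the range of [sym]
    contains the unit and is stable under left multiplications, [sym] is onto, so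
    [sym] and [eta] are isomorphisms.  It follows that [E] conjugates [Phi x] to
    [s x] and [Phi_bot x] to [s_bot x] ([E_Phi], [E_Phi_bot]), and the linear
    coderivation [d] to [calK d] by definition.

    What remains is formal.  A coderivation is determined by its corestriction
    ([coder_ext]), which yields that actions by coderivations classify extensions
    ([ext_is_extension]).  On the product of a word of base letters with an
    element of the fibre coalgebra, the differential of an extension only involves
    the fibre through its differential and the action ([ext_mu]).  An
    automorphism of the fibre coalgebra that intertwines both therefore extends,
    by the identity on the base, to an isomorphism of extensions
    ([extF_intertwine]). *)

(** * Linear maps and presented modules *)

Section Linear.
Variables (K : fieldType) (V W : lmodType K) (F : V -> W).
Hypothesis hF : linear F.

Lemma linD u v : F (u + v) = F u + F v.
Proof. by have := hF 1 u v; rewrite !scale1r. Qed.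

Lemma lin0 : F 0 = 0.
Proof. by apply: (addrI (F 0)); rewrite -linD !addr0. Qed.

Lemma linZ c u : F (c *: u) = c *: F u.
Proof. by have := hF c u 0; rewrite !addr0 lin0 addr0. Qed.

Lemma linN u : F (- u) = - F u.
Proof. by rewrite -!scaleN1r linZ. Qed.

Lemma linB u v : F (u - v) = F u - F v.
Proof. by rewrite linD linN. Qed.

Lemma lin_sum (I : Type) (r : seq I) (P : pred I) (G : I -> V) :
  F (\sum_(i <- r | P i) G i) = \sum_(i <- r | P i) F (G i).
Proof. exact: (big_morph _ linD lin0). Qed.

End Linear.

Section LinearClosure.
Variables (K : fieldType) (U V W : lmodType K).

Lemma lin_id : linear (@id V). Proof. by []. Qed.

Lemma lin_zero : linear (fun _ : V => 0 : W).
Proof. by move=> c u v; rewrite scaler0 addr0. Qed.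

Lemma lin_comp (F : V -> W) (G : U -> V) :
  linear F -> linear G -> linear (fun u => F (G u)).
Proof. by move=> hF hG c u v; rewrite hG hF. Qed.

Lemma lin_add (F G : V -> W) :
  linear F -> linear G -> linear (fun u => F u + G u).
Proof. by move=> hF hG c u v; rewrite hF hG scalerDr addrACA. Qed.

Lemma lin_opp (F : V -> W) : linear F -> linear (fun u => - F u).
Proof. by move=> hF c u v; rewrite hF opprD scalerN. Qed.

Lemma lin_sub (F G : V -> W) :
  linear F -> linear G -> linear (fun u => F u - G u).
Proof. by move=> hF hG; apply: lin_add => //; exact: lin_opp. Qed.

Lemma lin_scale a (F : V -> W) : linear F -> linear (fun u => a *: F u).
Proof. by move=> hF c u v; rewrite hF scalerDr !scalerA mulrC. Qed.

Lemma lin_bigsum (I : Type) (r : seq I) (F : I -> V -> W) :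
  (forall i, linear (F i)) -> linear (fun u => \sum_(i <- r) F i u).
Proof.
move=> hF c u v; rewrite scaler_sumr -big_split.
by apply: eq_bigr => i _; rewrite hF.
Qed.

End LinearClosure.

Section PresentedExt.
Variables (K : fieldType) (X : choiceType) (R : seq (K * X) -> Prop).
Variable W : lmodType K.

Lemma pmod_lincomb (u : pmod R) : exists l, u = lincomb (pgen R) l.
Proof.
exists (repr u); apply: pmod_ext => Z f kf.
have hf : lincomb f (repr u) = plin f u by rewrite /plin asboolT.
have -> : lincomb f (repr (lincomb (pgen R) (repr u)))
          = plin f (lincomb (pgen R) (repr u)) by rewrite /plin asboolT.
rewrite {2}/lincomb (lin_sum (@plin_linear K X R Z f)).
by apply: eq_bigr => t _; rewrite (linZ (@plin_linear K X R Z f)) plin_gen.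
Qed.

Lemma pmod_linext (F G : pmod R -> W) : linear F -> linear G ->
  (forall x, F (pgen R x) = G (pgen R x)) -> forall u, F u = G u.
Proof.
move=> hF hG e u; have [l ->] := pmod_lincomb u.
rewrite /lincomb (lin_sum hF) (lin_sum hG); apply: eq_bigr => t _.
by rewrite (linZ hF) (linZ hG) e.
Qed.

Lemma kills_lin (Z : lmodType K) (F : W -> Z) (f : X -> W) :
  linear F -> kills R f -> kills R (fun x => F (f x)).
Proof.
move=> hF kf r Rr; rewrite /lincomb.
under eq_bigr do rewrite -(linZ hF).
by rewrite -(lin_sum hF) -[X in F X]/(lincomb f r) (kf r Rr) (lin0 hF).
Qed.

Lemma kills_pgen (F : pmod R -> W) : linear F -> kills R (fun x => F (pgen R x)).
Proof.
move=> hF r Rr; rewrite /lincomb.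
under eq_bigr do rewrite -(linZ hF).
by rewrite -(lin_sum hF) -[X in F X]/(lincomb (pgen R) r) (pgen_kills Rr) (lin0 hF).
Qed.

End PresentedExt.

Section TensorExt.
Variables (K : fieldType) (A B : lmodType K).

Lemma ten_linl b : linear (fun a : A => ten a b : tens A B).
Proof.
move=> c a a'; have := @pgen_kills K _ (@tens_rel K A B) _ (TensL c a a' b).
rewrite /lincomb !big_cons big_nil /= addr0 scale1r scaleNr scaleN1r.
by move=> /eqP; rewrite addr_eq0 opprD !opprK => /eqP.
Qed.

Lemma ten_linr a : linear (fun b : B => ten a b : tens A B).
Proof.
move=> c b b'; have := @pgen_kills K _ (@tens_rel K A B) _ (TensR c a b b').
rewrite /lincomb !big_cons big_nil /= addr0 scale1r scaleNr scaleN1r.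
by move=> /eqP; rewrite addr_eq0 opprD !opprK => /eqP.
Qed.

Lemma tens_kills (W : lmodType K) (f : A -> B -> W) :
  (forall b, linear (f^~ b)) -> (forall a, linear (f a)) ->
  kills (@tens_rel K A B) (fun t => f t.1 t.2).
Proof.
move=> hl hr r [c a a' b|c a b b']; rewrite /lincomb !big_cons big_nil /= addr0.
  by rewrite (hl b c) scale1r scaleNr scaleN1r addrACA addrN addrN addr0.
by rewrite (hr a c) scale1r scaleNr scaleN1r addrACA addrN addrN addr0.
Qed.

Lemma plin_ten (W : lmodType K) (f : A -> B -> W) a b :
  (forall b, linear (f^~ b)) -> (forall a, linear (f a)) ->
  plin (fun t => f t.1 t.2) (ten a b) = f a b.
Proof. by move=> hl hr; rewrite plin_gen //; exact: tens_kills. Qed.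

Lemma tens_linext (W : lmodType K) (F G : tens A B -> W) :
  linear F -> linear G -> (forall a b, F (ten a b) = G (ten a b)) ->
  forall u, F u = G u.
Proof. by move=> hF hG e; apply: pmod_linext => // -[a b]; exact: e. Qed.

End TensorExt.

Section TensorMap.
Variables (K : fieldType) (A B A' B' : lmodType K).
Variables (F : A -> A') (G : B -> B').
Hypotheses (hF : linear F) (hG : linear G).

Lemma tmap_ten a b : tmap F G (ten a b) = ten (F a) (G b).
Proof.
apply: (plin_ten (f := fun a b => ten (F a) (G b))) => [b'|a'].
  exact: (lin_comp (ten_linl _) hF).
exact: (lin_comp (ten_linr _) hG).
Qed.

Lemma tmap_lin : linear (tmap F G).
Proof. exact: plin_linear. Qed.

End TensorMap.

(** * Signs and unshuffles *)

Section Sign.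
Variable K : fieldType.

Lemma ksignD m n : ksign K (m + n) = ksign K m * ksign K n.
Proof.
rewrite /ksign -signr_odd -[in RHS]signr_odd -[X in _ = _ * X]signr_odd -signr_addb.
by congr (_ ^+ _); congr nat_of_bool; lia.
Qed.

(** Equalities of signs are reduced to the ring of integers by giving half of
    the difference of the two exponents. *)
Lemma ksign_par m n k : m = n + k * 2 -> ksign K m = ksign K n.
Proof.
move=> ->; rewrite /ksign -signr_odd -[RHS]signr_odd.
by congr (_ ^+ _); congr nat_of_bool; lia.
Qed.

Lemma ksign0 : ksign K 0 = 1. Proof. by []. Qed.
Lemma ksign1 : ksign K 1 = -1. Proof. by rewrite /ksign expr1. Qed.
Lemma ksignS m : ksign K (m + 1) = - ksign K m.
Proof. by rewrite ksignD ksign1 mulrN1. Qed.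
Lemma ksign_cancel m n k : n = m + 1 + k * 2 -> ksign K m + ksign K n = 0.
Proof. by move=> h; rewrite (ksign_par h) ksignS addrN. Qed.
Lemma ksign_sq m : ksign K m * ksign K m = 1.
Proof. by rewrite -ksignD (@ksign_par _ 0 m) //; ring. Qed.
Lemma ksignZK (V : lmodType K) m (v : V) : ksign K m *: (ksign K m *: v) = v.
Proof. by rewrite scalerA ksign_sq scale1r. Qed.
Lemma ksignZ (V : lmodType K) m n (v : V) :
  ksign K m *: (ksign K n *: v) = ksign K (m + n) *: v.
Proof. by rewrite scalerA -ksignD. Qed.

End Sign.

Section Unshuffle.
Variables (K : fieldType) (V : gspace K).
Implicit Types (w a b : word V) (x y z : hel V).

Lemma wdeg_nil : wdeg ([::] : word V) = 0. Proof. exact: big_nil. Qed.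
Lemma wdeg_cons x w : wdeg (x :: w) = deg x + wdeg w. Proof. exact: big_cons. Qed.
Lemma wdeg_cat a b : wdeg (a ++ b) = wdeg a + wdeg b. Proof. exact: big_cat. Qed.

(** Coassociativity and cocommutativity are stated for these sums at the level
    of words, so that they also apply to functions that do not descend to the
    symmetric quotient, such as noncommutative products. *)
Definition usum (W : lmodType K) w (F : word V -> word V -> W) : W :=
  \sum_(t <- unshuffles w) ksign K t.1.1 *: F t.1.2 t.2.

Variable W : lmodType K.
Implicit Types F G : word V -> word V -> W.

Lemma usum_nil F : usum [::] F = F [::] [::].
Proof. by rewrite /usum big_seq1 ksign0 scale1r. Qed.

Lemma usum_cons x w F :
  usum (x :: w) F = usum w (fun a b => F (x :: a) b)
    + usum w (fun a b => ksign K (deg x * wdeg a) *: F a (x :: b)).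
Proof.
rewrite /usum /= big_flatten /= big_map -big_split /=.
apply: eq_bigr => -[[e a] b] _ /=; rewrite big_cons big_seq1 /=.
by rewrite ksignZ.
Qed.

Lemma eq_usum_deg w F G :
  (forall a b, (size a + size b)%N = size w -> wdeg a + wdeg b = wdeg w ->
     F a b = G a b) -> usum w F = usum w G.
Proof.
elim: w F G => [|x w IH] F G e.
  by rewrite !usum_nil e ?addr0 // wdeg_nil.
rewrite !usum_cons; congr (_ + _); apply: IH => a b sz dg.
  by apply: e; rewrite /= ?wdeg_cons -?dg ?addrA // -sz.
by rewrite e //= ?wdeg_cons -?dg -?sz ?addnS //; ring.
Qed.

Lemma eq_usum w F G : (forall a b, F a b = G a b) -> usum w F = usum w G.
Proof. by move=> e; apply: eq_usum_deg. Qed.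

Lemma usum0 w F : (forall a b, F a b = 0) -> usum w F = 0.
Proof. by move=> e; rewrite /usum big1 // => t _; rewrite e scaler0. Qed.

Lemma usumD w F G : usum w (fun a b => F a b + G a b) = usum w F + usum w G.
Proof.
by rewrite /usum -big_split; apply: eq_bigr => t _; rewrite scalerDr.
Qed.

Lemma usumZ c w F : usum w (fun a b => c *: F a b) = c *: usum w F.
Proof.
rewrite /usum scaler_sumr; apply: eq_bigr => t _.
by rewrite !scalerA mulrC.
Qed.

Lemma usumN w F : usum w (fun a b => - F a b) = - usum w F.
Proof.
by rewrite -scaleN1r -usumZ; apply: eq_usum => a b; rewrite scaleN1r.
Qed.

Lemma usumB w F G : usum w (fun a b => F a b - G a b) = usum w F - usum w G.
Proof. by rewrite usumD usumN. Qed.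

Lemma usum_sum (I : Type) (r : seq I) w (F : I -> word V -> word V -> W) :
  usum w (fun a b => \sum_(i <- r) F i a b) = \sum_(i <- r) usum w (F i).
Proof.
elim: r => [|i r IH]; first by rewrite big_nil usum0 // => a b; rewrite big_nil.
by rewrite big_cons -IH -usumD; apply: eq_usum => a b; rewrite big_cons.
Qed.

Lemma lin_usum (Z : lmodType K) (L : W -> Z) w F : linear L ->
  L (usum w F) = usum w (fun a b => L (F a b)).
Proof.
by move=> hL; rewrite /usum (lin_sum hL); apply: eq_bigr => t _; rewrite (linZ hL).
Qed.

Lemma usum_coassoc w (F : word V -> word V -> word V -> W) :
  usum w (fun a c => usum c (fun b1 b2 => F a b1 b2))
  = usum w (fun c b2 => usum c (fun a b1 => F a b1 b2)).
Proof.
elim: w F => [|x w IH] F; first by rewrite !usum_nil.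
rewrite !usum_cons.
under [X in _ + X = _]eq_usum => a c do rewrite usum_cons scalerDr -!usumZ.
under [X in _ = X + _]eq_usum => c b2 do rewrite usum_cons.
rewrite !usumD IH -addrA; congr (_ + _); congr (_ + _); first exact: IH.
rewrite IH; apply: eq_usum => c b2; rewrite -usumZ; apply: eq_usum_deg => a b1 _ <-.
by rewrite ksignZ; congr (ksign _ _ *: _); ring.
Qed.

Lemma usum_cocomm w F :
  usum w F = usum w (fun a b => ksign K (wdeg a * wdeg b) *: F b a).
Proof.
elim: w F => [|x w IH] F; first by rewrite !usum_nil wdeg_nil mul0r ksign0 scale1r.
rewrite !usum_cons addrC [in LHS]IH [X in _ + X = _]IH.
congr (_ + _); apply: eq_usum => a b; rewrite ksignZ wdeg_cons.
  by congr (ksign _ _ *: _); ring.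
congr (_ *: _); apply: (@ksign_par _ _ _ (- (deg x * wdeg a))); ring.
Qed.

(** Coassociativity and cocommutativity combined: extracting [a] first and then
    [b1], or [b1] first and then [a]. *)
Lemma usum_exchange w (F : word V -> word V -> word V -> W) :
  usum w (fun a c => usum c (fun b1 b2 => F a b1 b2))
  = usum w (fun b1 c => usum c (fun a b2 => ksign K (wdeg a * wdeg b1) *: F a b1 b2)).
Proof.
rewrite usum_coassoc [RHS]usum_coassoc; apply: eq_usum => c b2.
by rewrite usum_cocomm; apply: eq_usum => a b; rewrite mulrC.
Qed.

Lemma usum_cat a b F :
  usum (a ++ b) F = usum a (fun a1 a2 => usum b (fun b1 b2 =>
    ksign K (wdeg a2 * wdeg b1) *: F (a1 ++ b1) (a2 ++ b2))).
Proof.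
elim: a F => [|x a IH] F /=.
  rewrite usum_nil; apply: eq_usum => b1 b2.
  by rewrite wdeg_nil mul0r ksign0 scale1r.
rewrite !usum_cons !IH; congr (_ + _); apply: eq_usum => a1 a2.
rewrite -usumZ; apply: eq_usum => b1 b2; rewrite !ksignZ wdeg_cons wdeg_cat.
by congr (ksign _ _ *: _); ring.
Qed.

Lemma usum_rnil w F : (forall a b, b <> [::] -> F a b = 0) -> usum w F = F w [::].
Proof.
elim: w F => [|x w IH] F h; first by rewrite usum_nil.
rewrite usum_cons IH => [|a b nb]; last exact: h.
by rewrite usum0 ?addr0 // => a b; rewrite h ?scaler0.
Qed.

Lemma usum_lnil w F : (forall a b, a <> [::] -> F a b = 0) -> usum w F = F [::] w.
Proof.
elim: w F => [|x w IH] F h; first by rewrite usum_nil.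
rewrite usum_cons [X in X + _]usum0 ?add0r => [|a b]; last exact: h.
rewrite IH => [|a b na]; last by rewrite h ?scaler0.
by rewrite wdeg_nil mulr0 ksign0 scale1r.
Qed.

End Unshuffle.

(** ** One-letter unshuffles *)

Section OneLetter.
Variables (K : fieldType) (V : gspace K).
Implicit Types (w a b : word V) (x y z : hel V).

(** Extraction of one letter is the source of all the recursions on the length
    of words. *)
Definition psum (Z : lmodType K) w (F : hel V -> word V -> Z) : Z :=
  usum w (fun a b => if a is [:: x] then F x b else 0).

Definition psumr (Z : lmodType K) w (F : word V -> hel V -> Z) : Z :=
  usum w (fun a b => if b is [:: x] then F a x else 0).

Variable W : lmodType K.
Implicit Types f g : hel V -> word V -> W.

Lemma psum_nil f : psum [::] f = 0. Proof. exact: usum_nil. Qed.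

Lemma psum_cons x w f :
  psum (x :: w) f
  = f x w + psum w (fun y b => ksign K (deg x * deg y) *: f y (x :: b)).
Proof.
rewrite /psum usum_cons usum_lnil => [|[//|y a] b _ //]; congr (_ + _).
apply: eq_usum => -[|y [|z a]] b; rewrite ?scaler0 //.
by rewrite wdeg_cons wdeg_nil addr0.
Qed.

Lemma eq_psum_deg w f g :
  (forall x b, (size b).+1 = size w -> deg x + wdeg b = wdeg w -> f x b = g x b) ->
  psum w f = psum w g.
Proof.
move=> e; apply: eq_usum_deg => -[|x [|y a]] b // sz dg.
by apply: e => //; rewrite -dg wdeg_cons wdeg_nil addr0.
Qed.

Lemma eq_psum w f g : (forall x b, f x b = g x b) -> psum w f = psum w g.
Proof. by move=> e; apply: eq_psum_deg. Qed.

Lemma psum0 w f : (forall x b, f x b = 0) -> psum w f = 0.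
Proof. by move=> e; apply: usum0 => -[|x [|y a]] b //; exact: e. Qed.

Lemma psumD w f g : psum w (fun x b => f x b + g x b) = psum w f + psum w g.
Proof.
by rewrite -usumD; apply: eq_usum => -[|x [|y a]] b; rewrite ?addr0.
Qed.

Lemma psumB w f g : psum w (fun x b => f x b - g x b) = psum w f - psum w g.
Proof.
by rewrite -usumB; apply: eq_usum => -[|x [|y a]] b; rewrite ?subr0.
Qed.

Lemma psumZ c w f : psum w (fun x b => c *: f x b) = c *: psum w f.
Proof.
by rewrite -usumZ; apply: eq_usum => -[|x [|y a]] b; rewrite ?scaler0.
Qed.

Lemma lin_psum (Z : lmodType K) (L : W -> Z) w f : linear L ->
  L (psum w f) = psum w (fun x b => L (f x b)).
Proof.
move=> hL; rewrite (lin_usum _ _ hL).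
by apply: eq_usum => -[|x [|y a]] b; rewrite ?(lin0 hL).
Qed.

Lemma psumr_psum w (f : word V -> hel V -> W) :
  psumr w f = psum w (fun x b => ksign K (deg x * wdeg b) *: f b x).
Proof.
rewrite /psumr usum_cocomm; apply: eq_usum => -[|x [|y a]] b; rewrite ?scaler0 //.
by rewrite wdeg_cons wdeg_nil addr0.
Qed.

Lemma psum_usum_coassoc w (F : hel V -> word V -> word V -> W) :
  psum w (fun x c => usum c (fun a b => F x a b))
  = usum w (fun c b => psum c (fun x a => F x a b)).
Proof.
pose G (a b1 b2 : word V) := if a is [:: x] then F x b1 b2 else 0.
transitivity (usum w (fun a c => usum c (G a))); last exact: usum_coassoc.
by apply: eq_usum => -[|x [|y a]] c //; rewrite usum0.
Qed.

Lemma psum_usum_exchange w (F : hel V -> word V -> word V -> W) :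
  psum w (fun x c => usum c (fun a b => F x a b))
  = usum w (fun a c => psum c (fun x b => ksign K (deg x * wdeg a) *: F x a b)).
Proof.
transitivity (usum w (fun a c => usum c (fun b1 b2 =>
   if a is [:: x] then F x b1 b2 else 0))).
  by apply: eq_usum => -[|x [|y a]] c //; rewrite usum0.
rewrite usum_exchange; apply: eq_usum => b1 c.
apply: eq_usum => -[|x [|y a]] b2; rewrite ?scaler0 //.
by rewrite wdeg_cons wdeg_nil addr0.
Qed.

Lemma psum_exchange w (F : hel V -> hel V -> word V -> W) :
  psum w (fun x c => psum c (fun y b => F x y b))
  = psum w (fun y c => psum c (fun x b => ksign K (deg x * deg y) *: F x y b)).
Proof.
rewrite [LHS]psum_usum_exchange; apply: eq_usum => -[|y [|z a]] c.
- by apply: psum0 => x b; rewrite scaler0.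
- by apply: eq_psum => x b; rewrite wdeg_cons wdeg_nil addr0.
- by apply: psum0 => x b; rewrite scaler0.
Qed.

Lemma usum_psumr_coassoc w (F : word V -> word V -> hel V -> W) :
  usum w (fun a c => psumr c (fun b x => F a b x))
  = psumr w (fun c x => usum c (fun a b => F a b x)).
Proof.
rewrite [LHS]usum_coassoc; apply: eq_usum => c [|x [|y b]] //.
- exact: usum0.
- exact: usum0.
Qed.

Lemma psum_psumr w (F : hel V -> word V -> hel V -> W) :
  psum w (fun x c => psumr c (fun a y => F x a y))
  = psumr w (fun c y => psum c (fun x a => F x a y)).
Proof.
rewrite [LHS]psum_usum_coassoc; apply: eq_usum => c [|x [|y b]] //.
- by apply: psum0.
- by apply: psum0.
Qed.

Lemma psum_cat a b f :
  psum (a ++ b) f = psum a (fun x a' => f x (a' ++ b))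
    + psum b (fun x b' => ksign K (wdeg a * deg x) *: f x (a ++ b')).
Proof.
elim: a f => [|y a IH] f /=.
  rewrite psum_nil add0r; apply: eq_psum => x b'.
  by rewrite wdeg_nil mul0r ksign0 scale1r.
rewrite !psum_cons IH -addrA; congr (_ + (_ + _)).
apply: eq_psum => x b'; rewrite ksignZ wdeg_cons.
by congr (ksign _ _ *: _); ring.
Qed.

End OneLetter.

Lemma usum_map (K : fieldType) (V V' : gspace K) (W : lmodType K) (h : hel V -> hel V')
    (w : word V) (F : word V' -> word V' -> W) :
  (forall x, deg (h x) = deg x) ->
  usum (map h w) F = usum w (fun a b => F (map h a) (map h b)).
Proof.
move=> hd; elim: w F => [|x w IH] F /=; first by rewrite !usum_nil.
rewrite !usum_cons !IH hd; congr (_ + _); apply: eq_usum => a b.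
by congr (ksign _ (_ * _) *: _); rewrite /wdeg big_map; apply: eq_bigr.
Qed.

Lemma wdeg_map (K : fieldType) (V V' : gspace K) (h : hel V -> hel V') (w : word V) :
  (forall x, deg (h x) = deg x) -> wdeg (map h w) = wdeg w.
Proof. by move=> hd; rewrite /wdeg big_map; apply: eq_bigr. Qed.

Lemma psum_map (K : fieldType) (V V' : gspace K) (W : lmodType K) (h : hel V -> hel V')
    (w : word V) (F : hel V' -> word V' -> W) :
  (forall x, deg (h x) = deg x) ->
  psum (map h w) F = psum w (fun x b => F (h x) (map h b)).
Proof. by move=> hd; rewrite /psum usum_map //; apply: eq_usum => -[|x [|y a]]. Qed.

Lemma lin_psumr (K : fieldType) (V : gspace K) (W Z : lmodType K) (M : W -> Z) (w : word V)
    (f : word V -> hel V -> W) : linear M ->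
  M (psumr w f) = psumr w (fun a z => M (f a z)).
Proof.
move=> lM; rewrite !psumr_psum (lin_psum _ _ lM).
by apply: eq_psum => z b; rewrite (linZ lM).
Qed.

Lemma eq_psumr (K : fieldType) (V : gspace K) (W : lmodType K) (w : word V)
    (f g : word V -> hel V -> W) :
  (forall a z, f a z = g a z) -> psumr w f = psumr w g.
Proof. by move=> e; rewrite !psumr_psum; apply: eq_psum => z b; rewrite e. Qed.


(** * Functions on words that descend to the symmetric coalgebra *)

Section Homogeneous.
Variables (K : fieldType) (V : gspace K).
Implicit Types (x y z : hel V) (v : V).

Lemma homog_vec x : homog (deg x) (vec x).
Proof. exact: (valP x). Qed.

Lemma gproj_vec x : gproj (deg x) (vec x) = vec x.
Proof. exact/eqP/homog_vec. Qed.

Lemma hel_eq x y : deg x = deg y -> vec x = vec y -> x = y.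
Proof.
case: x y => -[i v] hx [[j w] hy]; rewrite /deg /vec /= => eij evw.
by apply: val_inj; rewrite /= eij evw.
Qed.

Lemma mkhel_vec x : mkhel (deg x) (vec x) = x.
Proof. by apply: hel_eq => //; exact: gproj_vec. Qed.

Lemma homog_lin i c u v : homog i u -> homog i v -> homog i (c *: u + v : V).
Proof. by move=> /eqP hu /eqP hv; rewrite /homog gproj_linear hu hv. Qed.

Lemma homog0 i : homog i (0 : V).
Proof. by rewrite /homog gproj0. Qed.

Lemma homogZ i c v : homog i v -> homog i (c *: v).
Proof. by move=> hv; rewrite -[_ *: _]addr0; apply: homog_lin; rewrite ?homog0. Qed.

Lemma homogD i u v : homog i u -> homog i v -> homog i (u + v : V).
Proof. by move=> hu hv; rewrite -[u]scale1r; exact: homog_lin. Qed.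

Lemma homogN i v : homog i v -> homog i (- v).
Proof. by move=> hv; rewrite -scaleN1r; exact: homogZ. Qed.

End Homogeneous.

Section Multilinear.
Variables (K : fieldType) (V : gspace K).
Implicit Types (u v w : word V) (x y z : hel V).

(** Compatibility with each of the two families of relators of [Sym]; the first
    family is shared with the enveloping algebra. *)
Definition multilin (W : lmodType K) (f : word V -> W) := forall c x y z u v,
  deg x = deg z -> deg y = deg z -> vec z = c *: vec x + vec y ->
  f (u ++ z :: v) = c *: f (u ++ x :: v) + f (u ++ y :: v).

Definition gsym (W : lmodType K) (f : word V -> W) := forall x y u v,
  f (u ++ x :: y :: v) = ksign K (deg x * deg y) *: f (u ++ y :: x :: v).

Notation skills := (kills (@sym_rel K V)).

Lemma sym_killsP (W : lmodType K) (f : word V -> W) :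
  skills f <-> multilin f /\ gsym f.
Proof.
split=> [kf|[ml gs] r].
  split=> [c x y z u v hx hy hz|x y u v].
    have := kf _ (SymLin u v hx hy hz).
    rewrite /lincomb !big_cons big_nil /= addr0 scale1r scaleNr scaleN1r.
    by move=> /eqP; rewrite addr_eq0 opprD !opprK => /eqP.
  have := kf _ (SymSwap x y u v).
  rewrite /lincomb !big_cons big_nil /= addr0 scale1r scaleNr.
  by move=> /eqP; rewrite subr_eq0 => /eqP.
case=> [c x y z u v hx hy hz|x y u v]; rewrite /lincomb !big_cons big_nil /= addr0.
  by rewrite (ml c x y z) // scale1r scaleNr scaleN1r addrACA addrN addrN addr0.
by rewrite (gs x y) scale1r scaleNr addrN.
Qed.

Lemma multilin_zero (W : lmodType K) (f : word V -> W) u x v :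
  multilin f -> vec x = 0 -> f (u ++ x :: v) = 0.
Proof.
move=> ml x0; have := ml (-1) x x x u v erefl erefl.
by rewrite x0 scaler0 addr0 scaleN1r addNr; apply.
Qed.

Lemma multilin_mkhel (W : lmodType K) (f : word V -> W) n u v :
  multilin f -> linear (fun t => f (u ++ mkhel n t :: v)).
Proof.
move=> ml c s t; apply: ml => //=.
by rewrite /vec /= gproj_linear.
Qed.

Lemma wdeg_lin x z u v : deg x = deg z -> wdeg (u ++ x :: v) = wdeg (u ++ z :: v).
Proof. by move=> e; rewrite !wdeg_cat !wdeg_cons e. Qed.

Lemma wdeg_swap x y u v : wdeg (u ++ x :: y :: v) = wdeg (u ++ y :: x :: v).
Proof. by rewrite !wdeg_cat !wdeg_cons; ring. Qed.

(** The relators are homogeneous for the degree and for the length, so that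
    coefficients depending on these can be inserted. *)
Lemma multilin_graded (W Z : lmodType K) (q : word V -> W) (f : int -> nat -> W -> Z) :
  (forall n m, linear (f n m)) -> multilin q ->
  multilin (fun w => f (wdeg w) (size w) (q w)).
Proof.
move=> hf ml c x y z u v hx hy hz; rewrite (ml c x y z) //.
by rewrite hf (wdeg_lin u v hx) (wdeg_lin u v hy) !size_cat.
Qed.

Lemma kills_graded (W Z : lmodType K) (q : word V -> W) (f : int -> nat -> W -> Z) :
  (forall n m, linear (f n m)) -> skills q ->
  skills (fun w => f (wdeg w) (size w) (q w)).
Proof.
move=> hf /sym_killsP [ml gs]; apply/sym_killsP; split.
  exact: (multilin_graded hf).
move=> x y u v; rewrite gs (linZ (hf _ _)) (wdeg_swap x y) !size_cat //.
Qed.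

Lemma kills_cons (W : lmodType K) (f : word V -> W) u :
  skills f -> skills (fun w => f (u ++ w)).
Proof.
move=> /sym_killsP [ml gs]; apply/sym_killsP; split.
  by move=> c x y z a b hx hy hz; rewrite !catA (ml c x y z).
by move=> x y a b; rewrite !catA gs.
Qed.

Lemma kills_zero (W : lmodType K) : skills (fun _ => 0 : W).
Proof.
move=> r _; rewrite /lincomb big1 // => t _; exact: scaler0.
Qed.

Lemma kills_add (W : lmodType K) (f g : word V -> W) :
  skills f -> skills g -> skills (fun w => f w + g w).
Proof.
move=> kf kg r Rr; rewrite /lincomb.
under eq_bigr do rewrite scalerDr.
by rewrite big_split /= -[X in X + _]/(lincomb f r) -[X in _ + X]/(lincomb g r) kf ?kg ?addr0.
Qed.

Lemma kills_ext (W : lmodType K) (f g : word V -> W) :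
  (forall w, f w = g w) -> skills f -> skills g.
Proof.
by move=> e kf r Rr; rewrite -[RHS](kf r Rr); apply: eq_bigr => t _; rewrite e.
Qed.

Lemma kills_scale (W : lmodType K) c (f : word V -> W) :
  skills f -> skills (fun w => c *: f w).
Proof. by apply: kills_lin => a u v; rewrite scalerDr !scalerA mulrC. Qed.

Lemma kills_scale_deg (W : lmodType K) k (f : word V -> W) :
  skills f -> skills (fun w => ksign K (k * wdeg w) *: f w).
Proof.
apply: (@kills_graded W W f (fun n _ t => ksign K (k * n) *: t)).
by move=> n m; apply: lin_scale.
Qed.

(** The coproduct, the coderivations and all convolution products descend to
    [Sym] by this lemma.  Induction on the common prefix reduces it to relators
    at the beginning of a word, where the terms are matched one by one. *)
Lemma usum_kills (W : lmodType K) (F : word V -> word V -> W) :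
  (forall b, skills (F^~ b)) -> (forall a, skills (F a)) ->
  skills (fun w => usum w F).
Proof.
move=> hl hr; apply/sym_killsP; split.
  move=> c x y z u v hx hy hz; elim: u F hl hr => [|t u IH] F hl hr /=.
    rewrite !usum_cons scalerDr addrACA; congr (_ + _); rewrite -usumZ -usumD;
      apply: eq_usum => a b.
      by have [ml _] := (sym_killsP _).1 (hl b); exact: (ml c x y z [::]).
    have [ml _] := (sym_killsP _).1 (hr a).
    rewrite (ml c x y z [::]) // scalerDr !scalerA mulrC.
    by rewrite hx hy.
  rewrite !usum_cons scalerDr addrACA; congr (_ + _); apply: IH => [b|a].
  - exact: (kills_cons [:: t] (hl b)).
  - exact: hr.
  - exact: kills_scale_deg.
  - by apply: kills_scale; exact: (kills_cons [:: t] (hr a)).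
move=> x y u v; elim: u F hl hr => [|t u IH] F hl hr /=.
  rewrite !usum_cons !scalerDr -!usumZ.
  rewrite -[LHS]addrA [X in _ + X]addrA -[RHS]addrA [X in _ = _ + X]addrA.
  rewrite [X in _ = _ + (X + _)]addrC.
  congr (_ + (_ + _ + _)); apply: eq_usum => a b; rewrite ?ksignZ ?wdeg_cons.
  - by have [_ gs] := (sym_killsP _).1 (hl b); exact: (gs x y [::]).
  - congr (_ *: _); apply: (@ksign_par _ _ _ (- (deg x * deg y))); ring.
  - congr (_ *: _); apply: (@ksign_par _ _ _ 0); ring.
  - have [_ gs] := (sym_killsP _).1 (hr a).
    rewrite (gs x y [::]) ksignZ; congr (ksign _ _ *: _); ring.
rewrite !usum_cons scalerDr; congr (_ + _); apply: IH => [b|a].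
- exact: (kills_cons [:: t] (hl b)).
- exact: hr.
- exact: kills_scale_deg.
- by apply: kills_scale; exact: (kills_cons [:: t] (hr a)).
Qed.

Lemma psum_kills (W : lmodType K) (F : hel V -> word V -> W) :
  (forall c x y z b, deg x = deg z -> deg y = deg z -> vec z = c *: vec x + vec y ->
     F z b = c *: F x b + F y b) ->
  (forall x, skills (F x)) ->
  skills (fun w => psum w F).
Proof.
move=> hl hr; apply: usum_kills => [b|[|x [|y a]]]; try exact: kills_zero.
  apply/sym_killsP; split=> [c x y z [|u1 [|u2 u]] [|v1 v] hx hy hz /=|x y [|u1 [|u2 u]] v /=];
    rewrite ?scaler0 ?addr0 //.
  exact: hl.
exact: hr.
Qed.

End Multilinear.

Notation skills := (kills (@sym_rel _ _)).

(** * The symmetric coalgebra *)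

Section SymCoalgebra.
Variables (K : fieldType) (V : gspace K).
Implicit Types (u v w : word V) (x y z : hel V).

Lemma sgen_kills : skills (@sgen K V).
Proof. exact: pgen_kills. Qed.

Lemma sgen_multilin : multilin (@sgen K V).
Proof. by have [] := (sym_killsP _).1 sgen_kills. Qed.

Lemma sgen_swap : gsym (@sgen K V).
Proof. by have [] := (sym_killsP _).1 sgen_kills. Qed.

Lemma sgen_zero u x v : vec x = 0 -> sgen (u ++ x :: v) = 0.
Proof. exact: (multilin_zero _ _ sgen_multilin). Qed.

Lemma Sym_linext (W : lmodType K) (F G : Sym V -> W) : linear F -> linear G ->
  (forall w, F (sgen w) = G (sgen w)) -> forall t, F t = G t.
Proof. exact: pmod_linext. Qed.

Lemma sgen_move x u v :
  sgen (u ++ x :: v) = ksign K (deg x * wdeg u) *: sgen (x :: u ++ v).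
Proof.
elim: u => [|y u IH] /=; first by rewrite wdeg_nil mulr0 ksign0 scale1r.
have := kills_cons [:: y] sgen_kills; move/sym_killsP => [_ gs].
have hp : skills (fun w => sgen (y :: w)) by exact: (kills_cons [:: y] sgen_kills).
have e : plin (fun w => sgen (y :: w)) (sgen (u ++ x :: v))
      = plin (fun w => sgen (y :: w)) (ksign K (deg x * wdeg u) *: sgen (x :: u ++ v)).
  by rewrite IH.
move: e; rewrite plin_gen // (linZ (plin_linear _)) plin_gen // => ->.
rewrite (sgen_swap y x [::]) ksignZ wdeg_cons.
by congr (ksign _ _ *: _); ring.
Qed.

Definition pre u : Sym V -> Sym V := plin (fun w => sgen (u ++ w)).

Lemma pre_lin u : linear (pre u). Proof. exact: plin_linear. Qed.

Lemma pre_sgen u w : pre u (sgen w) = sgen (u ++ w).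
Proof. by rewrite /pre plin_gen //; apply: kills_cons; exact: sgen_kills. Qed.

Lemma Delta_kills : skills (fun w => usum w (fun a b => ten (sgen a) (sgen b))).
Proof.
apply: usum_kills => [b|a].
  exact: (kills_lin (ten_linl (sgen b)) sgen_kills).
exact: (kills_lin (ten_linr (sgen a)) sgen_kills).
Qed.

Lemma Delta_lin : linear (@Delta K V). Proof. exact: plin_linear. Qed.

Lemma Delta_sgen w : Delta (sgen w) = usum w (fun a b => ten (sgen a) (sgen b)).
Proof. by rewrite /Delta plin_gen //; exact: Delta_kills. Qed.

Lemma scounit_kills : skills (fun w : word V => (w == [::])%:R : K^o).
Proof.
apply/sym_killsP; split=> [c x y z [|u1 u] v _ _ _ /=|x y [|u1 u] v /=];
  by rewrite ?scaler0 ?addr0.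
Qed.

Lemma scounit_lin : linear (@scounit K V). Proof. exact: plin_linear. Qed.

Lemma scounit_sgen w : scounit (sgen w) = (w == [::])%:R.
Proof. by rewrite /scounit plin_gen //; exact: scounit_kills. Qed.

Lemma sproj1_kills : skills (fun w : word V => if w is [:: x] then vec x else 0).
Proof.
apply/sym_killsP; split=>
  [c x y z [|u1 [|u2 u]] [|v1 v] _ _ hz /=|x y [|u1 [|u2 u]] v /=];
  by rewrite ?scaler0 ?addr0.
Qed.

Lemma sproj1_lin : linear (@sproj1 K V). Proof. exact: plin_linear. Qed.

Lemma sproj1_sgen w : sproj1 (sgen w) = if w is [:: x] then vec x else 0.
Proof. by rewrite /sproj1 plin_gen //; exact: sproj1_kills. Qed.

Lemma spart_kills n : skills (fun w : word V => if wdeg w == n then sgen w else 0).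
Proof.
apply: (@kills_graded K V _ _ (@sgen K V) (fun m _ t => if m == n then t else 0));
  last exact: sgen_kills.
by move=> m _ c s t; case: eqP => // _; rewrite scaler0 addr0.
Qed.

Lemma spart_lin n : linear (@spart K V n). Proof. exact: plin_linear. Qed.

Lemma spart_sgen n w : spart n (sgen w) = if wdeg w == n then sgen w else 0.
Proof. by rewrite /spart plin_gen //; exact: spart_kills. Qed.

Lemma stwist_kills k : skills (fun w : word V => ksign K (k * wdeg w) *: sgen w).
Proof. by apply: kills_scale_deg; exact: sgen_kills. Qed.

Lemma stwist_lin k : linear (@stwist K V k). Proof. exact: plin_linear. Qed.

Lemma stwist_sgen k w : stwist k (sgen w) = ksign K (k * wdeg w) *: sgen w.
Proof. by rewrite /stwist plin_gen //; exact: stwist_kills. Qed.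

Lemma shomog_sgen n w : wdeg w = n -> shomog n (sgen w).
Proof. by move=> e; rewrite /shomog spart_sgen e eqxx. Qed.

Lemma shomogZ n c (u : Sym V) : shomog n u -> shomog n (c *: u).
Proof. by move=> h; rewrite /shomog (linZ (spart_lin n)) h. Qed.

Lemma shomogD n (u v : Sym V) : shomog n u -> shomog n v -> shomog n (u + v).
Proof. by move=> h h'; rewrite /shomog (linD (spart_lin n)) h h'. Qed.

Lemma shomog_usum n w (F : word V -> word V -> Sym V) :
  (forall a b, wdeg a + wdeg b = wdeg w -> shomog n (F a b)) -> shomog n (usum w F).
Proof.
move=> h; rewrite /shomog (lin_usum _ _ (spart_lin n)).
by apply: eq_usum_deg => a b _ /h.
Qed.

Lemma shomog_psum n w (F : hel V -> word V -> Sym V) :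
  (forall x b, (size b).+1 = size w -> deg x + wdeg b = wdeg w -> shomog n (F x b)) ->
  shomog n (psum w F).
Proof.
by move=> h; rewrite /shomog (lin_psum _ _ (spart_lin n)); apply: eq_psum_deg.
Qed.

(** A word is recovered by putting any of its letters in front. *)
Lemma psum_sgen w : psum w (fun x b => sgen (x :: b)) = (size w)%:R *: sgen w.
Proof.
elim: w => [|x w IH]; first by rewrite psum_nil scale0r.
rewrite psum_cons (eq_psum _ (g := fun y b => pre [:: x] (sgen (y :: b)))).
  by rewrite -(lin_psum _ _ (pre_lin _)) IH (linZ (pre_lin _)) pre_sgen -[X in X + _]scale1r
     -scalerDl -natr1 addrC.
by move=> y b; rewrite pre_sgen (sgen_swap x y [::]) mulrC.
Qed.

End SymCoalgebra.

(** * Coderivations *)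

Section Euler.
Variables (K : fieldType) (V : gspace K).
Implicit Types (a b w : word V) (x y z : hel V) (u v : Sym V).

Lemma spart_spart n m u : spart n (spart m u) = if n == m then spart m u else 0.
Proof.
move: u; apply: Sym_linext.
- exact: lin_comp (spart_lin _) (spart_lin _).
- by case: eqP => _; [exact: spart_lin | exact: lin_zero].
move=> w; rewrite spart_sgen; case: (wdeg w =P m) => [<-|_].
  by rewrite spart_sgen eq_sym.
by rewrite (lin0 (spart_lin n)) if_same.
Qed.

Lemma spart_other n m u : shomog m u -> n != m -> spart n u = 0.
Proof. by move=> <- nm; rewrite spart_spart (negPf nm). Qed.

Lemma shomog_twist k n u : shomog n u -> stwist k u = ksign K (k * n) *: u.
Proof.
move=> <-; move: u; apply: Sym_linext.
- exact: lin_comp (stwist_lin _) (spart_lin _).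
- exact: lin_scale (spart_lin _).
move=> w; rewrite spart_sgen; case: eqP => [<-|_]; first exact: stwist_sgen.
by rewrite (lin0 (stwist_lin k)) scaler0.
Qed.

Lemma lead_kills v : skills (fun w => if w is [:: x] then pre [:: x] v else 0).
Proof.
apply/sym_killsP; split=>
  [c x y z [|u1 [|u2 u]] [|v1 v'] hx hy hz /=|x y [|u1 [|u2 u]] v' /=];
  rewrite ?scaler0 ?addr0 //.
move: v; apply: Sym_linext.
- exact: pre_lin.
- by apply: lin_add (pre_lin _); apply: lin_scale (pre_lin _).
move=> w; rewrite !pre_sgen; exact: (sgen_multilin [::] w hx hy hz).
Qed.

(** The product [u, v |-> (p u) (.) v], where [p] is the projection onto words
    of length one; composed with the coproduct it is the Euler operator. *)
Definition lead u v : Sym V := plin (fun w => if w is [:: x] then pre [:: x] v else 0) u.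

Lemma lead_sgen w v : lead (sgen w) v = if w is [:: x] then pre [:: x] v else 0.
Proof. by rewrite /lead plin_gen //; exact: lead_kills. Qed.

Lemma lead_linl v : linear (lead^~ v). Proof. exact: plin_linear. Qed.

Lemma lead_linr u : linear (lead u).
Proof.
move=> c v v'; move: u; apply: Sym_linext.
- exact: lead_linl.
- by apply: lin_add; [apply: lin_scale|]; exact: lead_linl.
by move=> [|x [|y w]]; rewrite !lead_sgen ?scaler0 ?addr0 // pre_lin.
Qed.

Lemma lead_shomog n u v : shomog n u -> lead u v = pre [:: mkhel n (sproj1 u)] v.
Proof.
have hp : linear (fun t => pre [:: mkhel n t] v).
  move=> c s t; move: v; apply: Sym_linext.
  - exact: pre_lin.
  - by apply: lin_add (pre_lin _); apply: lin_scale (pre_lin _).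
  move=> w; rewrite !pre_sgen.
  exact: (multilin_mkhel n [::] w (@sgen_multilin K V)).
move=> <-; move: u; apply: Sym_linext.
- exact: lin_comp (lead_linl v) (spart_lin n).
- exact: (lin_comp hp (lin_comp (@sproj1_lin K V) (spart_lin n))).
move=> w; rewrite spart_sgen; case: eqP => [e|_]; last first.
  by rewrite (lin0 (lead_linl v)) (lin0 (@sproj1_lin K V)) (lin0 hp).
rewrite lead_sgen sproj1_sgen; case: w e => [|x [|y w]] e; rewrite ?(lin0 hp) //.
by rewrite -e wdeg_cons wdeg_nil addr0 mkhel_vec.
Qed.

Definition euler u : Sym V := plin (fun t => lead t.1 t.2) (Delta u).

Lemma euler_lin : linear euler.
Proof. exact: lin_comp (plin_linear _) (@Delta_lin K V). Qed.

Lemma lead_ten u v : plin (fun t => lead t.1 t.2) (ten u v) = lead u v.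
Proof. by apply: plin_ten => *; [exact: lead_linl | exact: lead_linr]. Qed.

Lemma euler_sgen w : euler (sgen w) = (size w)%:R *: sgen w.
Proof.
rewrite /euler Delta_sgen (lin_usum _ _ (plin_linear _)) -psum_sgen.
apply: eq_usum => a b; rewrite lead_ten lead_sgen.
by case: a => [|x [|y a]] //; rewrite pre_sgen.
Qed.

Definition ssize n : Sym V -> Sym V :=
  plin (fun w => if size w == n then sgen w else 0).

Lemma ssize_lin n : linear (ssize n). Proof. exact: plin_linear. Qed.

Lemma ssize_sgen n w : ssize n (sgen w) = if size w == n then sgen w else 0.
Proof.
rewrite /ssize plin_gen //.
apply: (@kills_graded K V _ _ (@sgen K V) (fun _ m t => if m == n then t else 0));
  last exact: sgen_kills.
by move=> _ m c s t; case: eqP => // _; rewrite scaler0 addr0.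
Qed.

Lemma ssize_euler n u : ssize n (euler u) = n%:R *: ssize n u.
Proof.
move: u; apply: Sym_linext.
- exact: lin_comp (ssize_lin n) euler_lin.
- exact: lin_scale (ssize_lin n).
move=> w; rewrite euler_sgen (linZ (ssize_lin n)) ssize_sgen.
by case: eqP => [->|_] //; rewrite !scaler0.
Qed.

(** An element is a combination of finitely many words, hence the sum of its
    components of bounded length. *)
Lemma ssize_inj u : (forall n, ssize n u = 0) -> u = 0.
Proof.
move=> h; have [l e] := pmod_lincomb u.
pose N := (\max_(t <- l) size t.2).+1.
suff -> : u = \sum_(n < N) ssize n u by rewrite big1.
rewrite e /lincomb; under [RHS]eq_bigr => n _ do rewrite (lin_sum (ssize_lin n)).
rewrite exchange_big big_seq [RHS]big_seq /=; apply: eq_bigr => t tl.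
have tN : (size t.2 < N)%N.
  by rewrite ltnS /N; apply: (@leq_bigmax_seq _ l xpredT (fun t : K * word V => size t.2)).
rewrite (bigD1 (Ordinal tN)) //= big1 ?addr0.
  by rewrite (linZ (ssize_lin _)) ssize_sgen eqxx.
move=> i; rewrite -val_eqE /= eq_sym => /negPf ni.
by rewrite (linZ (ssize_lin _)) ssize_sgen ni scaler0.
Qed.

Lemma ssize0 u : ssize 0 u = (scounit u : K) *: sone V.
Proof.
move: u; apply: Sym_linext; first exact: ssize_lin.
  by move=> c u v; rewrite (@scounit_lin K V) scalerDl -scalerA.
move=> w; rewrite ssize_sgen scounit_sgen size_eq0.
by case: eqP => [->|_]; rewrite ?scale1r ?scale0r.
Qed.

End Euler.

Section Coderivation.
Variables (K : fieldType) (V : gspace K).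
Implicit Types (a b w : word V) (x y z : hel V) (u v : Sym V).

Lemma sdegP (W : gspace K) k (F : Sym V -> Sym W) : linear F ->
  (forall w, shomog (wdeg w + k) (F (sgen w))) -> sdeg_map k F.
Proof.
move=> hF h; split=> // n u <-; rewrite /shomog.
move: u; apply: Sym_linext.
- exact: lin_comp (spart_lin _) (lin_comp hF (spart_lin n)).
- exact: lin_comp hF (spart_lin n).
move=> w; rewrite spart_sgen; case: eqP => [<-|_]; first exact: h.
by rewrite (lin0 hF) (lin0 (spart_lin _)).
Qed.

Lemma sdeg_sgen (W : gspace K) k (F : Sym V -> Sym W) w :
  sdeg_map k F -> shomog (wdeg w + k) (F (sgen w)).
Proof. by move=> [_ h]; apply: h; exact: shomog_sgen. Qed.

Lemma sdeg_spart (W : gspace K) k (F : Sym V -> Sym W) n u :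
  sdeg_map k F -> F (spart n u) = spart (n + k) (F u).
Proof.
move=> hF; have [lF _] := hF; move: u; apply: Sym_linext.
- exact: lin_comp lF (spart_lin n).
- exact: lin_comp (spart_lin _) lF.
move=> w; rewrite spart_sgen; case: eqP => [<-|/eqP nw].
  by rewrite (sdeg_sgen w hF).
rewrite (lin0 lF) (spart_other (sdeg_sgen w hF)) //.
by rewrite (inj_eq (addIr k)) eq_sym.
Qed.

Lemma sdeg_twist (W : gspace K) k l (F : Sym V -> Sym W) u : sdeg_map l F ->
  stwist k (F u) = ksign K (k * l) *: F (stwist k u).
Proof.
move=> hF; have [lF _] := hF; move: u; apply: Sym_linext.
- exact: lin_comp (stwist_lin k) lF.
- exact: lin_scale (lin_comp lF (stwist_lin k)).
move=> w; rewrite (shomog_twist k (sdeg_sgen w hF)) stwist_sgen (linZ lF) ksignZ.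
by congr (ksign _ _ *: _); ring.
Qed.

Lemma sdeg_twist0 (W : gspace K) k (F : Sym V -> Sym W) u : sdeg_map 0 F ->
  stwist k (F u) = F (stwist k u).
Proof. by move=> hF; rewrite (sdeg_twist k u hF) mulr0 ksign0 scale1r. Qed.

(** ** The coderivation with given Taylor coefficients *)

Definition coefs k (q : word V -> V) :=
  skills q /\ forall w, homog (k + wdeg w) (q w).

Lemma coder_kills k (q : word V -> V) : skills q ->
  skills (fun w => usum w (fun a b => sgen (mkhel (k + wdeg a) (q a) :: b))).
Proof.
move=> kq; apply: usum_kills => [b|a].
  apply: (@kills_graded K V _ _ q (fun n _ t => sgen (mkhel (k + n) t :: b))) => // n m.
  exact: (multilin_mkhel _ [::] b (@sgen_multilin K V)).
exact: (kills_cons [:: _] (@sgen_kills K V)).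
Qed.

Lemma coder_lin k q : linear (@coder K V k q). Proof. exact: plin_linear. Qed.

Lemma coder_sgen k q w : skills q ->
  coder k q (sgen w) = usum w (fun a b => sgen (mkhel (k + wdeg a) (q a) :: b)).
Proof. by move=> kq; rewrite /coder plin_gen //; exact: coder_kills. Qed.

Lemma taylor_coder k q w : coefs k q -> taylor (coder k q) w = q w.
Proof.
move=> [kq hq]; rewrite /taylor coder_sgen // (lin_usum _ _ (@sproj1_lin K V)).
rewrite usum_rnil => [|a [//|y b] _]; rewrite sproj1_sgen //.
exact: vec_mkhel.
Qed.

Lemma coder_sdeg k q : coefs k q -> sdeg_map k (coder k q).
Proof.
move=> [kq hq]; apply: sdegP; first exact: coder_lin.
move=> w; rewrite coder_sgen //; apply: shomog_usum => a b e.
by apply: shomog_sgen; rewrite wdeg_cons -e /deg /=; ring.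
Qed.

(** In the coproduct of [q(a) (.) c] the new letter stays on the left, which is
    coassociativity, or goes to the right, past the letters extracted from [c];
    the twist of the co-Leibniz rule accounts for the degree [k] of [q], and
    cocommutativity for the letters of [a]. *)
Lemma coder_is_coder k q : coefs k q -> is_coder k (coder k q).
Proof.
move=> cq; split; first exact: coder_sdeg.
have lQ := coder_lin k q; have kq := cq.1.
apply: Sym_linext => [||w].
- exact: lin_comp (@Delta_lin K V) lQ.
- by apply: lin_add; exact: lin_comp (tmap_lin _ _) (@Delta_lin K V).
rewrite Delta_sgen coder_sgen // (lin_usum _ _ (@Delta_lin K V)).
rewrite !(lin_usum _ _ (tmap_lin _ _)).
under eq_usum => a c do rewrite Delta_sgen usum_cons.
rewrite usumD usum_coassoc usum_exchange; congr (_ + _); apply: eq_usum => a b.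
  rewrite (tmap_ten lQ (@lin_id _ _)) coder_sgen // (lin_usum _ _ (ten_linl _)) //.
rewrite (tmap_ten (stwist_lin _) lQ) stwist_sgen coder_sgen //.
rewrite (linZ (ten_linl _)) (lin_usum _ _ (ten_linr _)) -usumZ.
apply: eq_usum => c d; rewrite ksignZ; congr (_ *: _).
by apply: (@ksign_par _ _ _ (wdeg c * wdeg a)); rewrite /deg /=; ring.
Qed.

Lemma is_coder_lin k (Q : Sym V -> Sym V) : is_coder k Q -> linear Q.
Proof. by case=> -[]. Qed.

Lemma taylor_coefs k (Q : Sym V -> Sym V) : is_coder k Q -> coefs k (taylor Q).
Proof.
move=> hQ; have lQ := is_coder_lin hQ; split.
  exact: (kills_pgen (R := @sym_rel K V) (lin_comp (@sproj1_lin K V) lQ)).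
move=> w; have h := sdeg_sgen w hQ.1; rewrite addrC /taylor -h.
move: (Q (sgen w)) (wdeg w + k) => u n; apply/eqP.
move: u; apply: Sym_linext.
- exact: lin_comp (@gproj_linear K V n) (lin_comp (@sproj1_lin K V) (spart_lin n)).
- exact: lin_comp (@sproj1_lin K V) (spart_lin n).
move=> w'; rewrite spart_sgen; case: eqP => [e|_]; last first.
  by rewrite (lin0 (@sproj1_lin K V)) gproj0.
rewrite sproj1_sgen; case: w' e => [|x [|y w']]; rewrite ?gproj0 //.
by rewrite wdeg_cons wdeg_nil addr0 => <-; exact: gproj_vec.
Qed.

Lemma is_coder_comb k (P Q : Sym V -> Sym V) c :
  is_coder k P -> is_coder k Q -> is_coder k (fun u => P u + c *: Q u).
Proof.
move=> hP hQ; have lP := is_coder_lin hP; have lQ := is_coder_lin hQ.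
have lR : linear (fun u => P u + c *: Q u).
  by apply: lin_add => //; exact: lin_scale.
split.
  split=> // n u hu; apply: shomogD; first exact: hP.1.2.
  by apply: shomogZ; exact: hQ.1.2.
move=> u; rewrite (linD (@Delta_lin K V)) (linZ (@Delta_lin K V)) hP.2 hQ.2.
move: (Delta u); apply: tens_linext.
- apply: lin_add; first by apply: lin_add; exact: tmap_lin.
  by apply: lin_scale; apply: lin_add; exact: tmap_lin.
- by apply: lin_add; exact: tmap_lin.
move=> a b; rewrite !tmap_ten //; try exact: stwist_lin.
rewrite (linD (ten_linl _)) (linZ (ten_linl _)) (linD (ten_linr _)) (linZ (ten_linr _)).
by rewrite scalerDr addrACA.
Qed.

Lemma is_coder_sub k (P Q : Sym V -> Sym V) :
  is_coder k P -> is_coder k Q -> is_coder k (fun u => P u - Q u).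
Proof.
move=> hP hQ; have := is_coder_comb (-1) hP hQ.
by congr is_coder; apply/funext => u; rewrite scaleN1r.
Qed.

(** The mixed terms of the two composites cancel, because a map of degree [l]
    commutes with the twist by [k] up to the sign [(-1)^(kl)]. *)
Lemma is_coder_comm k l (P Q : Sym V -> Sym V) :
  is_coder k P -> is_coder l Q ->
  is_coder (k + l) (fun u => P (Q u) - ksign K (k * l) *: Q (P u)).
Proof.
move=> hP hQ; have lP := is_coder_lin hP; have lQ := is_coder_lin hQ.
have lPQ := lin_comp lP lQ; have lQP := lin_comp lQ lP.
have lR : linear (fun u => P (Q u) - ksign K (k * l) *: Q (P u)).
  by apply: lin_sub => //; exact: lin_scale.
split.
  split=> // n u hu; apply: shomogD.
    by rewrite addrA addrAC; apply: hP.1.2; exact: hQ.1.2.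
  by rewrite -scaleN1r; do 2 apply: shomogZ; rewrite addrA; apply: hQ.1.2; exact: hP.1.2.
move=> u; rewrite (linB (@Delta_lin K V)) (linZ (@Delta_lin K V)) hP.2 hQ.2 hQ.2 hP.2.
move: (Delta u); apply: tens_linext.
- apply: lin_sub.
    by apply: lin_add; apply: lin_comp (tmap_lin _ _) _; apply: lin_add; exact: tmap_lin.
  apply: lin_scale.
  by apply: lin_add; apply: lin_comp (tmap_lin _ _) _; apply: lin_add; exact: tmap_lin.
- by apply: lin_add; exact: tmap_lin.
move=> a b.
rewrite !(linD (tmap_lin _ _)) !tmap_ten //; try exact: stwist_lin.
rewrite (sdeg_twist k _ hQ.1) (sdeg_twist l _ hP.1) !(linZ (ten_linl _)).
rewrite (linB (ten_linl _)) (linB (ten_linr _)) (linZ (ten_linl _)) (linZ (ten_linr _)).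
have -> : stwist k (stwist l a) = stwist (k + l) a.
  move: a; apply: Sym_linext => [||w]; try exact: stwist_lin.
    exact: lin_comp (stwist_lin _) (stwist_lin _).
  by rewrite !stwist_sgen (linZ (stwist_lin _)) stwist_sgen ksignZ -mulrDl addrC.
have -> : stwist l (stwist k a) = stwist (k + l) a.
  move: a; apply: Sym_linext => [||w]; try exact: stwist_lin.
    exact: lin_comp (stwist_lin _) (stwist_lin _).
  by rewrite !stwist_sgen (linZ (stwist_lin _)) stwist_sgen ksignZ -mulrDl.
rewrite !scalerDr !ksignZ [l * k]mulrC.
rewrite (@ksign_par K (k * l + k * l) 0 (k * l)); last ring.
rewrite ksign0 scale1r.
rewrite [in X in X - _](AC (2*2) (1*4*(2*3))) [in X in _ - X](AC (2*2) ((3*2)*(1*4))).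
by rewrite addrKA [RHS]addrACA -opprD.
Qed.

End Coderivation.

(** ** Cofreeness *)

Section Cofree.
Variables (K : fieldType) (V : gspace K).
Hypothesis char0 : [pchar K] =i pred0.
Implicit Types (a b w : word V) (x y z : hel V) (u v : Sym V).

Lemma natr_neq0 n : n.+1%:R != 0 :> K.
Proof. by rewrite (proj1 (@pcharf0P K)). Qed.

(** Applying the counit on both sides of the co-Leibniz rule gives
    [e(D u) = 2 e(D u)]. *)
Lemma scounit_coder k (D : Sym V -> Sym V) w :
  is_coder k D -> scounit (D (sgen w)) = 0.
Proof.
move=> hD; have lD := is_coder_lin hD.
pose m (u v : Sym V) : K^o := (scounit u : K) * (scounit v : K).
have ml v : linear (m^~ v).
  by move=> c u u'; rewrite /m (@scounit_lin K V) mulrDl -!mulrA.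
have mr u : linear (m u).
  by move=> c v v'; rewrite /m (@scounit_lin K V) mulrDr mulrCA.
have counit u : plin (fun t => m t.1 t.2) (Delta u) = scounit u.
  move: u; apply: Sym_linext.
  - exact: lin_comp (plin_linear _) (@Delta_lin K V).
  - exact: scounit_lin.
  move=> v; rewrite Delta_sgen (lin_usum _ _ (plin_linear _)) usum_rnil.
    by rewrite (plin_ten _ _ ml mr) /m !scounit_sgen mulr1.
  by move=> a b /eqP/negPf nb; rewrite (plin_ten _ _ ml mr) /m !scounit_sgen nb mulr0.
have := counit (D (sgen w)); rewrite hD.2 Delta_sgen (linD (plin_linear _)).
rewrite !(lin_usum _ _ (tmap_lin _ _)) !(lin_usum _ _ (plin_linear _)).
rewrite usum_rnil => [|a b /eqP/negPf nb]; last first.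
  by rewrite tmap_ten // (plin_ten _ _ ml mr) /m /= scounit_sgen nb mulr0.
rewrite usum_lnil => [|a b /eqP/negPf na]; last first.
  rewrite (tmap_ten (stwist_lin _) lD) (plin_ten _ _ ml mr) /m stwist_sgen.
  by rewrite (linZ (@scounit_lin K V)) scounit_sgen na scaler0 mul0r.
rewrite (tmap_ten lD (@lin_id _ _)) (tmap_ten (stwist_lin _) lD) !(plin_ten _ _ ml mr).
rewrite /m stwist_sgen wdeg_nil mulr0 ksign0 scale1r !scounit_sgen eqxx mulr1 mul1r.
by move=> /(canRL (addrK _)); rewrite addrN.
Qed.

Lemma euler_inj u : euler u = 0 -> scounit u = 0 -> u = 0.
Proof.
move=> e c; apply: ssize_inj => -[|n]; first by rewrite ssize0 c scale0r.
have := ssize_euler n.+1 u; rewrite e (lin0 (ssize_lin _)) => /esym/eqP.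
by rewrite scaler_eq0 (negPf (natr_neq0 n)) => /eqP.
Qed.

(** The Euler operator turns the co-Leibniz rule into a recursion on the length
    that involves only the corestriction. *)
Lemma coder_eq0 k (D : Sym V -> Sym V) :
  is_coder k D -> (forall w, taylor D w = 0) -> forall u, D u = 0.
Proof.
move=> hD t0; have lD := is_coder_lin hD.
apply: Sym_linext => [//||w]; first exact: lin_zero.
have [n] := ubnP (size w); elim: n w => // n IH w /ltnSE sz.
apply: euler_inj; last exact: scounit_coder hD.
rewrite /euler hD.2 Delta_sgen (linD (plin_linear _)).
rewrite !(lin_usum _ _ (tmap_lin _ _)) !(lin_usum _ _ (plin_linear _)).
rewrite usum0 ?add0r => [|a b]; last first.
  rewrite (tmap_ten lD (@lin_id _ _)) lead_ten (lead_shomog _ (sdeg_sgen a hD.1)).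
  rewrite [sproj1 _]t0 -[sgen b]/(id (sgen b)) pre_sgen.
  by apply: (sgen_zero [::]); rewrite /vec /= gproj0.
rewrite (@eq_usum_deg _ _ _ _ _ (fun _ _ => 0)) ?usum0 // => a b sab _.
rewrite (tmap_ten (stwist_lin _) lD) lead_ten stwist_sgen (linZ (lead_linl _)).
rewrite lead_sgen; case: a sab => [|x [|y a]] sab; rewrite ?scaler0 //.
by rewrite IH ?(lin0 (pre_lin _)) ?scaler0 //; apply: leq_trans sz; rewrite -sab.
Qed.

Lemma coder_ext k (P Q : Sym V -> Sym V) : is_coder k P -> is_coder k Q ->
  (forall w, taylor P w = taylor Q w) -> forall u, P u = Q u.
Proof.
move=> hP hQ e u; apply/eqP; rewrite -subr_eq0; apply/eqP.
apply: (coder_eq0 (is_coder_sub hP hQ)) => w.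
by rewrite /taylor (linB (@sproj1_lin K V)) -/(taylor P w) e addrN.
Qed.

Lemma coder_taylor k (Q : Sym V -> Sym V) u :
  is_coder k Q -> Q u = coder k (taylor Q) u.
Proof.
move=> hQ; have ct := taylor_coefs hQ.
apply: (coder_ext hQ (coder_is_coder ct)) => w; by rewrite taylor_coder.
Qed.

(** Since [Q^2] is half the commutator of [Q] with itself, it is again a
    coderivation, and it suffices to check that its corestriction vanishes. *)
Lemma sq_coder_eq0 (Q : Sym V -> Sym V) : is_coder 1 Q ->
  (forall w, sproj1 (Q (Q (sgen w))) = 0) -> forall u, Q (Q u) = 0.
Proof.
move=> hQ h u; have lQ := is_coder_lin hQ.
have e : Q (Q u) + Q (Q u) = 0.
  have := @coder_eq0 _ _ (is_coder_comm hQ hQ) _ u.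
  rewrite mulr1 ksign1 scaleN1r opprK; apply=> w.
  rewrite /taylor (linB (@sproj1_lin K V)) (linZ (@sproj1_lin K V)) h.
  by rewrite scaler0 subr0.
apply/eqP; have /eqP := e; rewrite -mulr2n -scaler_nat scaler_eq0.
by rewrite (negPf (natr_neq0 1)).
Qed.

End Cofree.

(** * Morphisms of coalgebras *)

Section CoalgMor.
Variables (K : fieldType).
Implicit Types V W : gspace K.

Lemma coalg_lin V W (F : Sym V -> Sym W) : is_coalg_mor F -> linear F.
Proof. by case=> -[]. Qed.

Lemma coalg_inv V W (F : Sym V -> Sym W) (G : Sym W -> Sym V) :
  is_coalg_mor F -> cancel F G -> cancel G F -> is_coalg_mor G.
Proof.
move=> hF FG GF; have lF := coalg_lin hF; have [dF cF eF uF] := hF.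
have lG : linear G.
  by move=> c u v; rewrite -[u in LHS]GF -[v in LHS]GF -lF FG.
split; first split => // n u hu.
- rewrite addr0 /shomog; apply: (can_inj FG).
  by rewrite (sdeg_spart _ _ dF) addr0 GF.
- move=> u; rewrite -[u in RHS]GF cF.
  move: (Delta (G u)) ; apply: tens_linext => [//||a b].
    exact: lin_comp (tmap_lin _ _) (tmap_lin _ _).
  by rewrite !tmap_ten // !FG.
- by move=> u; rewrite -[u in RHS]GF eF.
- by rewrite -uF FG.
Qed.

Lemma coder_conj V W (F : Sym V -> Sym W) (G : Sym W -> Sym V) k Q :
  is_coalg_mor F -> cancel F G -> cancel G F -> is_coder k Q ->
  is_coder k (fun u => F (Q (G u))).
Proof.
move=> hF FG GF hQ; have hG := coalg_inv hF FG GF.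
have [dF cF _ _] := hF; have [dG cG _ _] := hG.
have lF := coalg_lin hF; have lG := coalg_lin hG; have lQ := is_coder_lin hQ.
have lR := lin_comp lF (lin_comp lQ lG).
split.
  split=> // n u hu; rewrite -[n + k]addr0; apply: dF.2; apply: hQ.1.2.
  by rewrite -[n]addr0; apply: dG.2.
move=> u; rewrite cF hQ.2 cG; move: (Delta u); apply: tens_linext.
- apply: lin_comp (tmap_lin _ _) _; apply: lin_add;
  exact: lin_comp (tmap_lin _ _) (tmap_lin _ _).
- by apply: lin_add; exact: tmap_lin.
move=> a b; rewrite (tmap_ten lG lG) (tmap_ten lQ (@lin_id _ _)) (tmap_ten (stwist_lin _) lQ).
rewrite (linD (tmap_lin _ _)) !(tmap_ten lF lF) (tmap_ten lR (@lin_id _ _)).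
by rewrite (tmap_ten (stwist_lin _) lR) GF -(sdeg_twist0 _ _ dF) GF.
Qed.

Lemma coder_sone V k (Q : Sym V -> Sym V) : is_coder k Q -> 
  taylor Q [::] = 0 -> [pchar K] =i pred0 -> Q (sone V) = 0.
Proof.
move=> hQ t0 char0; rewrite (coder_taylor char0 _ hQ) coder_sgen; last first.
  exact: (taylor_coefs hQ).1.
by rewrite usum_nil; apply: (sgen_zero [::]); rewrite /vec /= t0 gproj0.
Qed.

End CoalgMor.

Section InverseMap.
Variables (A B : nmodType) (F : A -> B).

Lemma inverse_mapK : (forall y, exists x, F x = y) -> cancel (inverse_map F) F.
Proof.
move=> surj y; rewrite /inverse_map; case: pselect => [h|[]]; last exact: surj.
by case: cid.
Qed.

Lemma inverse_map_can : injective F -> cancel F (inverse_map F).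
Proof.
move=> inj x; rewrite /inverse_map; case: pselect => [h|[]]; last by exists x.
by apply: inj; case: cid.
Qed.

End InverseMap.

Section Unipotent.
Variables (K : fieldType) (V : gspace K).
Implicit Types (u v : Sym V).

(** The filtration by the length of words, with a strict bound. *)
Definition below n u := forall m, (n <= m)%N -> ssize m u = 0.

Lemma below_sgen n w : (size w < n)%N -> below n (sgen w : Sym V).
Proof. by move=> h m nm; rewrite ssize_sgen; case: eqP => // e; lia. Qed.

Lemma below_lin n c u v : below n u -> below n v -> below n (c *: u + v).
Proof. by move=> hu hv m nm; rewrite ssize_lin hu // hv // scaler0 addr0. Qed.

Lemma below0 n : below n 0.
Proof. by move=> m _; exact: lin0 (ssize_lin m). Qed.

Lemma belowD n u v : below n u -> below n v -> below n (u + v).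
Proof. by rewrite -[u in u + v]scale1r; exact: below_lin. Qed.

Lemma belowZ n c u : below n u -> below n (c *: u).
Proof. by move=> h; rewrite -[_ *: _]addr0; apply: below_lin => //; exact: below0. Qed.

Lemma belowW n m u : (n <= m)%N -> below n u -> below m u.
Proof. by move=> nm h k mk; apply: h; exact: leq_trans mk. Qed.

Lemma below_usum n (w : word V) F : (forall a b, (size a + size b)%N = size w ->
  below n (F a b)) -> below n (usum w F).
Proof.
move=> h m nm; rewrite (lin_usum _ _ (ssize_lin m)).
by rewrite (@eq_usum_deg _ _ _ _ _ (fun _ _ => 0)) ?usum0 // => a b sz _; exact: (h a b sz).
Qed.

Lemma below_psum n (w : word V) F : (forall x b, (size b).+1 = size w ->
  below n (F x b)) -> below n (psum w F).
Proof.
move=> h m nm; rewrite (lin_psum _ _ (ssize_lin m)).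
by rewrite (@eq_psum_deg _ _ _ _ _ (fun _ _ => 0)) ?psum0 // => x b sz _; exact: (h x b sz).
Qed.

Lemma ssize_ssize m n u : ssize m (ssize n u) = if m == n then ssize n u else 0.
Proof.
move: u; apply: Sym_linext.
- exact: lin_comp (ssize_lin _) (ssize_lin _).
- by case: eqP => _; [exact: ssize_lin | exact: lin_zero].
move=> w; rewrite ssize_sgen; case: (size w =P n) => [<-|_].
  by rewrite ssize_sgen eq_sym.
by rewrite (lin0 (ssize_lin m)) if_same.
Qed.

Lemma below_sum n u : below n u -> u = \sum_(m < n) ssize m u.
Proof.
move=> h; apply/eqP; rewrite -subr_eq0; apply/eqP; apply: ssize_inj => m.
rewrite (linB (ssize_lin m)) (lin_sum (ssize_lin m)).
under eq_bigr do rewrite ssize_ssize.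
case: (ltnP m n) => mn; last first.
  by rewrite h // big1 ?subr0 // => i _; case: eqP => // e; have := ltn_ord i; lia.
rewrite (bigD1 (Ordinal mn)) //= eqxx big1 ?addr0 ?addrN // => i.
by rewrite -val_eqE /= eq_sym => /negPf ->.
Qed.

Lemma below_ex u : exists n, below n u.
Proof.
have [l ->] := pmod_lincomb u; elim: l => [|t l [n IH]].
  by exists 0%N; rewrite /lincomb big_nil; exact: below0.
exists (maxn (size t.2).+1 n); rewrite /lincomb big_cons; apply: belowD.
  by apply: belowZ; apply: below_sgen; rewrite leq_max leqnn.
by apply: belowW IH; rewrite leq_max leqnn orbT.
Qed.

Lemma below_map (F : Sym V -> Sym V) n m u : linear F ->
  (forall w, (size w < n)%N -> below m (F (sgen w))) -> below n u -> below m (F u).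
Proof.
move=> lF h hu k mk; rewrite (below_sum hu) (lin_sum lF) (lin_sum (ssize_lin k)).
rewrite big1 // => j _; move: u {hu}; apply: Sym_linext.
- exact: lin_comp (ssize_lin _) (lin_comp lF (ssize_lin _)).
- exact: lin_zero.
move=> w; rewrite ssize_sgen; case: eqP => [e|_]; first by apply: h => //; rewrite e.
by rewrite (lin0 lF) (lin0 (ssize_lin _)).
Qed.

Variable F : Sym V -> Sym V.
Hypothesis lF : linear F.
Hypothesis uF : forall w, below (size w) (F (sgen w) - sgen w).

Let step n u : below n.+1 u -> below n (F u - u).
Proof.
apply: (below_map (F := fun u => F u - u)); first exact: lin_sub lF (@lin_id _ _).
by move=> w; rewrite ltnS => wn; apply: belowW wn _; exact: uF.
Qed.

(** [F - id] lowers the length, so that it is nilpotent on every element. *)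
Lemma unipotent_inj : injective F.
Proof.
move=> u v e; apply/eqP; rewrite -subr_eq0; apply/eqP.
have : F (u - v) = 0 by rewrite (linB lF) e addrN.
move: (u - v) => {}u {v e} Fu; have [n] := below_ex u.
elim: n => [|n IH] hu; first by apply: ssize_inj => m; exact: hu.
by apply: IH; have := step hu; rewrite Fu sub0r => /(belowZ (-1)); rewrite scaleN1r opprK.
Qed.

Lemma unipotent_surj u : exists v, F v = u.
Proof.
have [n] := below_ex u; elim: n u => [|n IH] u hu.
  by exists 0; rewrite (lin0 lF); apply/esym/ssize_inj => m; exact: hu.
have [v e] := IH _ (step hu); exists (u - v).
by rewrite (linB lF) e opprB addrCA addrN addr0.
Qed.

End Unipotent.

Section Smap.
Variables (K : fieldType) (V W : gspace K) (g : V -> W).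
Hypothesis hg : deg_map 0 g.
Implicit Types (w : word V).

Lemma vec_hmap x : vec (hmap g x) = g (vec x).
Proof. by apply: vec_mkhel; rewrite -[deg x]addr0; apply: hg.2; exact: homog_vec. Qed.

Lemma wdeg_hmap w : wdeg (map (hmap g) w) = wdeg w.
Proof. exact: wdeg_map. Qed.

Lemma kills_hmap (Z : lmodType K) (f : word W -> Z) :
  skills f -> skills (fun w => f (map (hmap g) w)).
Proof.
move=> /sym_killsP[ml gs]; apply/sym_killsP; split.
  move=> c x y z u v hx hy hz; rewrite !map_cat /=.
  by apply: ml => //; rewrite !vec_hmap hz hg.1.
by move=> x y u v; rewrite !map_cat /= gs.
Qed.

Lemma smap_lin : linear (smap g). Proof. exact: plin_linear. Qed.

Lemma smap_sgen w : smap g (sgen w) = sgen (map (hmap g) w).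
Proof. by rewrite /smap plin_gen //; apply: kills_hmap; exact: sgen_kills. Qed.

Lemma smap_coalg : is_coalg_mor (smap g).
Proof.
split.
- apply: sdegP smap_lin _ => w; rewrite smap_sgen addr0; apply: shomog_sgen.
  exact: wdeg_hmap.
- apply: Sym_linext => [||w].
  + exact: lin_comp (@Delta_lin K W) smap_lin.
  + exact: lin_comp (tmap_lin _ _) (@Delta_lin K V).
  rewrite smap_sgen !Delta_sgen usum_map // (lin_usum _ _ (tmap_lin _ _)).
  by apply: eq_usum => a b; rewrite (tmap_ten smap_lin smap_lin) !smap_sgen.
- apply: Sym_linext => [||w].
  + exact: lin_comp (@scounit_lin K W) smap_lin.
  + exact: scounit_lin.
  by rewrite smap_sgen !scounit_sgen; case: w.
- by rewrite /sone smap_sgen.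
Qed.

Lemma smap_coder k (q : word V -> V) (q' : word W -> W) :
  coefs k q -> coefs k q' -> (forall w, g (q w) = q' (map (hmap g) w)) ->
  forall u, smap g (coder k q u) = coder k q' (smap g u).
Proof.
move=> cq cq' e; apply: Sym_linext.
- exact: lin_comp smap_lin (coder_lin _ _).
- exact: lin_comp (coder_lin _ _) smap_lin.
move=> w; rewrite smap_sgen (coder_sgen _ _ cq.1) (coder_sgen _ _ cq'.1).
rewrite usum_map // (lin_usum _ _ smap_lin); apply: eq_usum => a b.
rewrite smap_sgen /= -e wdeg_hmap; congr (sgen (_ :: _)).
apply: hel_eq => //; rewrite vec_hmap !vec_mkhel ?cq.2 //.
by rewrite e; have := cq'.2 (map (hmap g) a); rewrite wdeg_hmap.
Qed.

End Smap.

(** * Signed sums over permutations *)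

Section SymmetricSum.
Variables (K : fieldType) (V : gspace K).
Implicit Types (a b w : word V) (x y z : hel V).

(** The signed sum of [g] over the rearrangements of a word of length [n] (and
    zero on words of another length), by recursion on the letter that comes first.
    In this form it can be convolved with other functions of words. *)
Fixpoint ssum (W : lmodType K) n (g : word V -> W) w : W :=
  if n is m.+1 then psum w (fun z b => ssum m (fun v => g (z :: v)) b)
  else if w is [::] then g [::] else 0.

Variable W : lmodType K.
Implicit Types g : word V -> W.

Lemma eq_ssum_deg n g g' w :
  (forall v, size v = n -> wdeg v = wdeg w -> g v = g' v) -> ssum n g w = ssum n g' w.
Proof.
elim: n g g' w => [|n IH] g g' w e /=; first by case: w e => // e; exact: e.
apply: eq_psum_deg => z b _ dg; apply: IH => v sv dv.
by apply: e; rewrite /= ?sv // wdeg_cons dv.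
Qed.

Lemma eq_ssum n g g' w : (forall v, g v = g' v) -> ssum n g w = ssum n g' w.
Proof. by move=> e; apply: eq_ssum_deg. Qed.

Lemma ssum_size n g w : size w <> n -> ssum n g w = 0.
Proof.
elim: n g w => [|n IH] g w sw /=; first by case: w sw.
rewrite (@eq_psum_deg _ _ _ _ _ (fun _ _ => 0)) ?psum0 // => z b sb _.
by apply: IH => e; apply: sw; rewrite -sb e.
Qed.

Lemma lin_ssum (Z : lmodType K) (L : W -> Z) n g w : linear L ->
  L (ssum n g w) = ssum n (fun v => L (g v)) w.
Proof.
move=> hL; elim: n g w => [|n IH] g w /=; first by case: w => //; rewrite (lin0 hL).
by rewrite (lin_psum _ _ hL); apply: eq_psum => z b; exact: IH.
Qed.

Lemma ssumD n g g' w : ssum n (fun v => g v + g' v) w = ssum n g w + ssum n g' w.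
Proof.
elim: n g g' w => [|n IH] g g' w /=; first by case: w; rewrite ?addr0.
by rewrite -psumD; apply: eq_psum => z b; exact: IH.
Qed.

Lemma ssumZ n c g w : ssum n (fun v => c *: g v) w = c *: ssum n g w.
Proof.
elim: n g w => [|n IH] g w /=; first by case: w; rewrite ?scaler0.
by rewrite -psumZ; apply: eq_psum => z b; exact: IH.
Qed.

(** The recursion on the last letter: extracting the first letter and extracting
    the last one commute, by coassociativity. *)
Lemma ssum_last n g w :
  ssum n.+1 g w = psumr w (fun a z => ssum n (fun v => g (rcons v z)) a).
Proof.
elim: n g w => [|n IH] g w.
  rewrite /= /psum /psumr usum_rnil; last by case=> [|x [|y a]] [|z b].
  by rewrite usum_lnil //; case=> [|x a] [|y [|z b]].
transitivity (psum w (fun z b => psumr b (fun a y =>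
    ssum n (fun v => g (z :: rcons v y)) a))).
  by apply: eq_psum => z b; exact: (IH (fun v => g (z :: v))).
by rewrite psum_psumr.
Qed.

Lemma ssum_kills n g : multilin g -> skills (ssum n g).
Proof.
elim: n g => [|n IH] g ml /=.
  apply/sym_killsP; split=> [c x y z [|u1 u] v _ _ _ /=|x y [|u1 u] v /=];
  by rewrite ?scaler0 ?addr0.
apply: psum_kills => [c x y z b hx hy hz|x].
  rewrite -ssumZ -ssumD; apply: eq_ssum => v; exact: (ml c x y z [::]).
apply: IH => c y z t u v hy hz ht; exact: (ml c y z t (x :: u)).
Qed.

Lemma ssum_kills_size (c : nat -> K) g : multilin g ->
  skills (fun w => c (size w) *: ssum (size w) g w).
Proof.
move=> mg; apply/sym_killsP; split=> [c' x y z u v hx hy hz|x y u v].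
  have /sym_killsP[ml _] := kills_scale (c (size (u ++ z :: v)))
    (ssum_kills (size (u ++ z :: v)) mg).
  by move: (ml c' x y z u v hx hy hz); rewrite !size_cat.
have /sym_killsP[_ gs] := kills_scale (c (size (u ++ x :: y :: v)))
  (ssum_kills (size (u ++ x :: y :: v)) mg).
by move: (gs x y u v); rewrite !size_cat.
Qed.

(** ** Comparison with sums indexed by permutations *)

Let letters n (t : 'I_n -> hel V) : word V := [seq t i | i <- enum 'I_n].

Let psign n (t : 'I_n -> hel V) (s : 'S_n) : int :=
  \sum_(i < n) \sum_(j < n | (i < j)%N && (s j < s i)%N) deg (t (s i)) * deg (t (s j)).

Let lettersS n (t : 'I_n.+1 -> hel V) :
  letters t = t ord0 :: letters (fun i => t (lift ord0 i)).
Proof. by rewrite /letters enum_ordSl /= -map_comp. Qed.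

Let psum_letters n (t : 'I_n.+1 -> hel V) (F : hel V -> word V -> W) :
  psum (letters t) F = \sum_(k < n.+1)
    ksign K (deg (t k) * \sum_(j < n.+1 | (j < k)%N) deg (t j)) *:
      F (t k) (letters (fun i => t (lift k i))).
Proof.
elim: n t F => [|n IH] t F.
  rewrite lettersS psum_cons big_ord1 big_pred0 // mulr0 ksign0 scale1r.
  by rewrite {2}/letters enum_ord0 psum_nil addr0.
rewrite lettersS psum_cons IH [RHS]big_ord_recl; congr (_ + _).
  by rewrite big_pred0 // mulr0 ksign0 scale1r.
apply: eq_bigr => k _; rewrite ksignZ.
have -> : \sum_(j < n.+2 | (j < lift ord0 k)%N) deg (t j)
   = deg (t ord0) + \sum_(j < n.+1 | (j < k)%N) deg (t (lift ord0 j)).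
  rewrite big_mkcond big_ord_recl /= [in RHS]big_mkcond /=; congr (_ + _).
congr (ksign _ _ *: F _ _); first by rewrite mulrDr addrC [X in X + _]mulrC.
rewrite [RHS]lettersS; congr (t _ :: _); first exact: val_inj.
by apply: eq_map => i; congr (t _); apply: val_inj; rewrite /= /bump; lia.
Qed.

Let psign_lift n (t : 'I_n.+1 -> hel V) k (s : 'S_n) :
  psign t (lift_perm ord0 k s)
  = deg (t k) * (\sum_(j < n.+1 | (j < k)%N) deg (t j))
    + psign (fun i => t (lift k i)) s.
Proof.
rewrite /psign big_ord_recl lift_perm_id; congr (_ + _).
  rewrite big_mkcond big_ord_recl /= add0r big_distrr /= [RHS]big_mkcond /=.
  rewrite [RHS](bigD1 k) //= ltnn add0r.
  transitivity (\sum_(j < n) if (lift k j < k)%N then deg (t k) * deg (t (lift k j)) else 0).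
    rewrite [RHS](reindex_inj (@perm_inj _ s)) /=.
    by apply: eq_bigr => j _; rewrite lift_perm_lift.
  symmetry; case: (pickP 'I_n) => [k0 _ | n0]; last first.
    rewrite big1 => [|i]; last by rewrite eq_sym => /unlift_some[j _ _]; have := n0 j.
    by rewrite big1 // => i _; have := n0 i.
  rewrite (reindex (lift k)).
    by apply: eq_bigl => i; rewrite eq_sym neq_lift.
  exists (fun i => odflt k0 (unlift k i)) => i; first by rewrite liftK.
  by rewrite inE eq_sym; case/unlift_some=> k' -> ->.
apply: eq_bigr => i _; rewrite big_mkcond big_ord_recl /= add0r [RHS]big_mkcond.
apply: eq_bigr => j _; rewrite !lift_perm_lift /=.
congr (if _ then _ else _); congr (_ && _).
by rewrite /bump; lia.
Qed.

(** A permutation is the choice of the letter that comes first, followed by a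
    permutation of the others; the Koszul sign is multiplicative in this
    decomposition. *)
Lemma ssum_perm w g : \sum_(p : 'S_(size w)) koszul p *: g (wperm p) = ssum (size w) g w.
Proof.
have e : w = letters (tnth (in_tuple w)).
  by rewrite /letters map_tnth_enum.
rewrite [X in ssum _ _ X]e.
transitivity (\sum_(p : 'S_(size w)) ksign K (psign (tnth (in_tuple w)) p) *:
   g (letters (fun i => tnth (in_tuple w) (p i)))); first by [].
rewrite {e}; move: (tnth _); rewrite -[size (in_tuple w)]/(size w).
move: (size w) => n {w} t; elim: n t g => [|n IH] t g.
  rewrite (big_pred1 (1%g : 'S_0)) => [|s]; last by rewrite /= [s]permS0 eqxx.
  by rewrite /letters enum_ord0 /psign big_ord0 scale1r.
rewrite -[RHS]/(psum (letters t) (fun z b => ssum n (fun v => g (z :: v)) b)).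
rewrite psum_letters (partition_big (fun s : 'S_n.+1 => s ord0) xpredT) //=.
apply: eq_bigr => k _; rewrite -IH scaler_sumr.
rewrite (reindex (lift_perm ord0 k)); last first.
  pose ulsf i (s : 'S_n.+1) j := odflt j (unlift (s i) (s (lift i j))).
  have ulsfK i (s : 'S_n.+1) j: lift (s i) (ulsf i s j) = s (lift i j).
    rewrite /ulsf; have := neq_lift i j.
    by rewrite -(can_eq (permK s)) => /unlift_some[] ? ? ->.
  have inj_ulsf: injective (ulsf ord0 _).
    move=> s; apply: can_inj (ulsf (s ord0) s^-1%g) _ => k'.
    by rewrite {1}/ulsf ulsfK !permK liftK.
  exists (fun s => perm (inj_ulsf s)) => [s _ | s].
    by apply/permP=> k'; rewrite permE /ulsf lift_perm_lift lift_perm_id liftK.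
  move/(s _ =P _) => si0; apply/permP=> j.
  case: (unliftP ord0 j) => [k'|] ->; rewrite ?lift_perm_id //.
  by rewrite lift_perm_lift -si0 permE ulsfK.
apply: eq_big => [s | s _]; first by rewrite lift_perm_id eqxx.
rewrite psign_lift ksignD scalerA; congr (_ *: g _).
rewrite lettersS lift_perm_id; congr (_ :: _).
by apply: eq_map => i; rewrite lift_perm_lift.
Qed.

End SymmetricSum.

Lemma homog_ssum (K : fieldType) (V W : gspace K) n m (g : word V -> W) (w : word V) :
  (forall v, size v = n -> wdeg v = wdeg w -> homog m (g v)) -> homog m (ssum n g w).
Proof.
move=> h; rewrite /homog (lin_ssum _ _ _ (@gproj_linear K W m)); apply/eqP.
by apply: eq_ssum_deg => v sv dv; apply/eqP/h.
Qed.


(** * The universal enveloping algebra and the exponential automorphism *)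

Section Enveloping.
Variables (K : fieldType) (L : preLie K).
Hypothesis char0 : [pchar K] =i pred0.
Implicit Types (a b u v w : word L) (x y z t : hel L).

Let opZ c (a b : L) : pl_op (c *: a) b = c *: pl_op a b.
Proof. exact: linZ (pl_linl b) _ _. Qed.
Let opB (a b c : L) : pl_op (a - b) c = pl_op a c - pl_op b c.
Proof. exact: linB (pl_linl c) _ _. Qed.

Lemma lbr_homog x y : homog (deg x + deg y) (lbr x y).
Proof.
apply: homogD; first by apply: pl_deg; exact: homog_vec.
by apply: homogN; apply: homogZ; rewrite addrC; apply: pl_deg; exact: homog_vec.
Qed.

Lemma vec_hbr x y : vec (hbr x y) = lbr x y.
Proof. exact/vec_mkhel/lbr_homog. Qed.

Lemma deg_hbr x y : deg (hbr x y) = deg x + deg y. Proof. by []. Qed.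

Lemma lbr_linl c x y z t : deg x = deg z -> deg y = deg z ->
  vec z = c *: vec x + vec y -> lbr z t = c *: lbr x t + lbr y t.
Proof.
move=> hx hy hz; rewrite /lbr hz hx hy pl_linl pl_linr !scalerBr scalerDr opprD.
by rewrite addrACA !scalerA [c * _]mulrC.
Qed.

Lemma lbr_linr c x y z t : deg x = deg z -> deg y = deg z ->
  vec z = c *: vec x + vec y -> lbr t z = c *: lbr t x + lbr t y.
Proof.
move=> hx hy hz; rewrite /lbr hz hx hy pl_linl pl_linr !scalerBr scalerDr opprD.
by rewrite addrACA !scalerA [c * _]mulrC.
Qed.

Lemma lbr_anti x y : lbr x y = - (ksign K (deg x * deg y) *: lbr y x).
Proof.
by rewrite /lbr scalerBr opprB [deg y * _]mulrC ksignZK.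
Qed.

Lemma s_coefs x : coefs (deg x) (s_coef x).
Proof.
split=> [|[|y [|z w]]] /=.
- apply/sym_killsP; split=>
  [c y y' z [|u1 [|u2 u]] [|v1 v] hx hy hz /=|y z [|u1 [|u2 u]] v /=];
  by rewrite ?scaler0 ?addr0 // hz pl_linr.
- by rewrite wdeg_nil addr0; exact: homog_vec.
- by rewrite wdeg_cons wdeg_nil addr0; apply: pl_deg; exact: homog_vec.
- exact: homog0.
Qed.

Lemma s_coder x : is_coder (deg x) (s x).
Proof. exact/coder_is_coder/s_coefs. Qed.

Lemma s_lin x : linear (s x). Proof. exact: coder_lin. Qed.

Lemma s_sgen x w : s x (sgen w) =
  usum w (fun a b => sgen (mkhel (deg x + wdeg a) (s_coef x a) :: b)).
Proof. exact: coder_sgen (s_coefs x).1. Qed.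

Lemma s_linl c x y z : deg x = deg z -> deg y = deg z ->
  vec z = c *: vec x + vec y -> forall m, s z m = c *: s x m + s y m.
Proof.
move=> hx hy hz; apply: Sym_linext.
- exact: s_lin.
- by apply: lin_add; [apply: lin_scale|]; exact: s_lin.
move=> w; rewrite !s_sgen.
rewrite -usumZ -usumD; apply: eq_usum => a b; rewrite hx hy.
rewrite -(multilin_mkhel _ [::] b (@sgen_multilin K L)); congr (sgen (mkhel _ _ :: _)).
by case: a => [|t [|t' a]] //=; rewrite ?scaler0 ?addr0 // hz pl_linl.
Qed.

Lemma taylor_s_comp x y w :
  sproj1 (s x (s y (sgen w))) = pl_op (vec x) (s_coef y w).
Proof.
rewrite [s y _]s_sgen (lin_usum _ _ (s_lin x)).
rewrite (lin_usum _ _ (@sproj1_lin K L)).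
have e v : sproj1 (s x (sgen v)) = s_coef x v by exact: (taylor_coder _ (s_coefs x)).
rewrite usum_rnil => [|a [//|t b] _]; rewrite e //=.
by rewrite vec_mkhel // (s_coefs y).2.
Qed.

(** Left symmetry of the associator says exactly that [s] represents the Lie
    algebra; as both sides are coderivations, it suffices to compare
    corestrictions. *)
Lemma s_hbr x y m :
  s (hbr x y) m = s x (s y m) - ksign K (deg x * deg y) *: s y (s x m).
Proof.
have hP : is_coder (deg x + deg y) (s (hbr x y)) := s_coder (hbr x y).
move: m; apply: (coder_ext char0 hP (is_coder_comm (s_coder x) (s_coder y))) => w.
rewrite (taylor_coder _ (s_coefs _)) /taylor (linB (@sproj1_lin K L)) (linZ (@sproj1_lin K L)).
rewrite !taylor_s_comp; case: w => [|t [|t' w]] /=.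
- by rewrite vec_hbr.
- have := pl_assoc x y (vec t); rewrite vec_hbr /lbr opB opZ /= scalerBr => /eqP.
  rewrite subr_eq => /eqP ->; rewrite addrAC [X in X + _]addrAC.
  by rewrite addrN add0r addrC.
- by rewrite !(lin0 (pl_linr _)) scaler0 subr0.
Qed.

Notation ekills := (kills (@env_rel K L)).

Lemma env_killsP (W : lmodType K) (f : word L -> W) :
  ekills f <-> multilin f /\ (forall x y u v,
    f (u ++ x :: y :: v) = ksign K (deg x * deg y) *: f (u ++ y :: x :: v)
                           + f (u ++ hbr x y :: v)).
Proof.
split=> [kf|[ml gs] r].
  split=> [c x y z u v hx hy hz|x y u v].
    have := kf _ (EnvLin u v hx hy hz).
    rewrite /lincomb !big_cons big_nil /= addr0 scale1r scaleNr scaleN1r.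
    by move=> /eqP; rewrite addr_eq0 opprD !opprK => /eqP.
  have := kf _ (EnvBr x y u v).
  rewrite /lincomb !big_cons big_nil /= addr0 scale1r scaleNr scaleN1r.
  by move=> /eqP; rewrite addr_eq0 opprD !opprK => /eqP.
case=> [c x y z u v hx hy hz|x y u v]; rewrite /lincomb !big_cons big_nil /= addr0.
  by rewrite (ml c x y z) // scale1r scaleNr scaleN1r addrACA addrN addrN addr0.
by rewrite gs scale1r scaleNr scaleN1r addrACA addrN addrN addr0.
Qed.

Lemma egen_kills : ekills (@egen K L). Proof. exact: pgen_kills. Qed.

Lemma egen_multilin : multilin (@egen K L).
Proof. by have [] := (env_killsP _).1 egen_kills. Qed.

Lemma Env_linext (W : lmodType K) (F G : Env L -> W) : linear F -> linear G ->
  (forall w, F (egen w) = G (egen w)) -> forall e, F e = G e.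
Proof. exact: pmod_linext. Qed.

(** The bracket relator is killed because [s] is an action. *)
Lemma foldr_s_kills : ekills (foldr (fun x m => s x m) (sone L)).
Proof.
apply/env_killsP; split=> [c x y z u v hx hy hz|x y u v]; rewrite !foldr_cat /=.
  rewrite (s_linl hx hy hz); elim: u => //= t u ->; exact: s_lin.
have -> : s x (s y (foldr (fun x m => s x m) (sone L) v))
   = ksign K (deg x * deg y) *: s y (s x (foldr (fun x m => s x m) (sone L) v))
     + s (hbr x y) (foldr (fun x m => s x m) (sone L) v).
  by rewrite s_hbr addrC subrK.
elim: u => //= t u ->; exact: s_lin.
Qed.

Lemma eta_lin : linear (@eta K L). Proof. exact: plin_linear. Qed.

Lemma eta_egen w : eta (egen w) = foldr (fun x m => s x m) (sone L) w.
Proof. by rewrite /eta plin_gen //; exact: foldr_s_kills. Qed.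

Definition lmul x : Env L -> Env L := plin (fun w => egen (x :: w)).
Definition rmul x : Env L -> Env L := plin (fun w => egen (rcons w x)).

Lemma lmul_lin x : linear (lmul x). Proof. exact: plin_linear. Qed.
Lemma rmul_lin x : linear (rmul x). Proof. exact: plin_linear. Qed.

Lemma lmul_egen x w : lmul x (egen w) = egen (x :: w).
Proof.
rewrite /lmul plin_gen //; have [ml gs] := (env_killsP _).1 egen_kills.
apply/env_killsP; split=> [c y y' z u v|y z u v]; first exact: (ml c y y' z (x :: u)).
exact: (gs y z (x :: u)).
Qed.

Lemma rcons_kills x : ekills (fun w => egen (rcons w x)).
Proof.
have [ml gs] := (env_killsP _).1 egen_kills.
apply/env_killsP; split=> [c y y' z u v|y z u v]; rewrite !rcons_cat /=.
  exact: (ml c y y' z u).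
exact: (gs y z u).
Qed.

Lemma rmul_egen x w : rmul x (egen w) = egen (rcons w x).
Proof. by rewrite /rmul plin_gen //; exact: rcons_kills. Qed.

Lemma lmul_rmul x y e : lmul x (rmul y e) = rmul y (lmul x e).
Proof.
move: e; apply: Env_linext.
- exact: lin_comp (lmul_lin x) (rmul_lin y).
- exact: lin_comp (rmul_lin y) (lmul_lin x).
by move=> w; rewrite rmul_egen !lmul_egen rmul_egen.
Qed.

Lemma env_rmul_lin x : linear (env_rmul x). Proof. exact: plin_linear. Qed.

Lemma env_rmul_egen x w : env_rmul x (egen w) = ksign K (deg x * wdeg w) *: egen (rcons w x).
Proof.
rewrite /env_rmul plin_gen //; have [ml gs] := (env_killsP _).1 (rcons_kills x).
apply/env_killsP; split.
  have hf (n : int) (m : nat) : linear (fun e : Env L => ksign K (deg x * n) *: e).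
    by move=> c e e'; rewrite scalerDr !scalerA mulrC.
  exact: (multilin_graded hf ml).
move=> y z u v; rewrite gs scalerDr !scalerA mulrC (wdeg_swap y z).
by congr (_ + ksign K (_ * _) *: _); rewrite !wdeg_cat !wdeg_cons deg_hbr; ring.
Qed.

Lemma eta_lmul x e : eta (lmul x e) = s x (eta e).
Proof.
move: e; apply: Env_linext.
- exact: lin_comp eta_lin (lmul_lin x).
- exact: lin_comp (s_lin x) eta_lin.
by move=> w; rewrite lmul_egen !eta_egen.
Qed.

Lemma sym_lin : linear (@sym K L). Proof. exact: plin_linear. Qed.

Lemma sym_sgen w : sym (sgen w) = (size w)`!%:R^-1 *: ssum (size w) (@egen K L) w.
Proof.
have sE v : (size v)`!%:R^-1 *: \sum_(p : 'S_(size v)) koszul p *: egen (wperm p)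
  = (size v)`!%:R^-1 *: ssum (size v) (@egen K L) v by rewrite ssum_perm.
rewrite /sym plin_gen ?sE //; apply: kills_ext => [v|]; first exact/esym/sE.
exact: (ssum_kills_size (fun n => n`!%:R^-1) egen_multilin).
Qed.

Lemma E_lin : linear (@E K L). Proof. exact: lin_comp eta_lin sym_lin. Qed.

Lemma sym_one : sym (sone L) = egen [::].
Proof. by rewrite sym_sgen /= fact0 invr1 scale1r. Qed.

Lemma sym_rec w : (size w)%:R *: sym (sgen w) = psum w (fun z b => lmul z (sym (sgen b))).
Proof.
case: w => [|x w]; first by rewrite psum_nil scale0r.
rewrite sym_sgen [size _]/= factS natrM invfM scalerA mulrA divff ?natr_neq0 //.
rewrite mul1r -psumZ; apply: eq_psum_deg => z b sb _.
have sn : size b = size w by apply: succn_inj; rewrite sb.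
rewrite sym_sgen (linZ (lmul_lin _)) sn (lin_ssum _ _ _ (lmul_lin z)); congr (_ *: _).
by apply: eq_ssum => v; rewrite lmul_egen.
Qed.

Lemma E_one : E (sone L) = sone L.
Proof. by rewrite /E sym_one eta_egen. Qed.

Lemma E_rec w : (size w)%:R *: E (sgen w) = psum w (fun z b => s z (E (sgen b))).
Proof.
rewrite -(linZ E_lin) /E (linZ sym_lin) sym_rec (lin_psum _ _ eta_lin).
by apply: eq_psum => z b; exact: eta_lmul.
Qed.

(** [E_rec] determines [E] from its values on shorter words, since lengths are
    invertible. *)
Lemma E_ind (P : word L -> Sym L -> Prop) :
  P [::] (sone L) ->
  (forall n w, size w = n.+1 -> (forall b, size b = n -> P b (E (sgen b))) ->
     P w (n.+1%:R^-1 *: psum w (fun z b => s z (E (sgen b))))) ->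
  forall w, P w (E (sgen w)).
Proof.
move=> P0 PS w; move: {-1}(size w) (erefl (size w)) => n.
elim: n w => [|n IH] w e; first by case: w e => //; rewrite -/(sone L) E_one.
have -> : E (sgen w) = n.+1%:R^-1 *: psum w (fun z b => s z (E (sgen b))).
  by rewrite -E_rec e scalerA mulVf ?natr_neq0 // scale1r.
exact: PS.
Qed.

Lemma E_sdeg : sdeg_map 0 (@E K L).
Proof.
apply: sdegP E_lin _.
apply: (E_ind (P := fun w m => shomog (wdeg w + 0) m)) => [|n w sw IH].
  by apply: shomog_sgen; rewrite addr0.
rewrite addr0; apply/shomogZ/shomog_psum => z b sb <-; rewrite addrC.
by apply: (s_coder z).1.2; rewrite -[wdeg b]addr0; apply: IH; rewrite sw in sb; case: sb.
Qed.

(** By [E_rec] and the co-Leibniz rule for [s z], the letters extracted on the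
    left of the coproduct count its left factor with the weight [size a], those
    extracted on the right its right factor with the weight [size b]; the total
    weight is the length of the word. *)
Lemma E_Delta m : Delta (E m) = tmap (@E K L) (@E K L) (Delta m).
Proof.
move: m; apply: Sym_linext.
- exact: lin_comp (@Delta_lin K L) E_lin.
- exact: lin_comp (tmap_lin _ _) (@Delta_lin K L).
have tE w : tmap (@E K L) (@E K L) (Delta (sgen w))
    = usum w (fun a b => ten (E (sgen a)) (E (sgen b))).
  rewrite Delta_sgen (lin_usum _ _ (tmap_lin _ _)); apply: eq_usum => a b.
  exact: (tmap_ten E_lin E_lin).
apply: (E_ind (P := fun w m => Delta m = tmap (@E K L) (@E K L) (Delta (sgen w)))) =>
  [|n w sw IH].
  by rewrite tE usum_nil /sone Delta_sgen usum_nil E_one.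
rewrite tE (linZ (@Delta_lin K L)) (lin_psum _ _ (@Delta_lin K L)).
apply: (canLR (scalerK (natr_neq0 char0 n))).
transitivity (psum w (fun z c => usum c (fun a b =>
    ten (s z (E (sgen a))) (E (sgen b))
    + ksign K (deg z * wdeg a) *: ten (E (sgen a)) (s z (E (sgen b)))))).
  apply: eq_psum_deg => z c sc _; rewrite (s_coder z).2 IH; last by rewrite sw in sc; case: sc.
  rewrite tE !(lin_usum _ _ (tmap_lin _ _)) -usumD; apply: eq_usum => a b.
  rewrite (tmap_ten (s_lin z) (@lin_id _ _)) (tmap_ten (stwist_lin _) (s_lin z)).
  rewrite (sdeg_twist0 _ _ E_sdeg) stwist_sgen (linZ E_lin) (linZ (ten_linl _)) //.
transitivity (usum w (fun a b => (size a)%:R *: ten (E (sgen a)) (E (sgen b))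
    + (size b)%:R *: ten (E (sgen a)) (E (sgen b)))); last first.
  rewrite -usumZ; apply: eq_usum_deg => a b e _.
  by rewrite -scalerDl -natrD e sw.
rewrite (eq_psum _ (g := fun z c => usum c (fun a b => ten (s z (E (sgen a))) (E (sgen b)))
   + usum c (fun a b => ksign K (deg z * wdeg a) *: ten (E (sgen a)) (s z (E (sgen b))))));
  last by move=> z c; rewrite usumD.
rewrite psumD usumD; congr (_ + _).
  rewrite psum_usum_coassoc; apply: eq_usum => a b.
  by rewrite -(linZ (ten_linl _)) E_rec (lin_psum _ _ (ten_linl _)).
rewrite psum_usum_exchange; apply: eq_usum => a b.
rewrite -(linZ (ten_linr _)) E_rec (lin_psum _ _ (ten_linr _)).
by apply: eq_psum => z c; rewrite ksignZK.
Qed.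

Lemma E_coalg : is_coalg_mor (@E K L).
Proof.
split; [exact: E_sdeg | exact: E_Delta | | exact: E_one].
apply: Sym_linext.
- exact: lin_comp (@scounit_lin K L) E_lin.
- exact: scounit_lin.
apply: (E_ind (P := fun w m => scounit m = scounit (sgen w))) => // n w sw IH.
rewrite (linZ (@scounit_lin K L)) scounit_sgen.
rewrite (lin_psum _ _ (@scounit_lin K L)) psum0 ?scaler0; first by case: w sw {IH}.
move=> z b; move: (E _); apply: (Sym_linext (F := fun m => scounit (s z m))) => [||v].
- exact: lin_comp (@scounit_lin K L) (s_lin z).
- exact: lin_zero.
exact: scounit_coder (s_coder z).
Qed.

(** The term of [s z] without letters consumed is the product with [z]; the
    others do not lengthen the word. *)
Lemma s_leading z v : below (size v).+1 (s z (sgen v) - sgen (z :: v)).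
Proof.
rewrite s_sgen.
have -> : sgen (z :: v) = usum v (fun a b => if a is [::] then sgen (z :: b) else 0).
  by rewrite usum_lnil // => -[].
rewrite -usumB; apply: below_usum => -[|x a] b sab.
  by rewrite wdeg_nil addr0 mkhel_vec addrN; exact: below0.
by rewrite subr0; apply: below_sgen; move: sab => /=; lia.
Qed.

Lemma E_leading w : below (size w) (E (sgen w) - sgen w).
Proof.
move: w; apply: (E_ind (P := fun w m => below (size w) (m - sgen w))) => [|n w sw IH].
  by rewrite addrN; exact: below0.
have -> : sgen w = n.+1%:R^-1 *: psum w (fun z b => sgen (z :: b)).
  by rewrite psum_sgen sw scalerA mulVf ?natr_neq0 // scale1r.
rewrite -scalerBr; apply: belowZ; rewrite -psumB; apply: below_psum => z b sb.
have sn : size b = n by move: sb; rewrite sw => -[].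
rewrite -[s z _](subrK (s z (sgen b))) -(linB (s_lin z)) -addrA.
apply: belowD; last by rewrite -sb; exact: s_leading.
rewrite sw -sn; apply: (below_map (s_lin z)) (IH b sn) => v vn.
rewrite -[s z _](subrK (sgen (z :: v))); apply: belowD.
  refine (belowW _ (@s_leading z v)). exact: leqW vn.
exact: below_sgen.
Qed.

Lemma E_inj : injective (@E K L).
Proof. exact: unipotent_inj E_lin E_leading. Qed.

Lemma E_surj (m : Sym L) : exists m', @E K L m' = m.
Proof. exact: unipotent_surj E_lin E_leading m. Qed.

Lemma sym_inj : injective (@sym K L).
Proof. by move=> m m' e; apply: E_inj; rewrite /E e. Qed.

End Enveloping.

(** * A Bernoulli identity for two commuting operators *)

Section Bernoulli.
Variable K : fieldType.
Hypothesis char0 : [pchar K] =i pred0.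

Lemma bernoulli_rec n : bernoulli K n
  = (n == 0%N)%:R - \sum_(k < n) 'C(n, k)%:R * bernoulli K k / (n - k).+1%:R.
Proof.
have sz m : size (bernoulli_seq K m) = m.
  by elim: m => //= m IH; rewrite size_rcons IH.
have nthE m k : (k < m)%N -> (bernoulli_seq K m)`_k = bernoulli K k.
  elim: m => // m IH; rewrite ltnS leq_eqVlt => /orP[/eqP -> //|km].
  by rewrite /= nth_rcons sz km IH.
rewrite {1}/bernoulli /= nth_rcons sz ltnn eqxx; congr (_ - _).
by apply: eq_bigr => k _; rewrite nthE.
Qed.

Lemma sum_bernoulli n :
  \sum_(k < n.+1) 'C(n.+1, k)%:R * bernoulli K k = (n == 0%N)%:R.
Proof.
have e k : (k <= n)%N ->
    'C(n.+1, k)%:R = n.+1%:R * ('C(n, k)%:R / (n - k).+1%:R) :> K.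
  move=> kn; rewrite mulrA -natrM -subSn //.
  apply: (canRL (mulfK _)); first by rewrite subSn //; exact: natr_neq0.
  by rewrite -natrM mulnC -mul_bin_down.
rewrite big_ord_recr /= binSn bernoulli_rec mulrBr mulr_natl mulr_sumr.
transitivity ((n == 0%N)%:R *+ n.+1 : K); last by case: n {e} => // n; rewrite mul0rn.
rewrite addrC -addrA -[RHS]addr0; congr (_ + _); apply/eqP.
rewrite addrC subr_eq0; apply/eqP; apply: eq_bigr => k _.
rewrite e; last exact/ltnW/ltn_ord.
by rewrite -!mulrA; congr (_ * (_ * _)); rewrite mulrC.
Qed.

(** Pascal's rule, as multiplication of [(X + Y)^n] by [X + Y] in terms of
    coefficients. *)
Lemma sum_pascal (V : lmodType K) n (f : nat -> V) :
  \sum_(i < n.+1) 'C(n, i)%:R *: (f i.+1 + f i) = \sum_(i < n.+2) 'C(n.+1, i)%:R *: f i.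
Proof.
rewrite (eq_bigr _ (fun i _ => scalerDr _ _ _)) big_split /= [in RHS]big_ord_recl.
rewrite [X in _ = _ + X](eq_bigr (fun i : 'I_n.+1 =>
  'C(n, i.+1)%:R *: f i.+1 + 'C(n, i)%:R *: f i.+1)); last first.
  by move=> i _; rewrite /= /bump add1n binS natrD scalerDl.
rewrite big_split /= [X in _ + X = _]big_ord_recl !bin0.
rewrite [X in _ = _ + (X + _)]big_ord_recr /= bin_small // scale0r addr0.
by rewrite addrCA [X in _ + X]addrC.
Qed.

Variables (V : lmodType K) (l r : V -> V).
Hypotheses (ll : linear l) (lr : linear r) (lrC : forall v, l (r v) = r (l v)).

(** The quotient of [r^(n+1) - l^(n+1)] by [r - l]. *)
Definition mixed n Y := \sum_(i < n.+1) iter i l (iter (n - i) r Y).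

Lemma mixed_rec n Y : mixed n.+1 Y = iter n.+1 r Y + l (mixed n Y).
Proof. by rewrite /mixed big_ord_recl (lin_sum ll) subn0. Qed.

Let t v := r v - l v.
(* All operators are expanded in the commuting pair [l], [t]. *)
Let W X j k := iter j l (iter k t X).

Lemma iter_lin (f : V -> V) n : linear f -> linear (iter n f).
Proof. by move=> lf; elim: n => [|n IH] c u v //=; rewrite IH lf. Qed.

Let rW X j k : r (W X j k) = W X j.+1 k + W X j k.+1.
Proof.
have rj v : r (iter j l v) = iter j l (r v) by elim: j => //= j <-; rewrite lrC.
rewrite /W rj iterSr [iter k.+1 t X]iterS.
rewrite -(linD (iter_lin j ll)); congr (iter j l _).
by rewrite /t addrC subrK.
Qed.

Let iter_rW X n k :
  iter n r (W X 0 k) = \sum_(i < n.+1) 'C(n, i)%:R *: W X i (k + n - i).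
Proof.
elim: n => [|n IH]; first by rewrite big_ord1 scale1r addn0 subn0.
rewrite iterS IH (lin_sum lr).
rewrite -(sum_pascal n (fun i => W X i (k + n.+1 - i))).
apply: eq_bigr => i _; rewrite (linZ lr) rW; congr (_ *: (_ + W X _ _)).
  by rewrite addnS subSS.
have := ltn_ord i; lia.
Qed.

Let mixedW X n k :
  mixed n (iter k t X) = \sum_(j < n.+1) 'C(n.+1, j)%:R *: W X j (k + n - j).
Proof.
elim: n => [|n IH]; first by rewrite /mixed !big_ord1 bin0 scale1r addn0 !subn0.
rewrite mixed_rec IH -[iter k t X]/(W X 0 k) iter_rW (lin_sum ll).
have := sum_pascal n.+1 (fun i => W X i (k + n.+1 - i)).
under eq_bigr => i _ do rewrite scalerDr.
rewrite big_split /= big_ord_recr [RHS]big_ord_recr /= !binn !scale1r.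
rewrite addrAC => /addIr <-; rewrite addrC; congr (_ + _).
by apply: eq_bigr => i _; rewrite (linZ ll) addnS subSS.
Qed.

(** The component of degree [N] of the identity of formal power series
    [(e^r - e^l) / (r - l) * (t / (e^t - 1)) = e^l] for [t = r - l].  In terms of
    [l] and [t], the coefficient of [l^j t^(N-j)] is a multiple of the sum in
    [sum_bernoulli], which vanishes unless [j = N]. *)
Lemma mixed_bernoulli X N :
  \sum_(m < N.+1) (bernoulli K m / m`!%:R / (N - m).+1`!%:R) *:
     mixed (N - m) (iter m (fun v => r v - l v) X)
  = N`!%:R^-1 *: iter N l X.
Proof.
pose c j m : K := bernoulli K m / m`!%:R / (N - m).+1`!%:R * 'C((N - m).+1, j)%:R.
transitivity (\sum_(j < N.+1) (\sum_(m < N.+1 | (m + j <= N)%N) c j m) *: W X j (N - j)).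
  under [RHS]eq_bigr => j _ do rewrite scaler_suml big_mkcond /=.
  rewrite exchange_big /=; apply: eq_bigr => m _; rewrite mixedW scaler_sumr.
  have mN := ltn_ord m.
  rewrite (big_ord_widen N.+1
    (fun j => (bernoulli K m / m`!%:R / (N - m).+1`!%:R) *:
      ('C((N - m).+1, j)%:R *: W X j (m + (N - m) - j))));
    last by lia.
  rewrite big_mkcond; apply: eq_bigr => j _; rewrite scalerA subnKC //.
  by have -> : (j < (N - m).+1)%N = (m + j <= N)%N by lia.
have cE (j m : nat) : (m + j <= N)%N ->
   c j m = ((j`!%:R)^-1 * ((N - j).+1`!%:R)^-1) * ('C((N - j).+1, m)%:R * bernoulli K m).
  move=> mjN; rewrite /c.
  have b1 : ('C((N - m).+1, j) * (j`! * ((N - m).+1 - j)`!) = (N - m).+1`!)%N.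
    by rewrite bin_fact //; lia.
  have b2 : ('C((N - j).+1, m) * (m`! * ((N - j).+1 - m)`!) = (N - j).+1`!)%N.
    by rewrite bin_fact //; lia.
  have e : ((N - m).+1 - j = (N - j).+1 - m)%N by lia.
  rewrite e in b1; move: b1 b2 => /(congr1 (fun n => n%:R : K)) b1 /(congr1 (fun n => n%:R : K)) b2.
  have f n : n`!%:R != 0 :> K by rewrite -(prednK (fact_gt0 n)) natr_neq0.
  rewrite -b1 -b2 !natrM.
  have := f (N - m).+1; rewrite -b1 !natrM !mulf_eq0 !negb_or => /and3P[h1 h2 h3].
  have := f (N - j).+1; rewrite -b2 !natrM !mulf_eq0 !negb_or => /and3P[h4 h5 _].
  by field; rewrite h1 h2 h3 h4 h5.
rewrite big_ord_recr /= big1 ?add0r => [|j _].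
  rewrite subnn; congr (_ *: _).
  rewrite (big_pred1 ord0) => [|m]; last by rewrite /= -val_eqE /=; lia.
  by rewrite cE // subnn bin0 mul1r /bernoulli /= big_ord0 subr0 !mulr1 invr1 mulr1.
rewrite (eq_bigr (fun m : 'I_N.+1 => (((j : nat)`!%:R)^-1 * ((N - j).+1`!%:R)^-1)
   * ('C((N - j).+1, m)%:R * bernoulli K m))); last by move=> m /cE.
have jN := ltn_ord j.
rewrite -mulr_sumr.
have -> : \sum_(i < N.+1 | (i + j <= N)%N) 'C((N - j).+1, i)%:R * bernoulli K i
  = \sum_(i < (N - j).+1) 'C((N - j).+1, i)%:R * bernoulli K i.
  rewrite (big_ord_widen N.+1 (fun i => 'C((N - j).+1, i)%:R * bernoulli K i)); last by lia.
  by apply: eq_bigl => i; lia.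
rewrite sum_bernoulli; case: eqP; last by rewrite mulr0 scale0r.
by lia.
Qed.

End Bernoulli.

Section BernoulliSwap.
Variables (K : fieldType) (V : lmodType K) (l r : V -> V).
Hypothesis char0 : [pchar K] =i pred0.
Hypotheses (ll : linear l) (lr : linear r) (lrC : forall v, l (r v) = r (l v)).

Lemma mixedC n Y : mixed l r n Y = mixed r l n Y.
Proof.
rewrite /mixed (reindex_inj rev_ord_inj) /=; apply: eq_bigr => i _.
have -> : (n - (n.+1 - i.+1) = i)%N by have := ltn_ord i; lia.
have lC b v : l (iter b r v) = iter b r (l v) by elim: b => //= b <-.
have C a b v : iter a l (iter b r v) = iter b r (iter a l v) by elim: a => //= a ->.
by rewrite subSS C.
Qed.

(** Exchanging [l] and [r] changes the sign of [t], and turns the series of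
    [t / (e^t - 1)] into that of [t / (1 - e^(-t))]. *)
Lemma mixed_bernoulli_swap X N :
  \sum_(m < N.+1) ((-1) ^+ m * (bernoulli K m / m`!%:R) / (N - m).+1`!%:R) *:
     mixed l r (N - m) (iter m (fun v => r v - l v) X)
  = N`!%:R^-1 *: iter N r X.
Proof.
have rlC v : r (l v) = l (r v) by rewrite lrC.
rewrite -(mixed_bernoulli char0 lr ll rlC); apply: eq_bigr => m _.
have lt : linear (fun v => r v - l v) by exact: lin_sub.
have -> : iter m (fun v => l v - r v) X = (-1) ^+ m *: iter m (fun v => r v - l v) X.
  elim: (val m) => [|n IH]; first by rewrite scale1r.
  by rewrite !iterS IH (linZ ll) (linZ lr) -scalerBr exprS mulN1r scaleNr -scalerN opprB.
rewrite -mixedC /mixed scaler_sumr [in RHS]scaler_sumr; apply: eq_bigr => i _.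
rewrite (linZ (iter_lin _ lr)) (linZ (iter_lin _ ll)) !scalerA; congr (_ *: _).
by rewrite [RHS]mulrC !mulrA.
Qed.

End BernoulliSwap.

(** * Multiplication by a letter, transported by symmetrization *)

Section Symmetrization.
Variables (K : fieldType) (L : preLie K).
Hypothesis char0 : [pchar K] =i pred0.
Variable x : hel L.
Implicit Types (a b u v w : word L) (y z : hel L) (g : word L -> Env L).

(* Convolution on the left and on the right by the inclusion of the letters,
   on functions of degree [deg x]; [X0] is the constant [x]. *)
Let Lop g w : Env L := psum w (fun z b => ksign K (deg x * deg z) *: lmul z (g b)).
Let Rop g w : Env L := psumr w (fun a z => rmul z (g a)).
Let X0 w : Env L := if w is [::] then egen [:: x] else 0.
Let T g : word L -> Env L := Rop g - Lop g.

Let Lop_lin : linear Lop.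
Proof.
move=> c g h; apply/funext => w; rewrite /Lop -[RHS]/(c *: psum _ _ + psum _ _).
rewrite -psumZ -psumD; apply: eq_psum => z b.
by rewrite lmul_lin scalerDr !scalerA mulrC.
Qed.

Let Rop_lin : linear Rop.
Proof.
move=> c g h; apply/funext => w; rewrite /Rop -[RHS]/(c *: psumr _ _ + psumr _ _).
rewrite !psumr_psum -psumZ -psumD; apply: eq_psum => z b.
by rewrite rmul_lin scalerDr !scalerA mulrC.
Qed.

Let LopRop g : Lop (Rop g) = Rop (Lop g).
Proof.
apply/funext => w; rewrite /Lop /Rop.
transitivity (psum w (fun z b => psumr b (fun a y =>
    ksign K (deg x * deg z) *: lmul z (rmul y (g a))))).
  apply: eq_psum => z b; rewrite (lin_psumr _ _ (lmul_lin z)).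
  by rewrite !psumr_psum -psumZ; apply: eq_psum => y c; rewrite !scalerA mulrC.
rewrite psum_psumr; apply: eq_psumr => c y.
rewrite (lin_psum _ _ (rmul_lin y)); apply: eq_psum => z a.
by rewrite lmul_rmul (linZ (rmul_lin y)).
Qed.

Let iter_L n w :
  iter n Lop X0 w = ksign K (deg x * wdeg w) *: ssum n (fun v => egen (rcons v x)) w.
Proof.
elim: n w => [|n IH] w.
  by case: w => [|z w] /=; rewrite ?scaler0 // wdeg_nil mulr0 scale1r.
rewrite iterS /= -psumZ; apply: eq_psum_deg => z b _ <-.
rewrite IH (linZ (lmul_lin z)) ksignZ (lin_ssum _ _ _ (lmul_lin z)) mulrDr.
by congr (_ *: _); apply: eq_ssum => v; rewrite lmul_egen.
Qed.

Let iter_R n w : iter n Rop X0 w = ssum n (fun v => egen (x :: v)) w.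
Proof.
elim: n w => [|n IH] w; first by case: w.
rewrite iterS ssum_last; apply: eq_psumr => a z.
rewrite IH (lin_ssum _ _ _ (rmul_lin z)).
by apply: eq_ssum => v; rewrite rmul_egen.
Qed.

Lemma deg_foldl_hbr t w : deg (foldl (@hbr K L) t w) = deg t + wdeg w.
Proof.
elim: w t => [|y w IH] t /=; first by rewrite wdeg_nil addr0.
by rewrite IH deg_hbr wdeg_cons addrA.
Qed.

(** In the enveloping algebra the bracket is a commutator, so that iterated
    brackets are the powers of the difference of the two multiplications. *)
Let iter_T n w : iter n T X0 w = ssum n (fun v => egen [:: foldl (@hbr K L) x v]) w.
Proof.
elim: n w => [|n IH] w; first by case: w.
rewrite iterS ssum_last psumr_psum -[LHS]/(Rop _ w - Lop _ w) /Rop psumr_psum /Lop.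
rewrite -psumB; apply: eq_psum => z b; rewrite IH.
rewrite (lin_ssum _ _ _ (rmul_lin z)) (lin_ssum _ _ _ (lmul_lin z)).
rewrite -!ssumZ -[X in _ + X]scaleN1r -ssumZ -ssumD.
apply: eq_ssum_deg => v _ dv.
rewrite rmul_egen lmul_egen /= foldl_rcons.
have [_ br] := (env_killsP _).1 (@egen_kills K L).
have := br (foldl (@hbr K L) x v) z [::] [::] => /= ->.
rewrite scalerDr ksignZ scaleN1r addrAC deg_foldl_hbr -dv.
rewrite (@ksign_par K _ (deg x * deg z) (deg z * wdeg v)); last by ring.
by rewrite addrN add0r.
Qed.

(* The coefficients of [Phi x] on words of length [m], without numerical factor,
   and the same as letters. *)
Let phi m a : L := ssum m (fun v => vec (foldl (@hbr K L) x v)) a.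
Let zphi m a : hel L := mkhel (deg x + wdeg a) (phi m a).

Lemma foldl_hbr_lin c (p q r : hel L) w :
  deg p = deg r -> deg q = deg r -> vec r = c *: vec p + vec q ->
  vec (foldl (@hbr K L) r w)
  = c *: vec (foldl (@hbr K L) p w) + vec (foldl (@hbr K L) q w).
Proof.
elim: w p q r => [|y w IH] p q r hp hq hr //=; apply: IH.
- by rewrite !deg_hbr hp.
- by rewrite !deg_hbr hq.
by rewrite !vec_hbr; exact: lbr_linl.
Qed.

Lemma foldl_hbr_multilin t : multilin (fun v => vec (foldl (@hbr K L) t v)).
Proof.
move=> c y y' z u v hy hy' hz; rewrite !foldl_cat /=.
apply: foldl_hbr_lin; rewrite ?deg_hbr ?hy ?hy' // !vec_hbr.
exact: lbr_linr.
Qed.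

Let phi_homog m a : homog (deg x + wdeg a) (phi m a).
Proof.
apply: homog_ssum => v _ <-; rewrite -deg_foldl_hbr; exact: homog_vec.
Qed.

Let egen_zphi m a : egen [:: zphi m a] = iter m T X0 a.
Proof.
have lin1 n : linear (fun t : L => egen [:: mkhel n t]).
  exact: (multilin_mkhel n [::] [::] (@egen_multilin K L)).
rewrite iter_T /zphi /phi (lin_ssum _ _ _ (lin1 _)); apply: eq_ssum_deg => v _ dv.
by rewrite -dv -deg_foldl_hbr mkhel_vec.
Qed.

(* Up to factorials, symmetrization after the coderivation with coefficients
   [phi m], on the terms where [n] letters remain. *)
Let H n m w : Env L := usum w (fun a b => ssum n.+1 (@egen K L) (zphi m a :: b)).

(* The terms of [H] where the new letter comes first. *)
Let iter_Rop_zphi n m w :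
  usum w (fun a b => lmul (zphi m a) (ssum n (@egen K L) b))
  = iter n Rop (iter m T X0) w.
Proof.
elim: n w => [|n IH] w.
  rewrite usum_rnil /= ?lmul_egen ?egen_zphi // => a [|z b] // _.
  exact: lin0 (lmul_lin _).
transitivity (usum w (fun a b => psumr b (fun c y =>
    rmul y (lmul (zphi m a) (ssum n (@egen K L) c))))).
  apply: eq_usum => a b; rewrite ssum_last (lin_psumr _ _ (lmul_lin _)).
  apply: eq_psumr => c y; rewrite -lmul_rmul (lin_ssum _ _ _ (rmul_lin y)).
  by congr (lmul _ _); apply: eq_ssum => v; rewrite rmul_egen.
rewrite usum_psumr_coassoc iterS; apply: eq_psumr => c y.
by rewrite -IH (lin_usum _ _ (rmul_lin y)).
Qed.

Lemma ssum_egen_rec n w :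
  ssum n.+1 (@egen K L) w = psum w (fun z b => lmul z (ssum n (@egen K L) b)).
Proof.
apply: eq_psum => z b; rewrite (lin_ssum _ _ _ (lmul_lin z)).
by apply: eq_ssum => v; rewrite lmul_egen.
Qed.

(** The letter [zphi m a] occupies each position of the symmetrized word once,
    with letters multiplied on its left and on its right. *)
Let H_mixed n m : H n m = mixed Lop Rop n (iter m T X0).
Proof.
have HE k w : H k m w = iter k Rop (iter m T X0) w
   + psum w (fun y c => ksign K (deg x * deg y) *:
       lmul y (usum c (fun a b => ssum k (@egen K L) (zphi m a :: b)))).
  rewrite -iter_Rop_zphi /H.
  rewrite (eq_psum _ (g := fun y c => usum c (fun a b => ksign K (deg x * deg y) *:
       lmul y (ssum k (@egen K L) (zphi m a :: b))))); last first.
    by move=> y c; rewrite (lin_usum _ _ (lmul_lin y)) usumZ.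
  rewrite psum_usum_exchange -usumD; apply: eq_usum => a b.
  rewrite ssum_egen_rec psum_cons; congr (_ + _); apply: eq_psum => y c.
  by rewrite ksignZ; congr (ksign _ _ *: _); rewrite /zphi /deg /=; ring.
elim: n => [|n IH]; apply/funext => w; rewrite HE.
  rewrite /mixed big_ord1 psum0 ?addr0 // => y c.
  by rewrite usum0 ?(lin0 (lmul_lin _)) ?scaler0.
by rewrite (mixed_rec Rop Lop_lin) -IH.
Qed.

(** Common form of [Phi_coef] and [Phi_bot_coef], which differ by their numerical
    factors only. *)
Definition adcoef (c : nat -> K) w : L :=
  c (size w) *: ssum (size w) (fun v => vec (foldl (@hbr K L) x v)) w.

Lemma adcoef_coefs c : coefs (deg x) (adcoef c).
Proof.
split; first exact: (ssum_kills_size c (@foldl_hbr_multilin x)).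
by move=> w; apply: homogZ; exact: phi_homog.
Qed.

(* The sum over [m] separates the unshuffles according to the length of the
   part that is consumed; [phi m] vanishes on words of another length. *)
Let sym_adcoef c w : sym (coder (deg x) (adcoef c) (sgen w)) =
  \sum_(m < (size w).+1) (c m / (size w - m).+1`!%:R) *:
     mixed Lop Rop (size w - m) (iter m (fun g => Rop g - Lop g) X0) w.
Proof.
rewrite coder_sgen; last exact: (adcoef_coefs c).1.
rewrite (lin_usum _ _ (@sym_lin K L)).
rewrite (eq_bigr (fun m : 'I_(size w).+1 => usum w (fun a b =>
   (c m / (size w - m).+1`!%:R) *: ssum (size w - m).+1 (@egen K L) (zphi m a :: b)))); last first.
  by move=> m _; rewrite -H_mixed usumZ.
rewrite -usum_sum; apply: eq_usum_deg => a b sab _.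
have ml n : multilin (ssum n (@egen K L)).
  by have [] := (sym_killsP _).1 (ssum_kills n (@egen_multilin K L)).
have am : (size a < (size w).+1)%N by lia.
rewrite (bigD1 (Ordinal am)) // big1 ?addr0 => [|m]; last first.
  rewrite -val_eqE => /eqP nm.
  suff -> : ssum (size w - m).+1 (@egen K L) (zphi m a :: b) = 0 by rewrite scaler0.
  apply: (multilin_zero [::] b (ml _)); rewrite /zphi /phi ssum_size; last by move=> e; apply: nm.
  by rewrite /vec /= gproj0.
rewrite -[val (Ordinal am)]/(size a).
have -> : (size w - size a)%N = size b by lia.
rewrite sym_sgen // /adcoef -[size (_ :: b)]/(size b).+1 (linZ (multilin_mkhel _ [::] b (ml _))).
by rewrite [RHS]addr0 scalerA mulrC.
Qed.

Lemma Phi_bot_coefE w : Phi_bot_coef x w = adcoef (fun n => bernoulli K n / n`!%:R) w.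
Proof. by rewrite /Phi_bot_coef (ssum_perm w (fun v => vec (foldl (@hbr K L) x v))). Qed.

Lemma Phi_coefE w :
  Phi_coef x w = adcoef (fun n => (-1) ^+ n * (bernoulli K n / n`!%:R)) w.
Proof. by rewrite /Phi_coef Phi_bot_coefE scalerA. Qed.

Lemma Phi_bot_coefs : coefs (deg x) (Phi_bot_coef x).
Proof. rewrite (funext Phi_bot_coefE); exact: adcoef_coefs. Qed.

Lemma Phi_coefs : coefs (deg x) (Phi_coef x).
Proof. rewrite (funext Phi_coefE); exact: adcoef_coefs. Qed.

Lemma sym_Phi_bot m : sym (Phi_bot x m) = env_rmul x (sym m).
Proof.
move: m; apply: Sym_linext.
- exact: lin_comp (@sym_lin K L) (coder_lin _ _).
- exact: lin_comp (env_rmul_lin x) (@sym_lin K L).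
move=> w; rewrite /Phi_bot (funext Phi_bot_coefE) sym_adcoef.
have := mixed_bernoulli char0 Lop_lin Rop_lin LopRop X0 (size w).
move=> /(congr1 (fun f => f w)); rewrite fct_sumE => ->.
rewrite -[LHS]/((size w)`!%:R^-1 *: iter (size w) Lop X0 w) iter_L sym_sgen.
rewrite (linZ (env_rmul_lin x)) (lin_ssum _ _ _ (env_rmul_lin x)).
congr (_ *: _); rewrite -ssumZ.
by apply: eq_ssum_deg => v _ dv; rewrite env_rmul_egen dv.
Qed.

Lemma sym_Phi m : sym (Phi x m) = lmul x (sym m).
Proof.
move: m; apply: Sym_linext.
- exact: lin_comp (@sym_lin K L) (coder_lin _ _).
- exact: lin_comp (lmul_lin x) (@sym_lin K L).
move=> w; rewrite /Phi (funext Phi_coefE) sym_adcoef.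
have := mixed_bernoulli_swap char0 Lop_lin Rop_lin LopRop X0 (size w).
move=> /(congr1 (fun f => f w)); rewrite fct_sumE => ->.
rewrite -[LHS]/((size w)`!%:R^-1 *: iter (size w) Rop X0 w) iter_R sym_sgen.
rewrite (linZ (lmul_lin x)) (lin_ssum _ _ _ (lmul_lin x)).
by congr (_ *: _); apply: eq_ssum => v; rewrite lmul_egen.
Qed.

End Symmetrization.

(** * The Lie algebra actions on the symmetric coalgebra *)

Section Actions.
Variables (K : fieldType) (L : preLie K).
Hypothesis char0 : [pchar K] =i pred0.
Implicit Types (a b u v w : word L) (x y z : hel L) (m : Sym L) (e : Env L).

Lemma lmul_linl c x y z e : deg x = deg z -> deg y = deg z ->
  vec z = c *: vec x + vec y -> lmul z e = c *: lmul x e + lmul y e.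
Proof.
move=> hx hy hz; move: e; apply: Env_linext.
- exact: lmul_lin.
- by apply: lin_add; [apply: lin_scale|]; exact: lmul_lin.
by move=> w; rewrite !lmul_egen; exact: (@egen_multilin K L c x y z [::] w).
Qed.

Lemma env_rmul_linl c x y z e : deg x = deg z -> deg y = deg z ->
  vec z = c *: vec x + vec y -> env_rmul z e = c *: env_rmul x e + env_rmul y e.
Proof.
move=> hx hy hz; move: e; apply: Env_linext.
- exact: env_rmul_lin.
- by apply: lin_add; [apply: lin_scale|]; exact: env_rmul_lin.
move=> w; rewrite !env_rmul_egen hx hy -!cats1.
by rewrite (@egen_multilin K L c x y z w [::]) // scalerDr !scalerA mulrC.
Qed.

Lemma lmul_hbr x y e :
  lmul (hbr x y) e = lmul x (lmul y e) - ksign K (deg x * deg y) *: lmul y (lmul x e).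
Proof.
move: e; apply: Env_linext.
- exact: lmul_lin.
- apply: lin_sub; first exact: lin_comp (lmul_lin _) (lmul_lin _).
  by apply: lin_scale; exact: lin_comp (lmul_lin _) (lmul_lin _).
move=> w; rewrite !lmul_egen; have [_ br] := (env_killsP _).1 (@egen_kills K L).
by have /= -> := br x y [::] w; rewrite addrC addKr.
Qed.

Lemma env_rmul_hbr x y e : - env_rmul (hbr x y) e
  = env_rmul x (env_rmul y e) - ksign K (deg x * deg y) *: env_rmul y (env_rmul x e).
Proof.
move: e; apply: Env_linext.
- by apply: lin_opp; exact: env_rmul_lin.
- apply: lin_sub; first exact: lin_comp (env_rmul_lin _) (env_rmul_lin _).
  by apply: lin_scale; exact: lin_comp (env_rmul_lin _) (env_rmul_lin _).
move=> w; rewrite !env_rmul_egen !(linZ (env_rmul_lin _)) !env_rmul_egen -!cats1.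
rewrite !cats1 !ksignZ -!cats1 -!catA /= !wdeg_cat !wdeg_cons wdeg_nil !addr0 deg_hbr.
have [_ br] := (env_killsP _).1 (@egen_kills K L).
rewrite (br x y w [::]) scalerDr ksignZ opprD addrA.
set p := deg x * deg y + deg x * wdeg w + deg y * (wdeg w + deg x).
rewrite (@ksign_par K (p + deg x * deg y) (deg y * wdeg w + deg x * (wdeg w + deg y))
  (deg x * deg y)); last by rewrite /p; ring.
rewrite (@ksign_par K p ((deg x + deg y) * wdeg w) (deg x * deg y)); last by rewrite /p; ring.
by rewrite addrN add0r.
Qed.

Lemma lmul_env_rmul x y e :
  lmul x (env_rmul y e) = ksign K (deg x * deg y) *: env_rmul y (lmul x e).
Proof.
move: e; apply: Env_linext.
- exact: lin_comp (lmul_lin _) (env_rmul_lin _).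
- by apply: lin_scale; exact: lin_comp (env_rmul_lin _) (lmul_lin _).
move=> w; rewrite lmul_egen !env_rmul_egen (linZ (lmul_lin _)) lmul_egen ksignZ.
rewrite wdeg_cons; congr (_ *: _); apply: (@ksign_par _ _ _ (- (deg x * deg y))); ring.
Qed.

(** The range of [sym] contains the unit and is stable under left
    multiplication by a letter. *)
Lemma sym_surj e : exists m, sym m = e.
Proof.
have [l ->] := pmod_lincomb e; elim: l => [|[c w] l [m IH]].
  by exists 0; rewrite (lin0 (@sym_lin K L)) /lincomb big_nil.
have [m' e'] : exists m', sym m' = egen w.
  elim: w => [|x w [m' e']]; first by exists (sone L); exact: sym_one.
  by exists (Phi x m'); rewrite (sym_Phi char0) e' lmul_egen.
by exists (c *: m' + m); rewrite (@sym_lin K L) e' IH [in RHS]/lincomb big_cons.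
Qed.

(** [eta] is injective because [E], its composite with the surjection [sym], is. *)
Lemma eta_inj : injective (@eta K L).
Proof.
move=> e e'; have [m <-] := sym_surj e; have [m' <-] := sym_surj e'.
by move=> /(E_inj char0) ->.
Qed.

Lemma E_Phi x m : E (Phi x m) = s x (E m).
Proof. by rewrite /E (sym_Phi char0) (eta_lmul char0). Qed.

Lemma E_Phi_bot x m : E (Phi_bot x m) = s_bot x (E m).
Proof. by rewrite /s_bot /E (sym_Phi_bot char0) (inverse_map_can eta_inj). Qed.

Lemma Phi_coder x : is_coder (deg x) (Phi x).
Proof. exact/coder_is_coder/Phi_coefs. Qed.

Lemma Phi_bot_coder x : is_coder (deg x) (Phi_bot x).
Proof. exact/coder_is_coder/Phi_bot_coefs. Qed.

Lemma Phi_lin x : linear (Phi x). Proof. exact: coder_lin. Qed.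
Lemma Phi_bot_lin x : linear (Phi_bot x). Proof. exact: coder_lin. Qed.

(** As [sym] is injective, the identities between the operators [Phi] and
    [Phi_bot] follow from those between left and right multiplications. *)
Lemma Phi_linl c x y z m : deg x = deg z -> deg y = deg z ->
  vec z = c *: vec x + vec y -> Phi z m = c *: Phi x m + Phi y m.
Proof.
move=> hx hy hz; apply: (sym_inj char0).
by rewrite (@sym_lin K L) !(sym_Phi char0); exact: lmul_linl.
Qed.

Lemma Phi_bot_linl c x y z m : deg x = deg z -> deg y = deg z ->
  vec z = c *: vec x + vec y -> Phi_bot z m = c *: Phi_bot x m + Phi_bot y m.
Proof.
move=> hx hy hz; apply: (sym_inj char0).
by rewrite (@sym_lin K L) !(sym_Phi_bot char0); exact: env_rmul_linl.
Qed.

Lemma Phi_hbr x y m :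
  Phi (hbr x y) m = Phi x (Phi y m) - ksign K (deg x * deg y) *: Phi y (Phi x m).
Proof.
apply: (sym_inj char0); rewrite (linB (@sym_lin K L)) (linZ (@sym_lin K L)).
by rewrite !(sym_Phi char0); exact: lmul_hbr.
Qed.

Lemma Phi_bot_hbr x y m : - Phi_bot (hbr x y) m
  = Phi_bot x (Phi_bot y m) - ksign K (deg x * deg y) *: Phi_bot y (Phi_bot x m).
Proof.
apply: (sym_inj char0).
rewrite (linN (@sym_lin K L)) (linB (@sym_lin K L)) (linZ (@sym_lin K L)).
by rewrite !(sym_Phi_bot char0); exact: env_rmul_hbr.
Qed.

Lemma Phi_Phi_bot x y m :
  Phi x (Phi_bot y m) = ksign K (deg x * deg y) *: Phi_bot y (Phi x m).
Proof.
apply: (sym_inj char0); rewrite (linZ (@sym_lin K L)).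
rewrite (sym_Phi char0) !(sym_Phi_bot char0) (sym_Phi char0).
exact: lmul_env_rmul.
Qed.

(** ** Compatibility with a derivation *)

Variable d : L -> L.
Hypothesis hd : is_dg_derivation d.

Let ld : linear d. Proof. by case: hd => -[]. Qed.

Definition dhel x : hel L := mkhel (deg x + 1) (d (vec x)).

Lemma deg_dhel x : deg (dhel x) = deg x + 1. Proof. by []. Qed.

Lemma vec_dhel x : vec (dhel x) = d (vec x).
Proof.
by apply: vec_mkhel; case: hd => -[_ h _ _]; apply: h; exact: homog_vec.
Qed.

Lemma lincoef_coefs : coefs 1 (lincoef d).
Proof.
split=> [|[|x [|y w]]] /=; try exact: homog0.
  apply/sym_killsP; split=>
  [c y y' z [|u1 [|u2 u]] [|v1 v] hx hy hz /=|y z [|u1 [|u2 u]] v /=];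
  by rewrite ?scaler0 ?addr0 // hz ld.
by rewrite wdeg_cons wdeg_nil addr0 -vec_dhel addrC; exact: (homog_vec (dhel x)).
Qed.

Lemma lin_coder_coder : is_coder 1 (lin_coder d).
Proof. exact: coder_is_coder lincoef_coefs. Qed.

Lemma sproj1_lin_coder m : sproj1 (lin_coder d m) = d (sproj1 m).
Proof.
move: m; apply: Sym_linext.
- exact: lin_comp (@sproj1_lin K L) (coder_lin _ _).
- exact: lin_comp ld (@sproj1_lin K L).
move=> w; rewrite sproj1_sgen -[LHS]/(taylor (lin_coder d) w).
rewrite (taylor_coder _ lincoef_coefs).
by case: w => [|x [|y w]] /=; rewrite ?(lin0 ld).
Qed.

Lemma lin_coder_sgen w : lin_coder d (sgen w) = psum w (fun z b => sgen (dhel z :: b)).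
Proof.
rewrite /lin_coder coder_sgen; last exact: lincoef_coefs.1.
have g0 n b : sgen (mkhel n (0 : L) :: b) = 0.
  by apply: (sgen_zero [::]); rewrite /vec /= gproj0.
apply: eq_usum => -[|x [|y a]] b; rewrite ?g0 //=.
by rewrite wdeg_cons wdeg_nil addr0 addrC.
Qed.

Fixpoint dword (W : lmodType K) (g : word L -> W) w : W :=
  if w is y :: v then g (dhel y :: v) + ksign K (deg y) *: dword (fun v => g (y :: v)) v
  else 0.

(** Symmetrization commutes with derivations of words. *)
Lemma ssum_dword (W : lmodType K) n (g : word L -> W) w :
  psum w (fun z b => ssum n g (dhel z :: b)) = ssum n (dword g) w.
Proof.
elim: n g w => [|n IH] g w; first by rewrite psum0 //; case: w.
have ssumS (h : word L -> W) v :
  ssum n.+1 h v = psum v (fun z b => ssum n (fun v => h (z :: v)) b) by [].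
rewrite (eq_psum _ (g := fun z b => ssum n (fun v => g (dhel z :: v)) b +
  psum b (fun y b' => ksign K (deg (dhel z) * deg y) *:
    ssum n (fun v => g (y :: v)) (dhel z :: b')))); last first.
  by move=> z b; rewrite ssumS psum_cons.
rewrite psumD psum_exchange ssumS.
rewrite [RHS](eq_psum _ (g := fun y c => ssum n (fun v => g (dhel y :: v)) c
   + ksign K (deg y) *: ssum n (dword (fun v => g (y :: v))) c)); last first.
  by move=> y c; rewrite -ssumZ -ssumD; apply: eq_ssum.
rewrite psumD; congr (_ + _); apply: eq_psum => y c.
rewrite -IH -psumZ; apply: eq_psum => z b; rewrite ksignZ; congr (_ *: _).
by apply: (@ksign_par _ _ _ (deg z * deg y)); rewrite /dhel /deg /=; ring.
Qed.

Lemma d_foldl_hbr x w : d (vec (foldl (@hbr K L) x w))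
  = vec (foldl (@hbr K L) (dhel x) w)
    + ksign K (deg x) *: dword (fun v => vec (foldl (@hbr K L) x v)) w.
Proof.
elim: w x => [|y w IH] x /=; first by rewrite scaler0 addr0 vec_dhel.
rewrite IH (@foldl_hbr_lin K L (ksign K (deg x)) (hbr x (dhel y)) (hbr (dhel x) y)).
- by rewrite deg_hbr scalerDr ksignZ [RHS]addrCA addrA.
- by rewrite !(deg_dhel, deg_hbr); ring.
- by rewrite !(deg_dhel, deg_hbr); ring.
by rewrite vec_dhel !vec_hbr; case: hd => _ -> _; rewrite addrC.
Qed.

(** Both sides are coderivations; on corestrictions, the identity is the Leibniz
    rule for iterated brackets, summed over all orders of the letters. *)
Lemma adcoef_derivation c x m :
  lin_coder d (coder (deg x) (adcoef x c) m)
    - ksign K (deg x) *: coder (deg x) (adcoef x c) (lin_coder d m)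
  = coder (deg (dhel x)) (adcoef (dhel x) c) m.
Proof.
move: m; have ca := coder_is_coder (adcoef_coefs x c).
have hP := is_coder_comm lin_coder_coder ca; rewrite mul1r addrC in hP.
have hQ : is_coder (deg x + 1) (coder (deg (dhel x)) (adcoef (dhel x) c)).
  exact: coder_is_coder (adcoef_coefs (dhel x) c).
apply: (coder_ext char0 hP hQ) => w.
rewrite (taylor_coder _ (adcoef_coefs _ _)) /taylor (linB (@sproj1_lin K L)).
rewrite (linZ (@sproj1_lin K L)) sproj1_lin_coder.
rewrite -[sproj1 (coder _ _ (sgen w))]/(taylor (coder (deg x) (adcoef x c)) w).
rewrite (taylor_coder _ (adcoef_coefs _ _)) lin_coder_sgen.
rewrite (lin_psum _ _ (coder_lin _ _)) (lin_psum _ _ (@sproj1_lin K L)).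
rewrite (@eq_psum_deg _ _ _ _ _ (fun z b =>
   c (size w) *: ssum (size w) (fun v => vec (foldl (@hbr K L) x v)) (dhel z :: b))).
  rewrite psumZ ssum_dword /adcoef (linZ ld) (lin_ssum _ _ _ ld).
  rewrite scalerA mulrC -scalerA -scalerBr; congr (_ *: _).
  rewrite -ssumZ -[X in _ + X]scaleN1r -ssumZ -ssumD; apply: eq_ssum => v.
  by rewrite scaleN1r d_foldl_hbr addrK.
move=> z b sb _; rewrite -[LHS]/(taylor (coder (deg x) (adcoef x c)) (dhel z :: b)).
by rewrite (taylor_coder _ (adcoef_coefs _ _)) /adcoef -[size (_ :: b)]/(size b).+1 sb.
Qed.

Lemma Phi_derivation x m : Phi (dhel x) m
  = lin_coder d (Phi x m) - ksign K (deg x) *: Phi x (lin_coder d m).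
Proof.
rewrite /Phi (funext (Phi_coefE x)) (funext (Phi_coefE (dhel x))).
by rewrite adcoef_derivation.
Qed.

Lemma Phi_bot_derivation x m : Phi_bot (dhel x) m
  = lin_coder d (Phi_bot x m) - ksign K (deg x) *: Phi_bot x (lin_coder d m).
Proof.
rewrite /Phi_bot (funext (Phi_bot_coefE x)) (funext (Phi_bot_coefE (dhel x))).
by rewrite adcoef_derivation.
Qed.

End Actions.

(** * The coderivation of a dg Lie algebra *)

Section DglStructure.
Variables (K : fieldType) (M : dgl K).

Definition br_hel (x y : hel M) : hel M := mkhel (deg x + deg y) (dgl_br x y).
Definition d_hel (x : hel M) : hel M := mkhel (deg x + 1) (dgl_d (vec x)).

(** Linearity in the second variable follows from antisymmetry. *)
Record is_dgl : Prop := IsDgl {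
  dgl_d_deg : deg_map 1 (@dgl_d K M);
  dgl_d_sq : forall v : M, dgl_d (dgl_d v) = 0;
  dgl_br_homog : forall x y : hel M, homog (deg x + deg y) (dgl_br x y);
  dgl_br_linl : forall c (x y z t : hel M), deg x = deg z -> deg y = deg z ->
    vec z = c *: vec x + vec y -> dgl_br z t = c *: dgl_br x t + dgl_br y t;
  dgl_br_anti : forall x y : hel M,
    dgl_br x y = - (ksign K (deg x * deg y) *: dgl_br y x);
  dgl_leibniz : forall x y : hel M, dgl_d (dgl_br x y)
    = dgl_br (d_hel x) y + ksign K (deg x) *: dgl_br x (d_hel y);
  dgl_jacobi : forall x y z : hel M, dgl_br x (br_hel y z)
    = dgl_br (br_hel x y) z + ksign K (deg x * deg y) *: dgl_br y (br_hel x z)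
}.

Hypotheses (char0 : [pchar K] =i pred0) (hM : is_dgl).
Local Notation B := (shift M 1).
Implicit Types (x y z : hel B) (w : word B).

Lemma vec_unshift x : vec (unshift x) = vec x.
Proof. exact: (gproj_vec x). Qed.

Lemma deg_unshift x : deg (unshift x) = 1 + deg x. Proof. by []. Qed.

Lemma unshift_mkhel n (v : B) : unshift (mkhel n v) = @mkhel K M (1 + n) v.
Proof. by apply: hel_eq => //; rewrite vec_unshift. Qed.

Let ld : linear (@dgl_d K M). Proof. exact: (dgl_d_deg hM).1. Qed.

Lemma vec_d_hel x : vec (d_hel (unshift x)) = dgl_d (vec x).
Proof.
rewrite vec_mkhel ?vec_unshift //; apply: (dgl_d_deg hM).2.
by rewrite -vec_unshift; exact: homog_vec.
Qed.

Lemma dgl_br_linr c (x y z t : hel M) : deg x = deg z -> deg y = deg z ->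
  vec z = c *: vec x + vec y -> dgl_br t z = c *: dgl_br t x + dgl_br t y.
Proof.
move=> hx hy hz; rewrite (dgl_br_anti hM t z) (dgl_br_anti hM t x) (dgl_br_anti hM t y).
rewrite (@dgl_br_linl hM c x y z t hx hy hz) hx hy scalerDr opprD scalerN !scalerA.
by rewrite [_ * c]mulrC.
Qed.

Lemma dgl_br_scalel c (x z t : hel M) : deg x = deg z -> vec z = c *: vec x ->
  dgl_br z t = c *: dgl_br x t.
Proof.
move=> hx hz.
have z0 (p : hel M) : vec p = 0 -> dgl_br p t = 0.
  move=> p0; have := @dgl_br_linl hM (-1) p p p t erefl erefl.
  by rewrite p0 scaler0 addr0 scaleN1r addNr; apply.
pose o : hel M := mkhel (deg z) 0.
have vo : vec o = 0 by rewrite /o /vec /= gproj0.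
have e : vec z = c *: vec x + vec o by rewrite vo addr0.
by rewrite (@dgl_br_linl hM c x o z t hx erefl e) (z0 o vo) addr0.
Qed.

Lemma dgl_coefs : coefs 1 (@dgl_coef K M).
Proof.
split.
  apply/sym_killsP; split.
    move=> c x y z [|u1 [|u2 [|u3 u]]] [|v1 [|v2 v]] hx hy hz /=; rewrite ?scaler0 ?addr0 //.
    - by rewrite !vec_unshift hz ld opprD scalerN.
    - rewrite (@dgl_br_linl hM c (unshift x) (unshift y)) ?deg_unshift ?hx ?hy //;
        last by rewrite !vec_unshift.
      by rewrite scalerDr !scalerA mulrC.
    - rewrite (@dgl_br_linr c (unshift x) (unshift y)) ?deg_unshift ?hx ?hy //;
        last by rewrite !vec_unshift.
      by rewrite scalerDr !scalerA mulrC.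
  move=> x y [|u1 [|u2 [|u3 u]]] [|v1 v] /=; rewrite ?scaler0 //.
  rewrite (dgl_br_anti hM) -scaleN1r !ksignZ scalerA -ksign1 -ksignD !ksignZ !deg_unshift.
  congr (_ *: _).
  by apply: (@ksign_par _ _ _ (1 + deg x)); ring.
move=> [|x [|y [|z w]]] /=; try exact: homog0.
- rewrite wdeg_cons wdeg_nil addr0; apply: homogN.
  rewrite -[homog _ _]/(@homog K M (1 + (1 + deg x)) (dgl_d (vec (unshift x)))).
  by rewrite addrC; apply: (dgl_d_deg hM).2; exact: (homog_vec (unshift x)).
- rewrite !wdeg_cons wdeg_nil addr0; apply: homogZ.
  have := dgl_br_homog hM (unshift x) (unshift y); rewrite !deg_unshift.
  by rewrite -[homog (V := B) _ _]/(@homog K M (1 + (1 + (deg x + deg y))) _);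
    congr homog; ring.
Qed.

Lemma dgl_Linf_coder : is_coder 1 (dgl_Linf M).
Proof. exact: coder_is_coder dgl_coefs. Qed.

Let mk a : hel B := mkhel (1 + wdeg a) (dgl_coef a).

Let deg_mk a : deg (mk a) = 1 + wdeg a. Proof. by []. Qed.
Let deg_d_hel (x : hel M) : deg (d_hel x) = deg x + 1. Proof. by []. Qed.
Let deg_br_hel (x y : hel M) : deg (br_hel x y) = deg x + deg y. Proof. by []. Qed.
Let degE := (deg_unshift, deg_mk, deg_d_hel, deg_br_hel, @wdeg_cons, @wdeg_nil).

Let mk1 x : dgl_coef [:: mk [:: x]] = 0.
Proof.
rewrite /= unshift_mkhel vec_mkhel; last exact: (dgl_coefs.2 [:: x]).
by rewrite (linN ld) vec_unshift dgl_d_sq ?oppr0.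
Qed.

Let mk_d x t : dgl_coef [:: mk [:: x]; t]
  = ksign K (deg (unshift x)) *: dgl_br (d_hel (unshift x)) (unshift t).
Proof.
rewrite -[LHS]/(ksign K _ *: dgl_br (unshift (mk [:: x])) (unshift t)).
rewrite (@dgl_br_scalel (-1) (d_hel (unshift x))).
- rewrite scalerA mulrN1 -ksignS; congr (_ *: _); apply: (@ksign_par _ _ _ 1).
  by rewrite !degE; ring.
- by rewrite !degE; ring.
by rewrite vec_unshift vec_d_hel scaleN1r vec_mkhel ?dgl_coefs.2 //= vec_unshift.
Qed.

Let vec_mk2 x y : vec (unshift (mk [:: x; y]))
  = ksign K (deg (unshift x)) *: vec (br_hel (unshift x) (unshift y)).
Proof.
rewrite vec_unshift !vec_mkhel ?dgl_coefs.2 //; exact: dgl_br_homog.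
Qed.

Let mk_br x y : dgl_coef [:: mk [:: x; y]]
  = - (ksign K (deg (unshift x)) *: dgl_d (dgl_br (unshift x) (unshift y))).
Proof.
rewrite -[LHS]/(- dgl_d _) vec_mk2 (linZ ld) vec_mkhel //; exact: dgl_br_homog.
Qed.

Let mk_br2 x y t : dgl_coef [:: mk [:: x; y]; t] = ksign K (deg (unshift y)) *:
  dgl_br (br_hel (unshift x) (unshift y)) (unshift t).
Proof.
rewrite -[LHS]/(ksign K _ *: dgl_br (unshift (mk [:: x; y])) (unshift t)).
rewrite (@dgl_br_scalel _ _ _ _ _ (vec_mk2 x y)).
  rewrite ksignZ; congr (_ *: _); apply: (@ksign_par _ _ _ (deg (unshift x))).
  by rewrite !degE; ring.
by rewrite !degE; ring.
Qed.

(** The corestriction of the square vanishes on words of length one, two and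
    three by [d^2 = 0], the Leibniz rule and the Jacobi identity, and on longer
    words because the coefficients have at most two arguments. *)
Lemma dgl_Linf_is_Linf : is_Linf (dgl_Linf M).
Proof.
have tQ w : sproj1 (dgl_Linf M (sgen w)) = dgl_coef w by exact: (taylor_coder _ dgl_coefs).
split; [exact: dgl_Linf_coder | exact: tQ | apply: (sq_coder_eq0 char0 dgl_Linf_coder)].
move=> w; rewrite {2}/dgl_Linf coder_sgen; last exact: dgl_coefs.1.
rewrite (lin_usum _ _ (is_coder_lin dgl_Linf_coder)) (lin_usum _ _ (@sproj1_lin K B)).
rewrite (eq_usum _ (G := fun a b => dgl_coef (mk a :: b))); last by move=> a b; exact: tQ.
have [ml _] := (sym_killsP _).1 dgl_coefs.1.
have mk0 a b : dgl_coef a = 0 -> dgl_coef (mk a :: b) = 0.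
  by move=> a0; apply: (multilin_zero [::] b ml); rewrite /mk a0 /vec /= gproj0.
case: w => [|x [|y [|z [|t w]]]].
- by rewrite usum_nil mk0.
- by rewrite usum_cons !usum_nil mk1 mk0 // scaler0 addr0.
- rewrite !usum_cons !usum_nil !(mk0 [::]) // mk_br !mk_d !scaler0 addr0.
  rewrite (dgl_leibniz hM) (dgl_br_anti hM (d_hel (unshift y))).
  rewrite -[- (_ *: dgl_br _ _)]scaleN1r -ksign1 !scalerDr !ksignZ wdeg_nil mulr0 add0r.
  rewrite opprD [X in X + _]addrAC addNr add0r addrC; apply/eqP; rewrite subr_eq0; apply/eqP.
  congr (_ *: _); rewrite !degE; apply: (@ksign_par _ _ _ (deg x * deg y + deg y + 1)); ring.
- rewrite !usum_cons !usum_nil !(mk0 [::]) //.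
  have c3 a b1 b2 b : dgl_coef (mk a :: b1 :: b2 :: b) = 0 by [].
  have d3 : dgl_coef (mk [:: x; y; z] :: [::]) = 0.
    by apply: (multilin_zero [::] [::] ml); rewrite /mk /vec /= gproj0.
  rewrite !c3 d3 !mk_br2 !scaler0 !addr0 !add0r.
  have := dgl_jacobi hM (unshift x) (unshift y) (unshift z).
  rewrite (dgl_br_anti hM (br_hel (unshift x) (unshift z))).
  rewrite (dgl_br_anti hM (br_hel (unshift y) (unshift z))).
  move=> ->.
  rewrite -!scaleN1r -ksign1 !scalerDr !ksignZ addrACA -!scalerDl !degE.
  rewrite (@ksign_cancel _ _ _
    (deg x * deg y + deg x * deg z + 1 + deg z + deg x)); last by ring.
  rewrite (@ksign_cancel _ _ _
    (deg x * deg y + deg x * deg z - deg y * deg z + deg x)); last by ring.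
  by rewrite !scale0r addr0.
rewrite (@eq_usum_deg _ _ _ _ _ (fun _ _ => 0)) ?usum0 // => a b sab _.
case: a sab => [|a1 [|a2 [|a3 a]]] sab; try by rewrite mk0.
  by case: b sab => [|b1 [|b2 b]].
by case: b sab => [|b1 [|b2 b]].
Qed.

End DglStructure.

(** * Extensions by a dg Lie algebra acting by coderivations *)

Lemma kills_append (K : fieldType) (V : gspace K) (W : lmodType K)
    (f : word V -> W) u : skills f -> skills (fun w => f (w ++ u)).
Proof.
move=> /sym_killsP [ml gs]; apply/sym_killsP; split.
  by move=> c x y z a b hx hy hz; rewrite -!catA /= (ml c x y z).
by move=> x y a b; rewrite -!catA /= gs.
Qed.

Lemma usumC (K : fieldType) (V V' : gspace K) (W : lmodType K) (w : word V) (w' : word V')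
    (F : word V -> word V -> word V' -> word V' -> W) :
  usum w (fun a b => usum w' (F a b)) = usum w' (fun c d => usum w (fun a b => F a b c d)).
Proof.
rewrite {1}/usum; under eq_bigr => t _ do rewrite -usumZ.
by rewrite -usum_sum.
Qed.

Section ProductSpace.
Variables (K : fieldType) (B I : gspace K).
Local Notation X := (gprod B I).
Implicit Types (a : word B) (b : word I) (w : word X) (v : Sym I).

Definition inclB (m : B) : X := (m, 0 : I).
Definition projI (t : X) : I := t.2.

Lemma homog_pair n (m : B) (i : I) : @homog K X n (m, i) = homog n m && homog n i.
Proof. by rewrite /homog /= xpair_eqE. Qed.

Lemma inclB_deg : deg_map 0 inclB.
Proof.
split; first by move=> c u v; rewrite /inclB -[RHS]/(c *: u + v, c *: 0 + 0) scaler0 addr0.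
by move=> i v hv; rewrite addr0 homog_pair hv homog0.
Qed.

Lemma incl_deg : deg_map 0 (@incl K B I).
Proof.
split; first by move=> c u v; rewrite /incl -[RHS]/(c *: 0 + 0, c *: u + v) scaler0 addr0.
by move=> i v hv; rewrite addr0 homog_pair hv homog0.
Qed.

Lemma proj_deg : deg_map 0 (@proj K B I).
Proof. by split=> // i [m t]; rewrite addr0 homog_pair => /andP[]. Qed.

Lemma projI_deg : deg_map 0 projI.
Proof. by split=> // i [m t]; rewrite addr0 homog_pair => /andP[]. Qed.

Local Notation iB := (hmap inclB).
Local Notation iI := (hmap (@incl K B I)).
Local Notation pB := (hmap (@proj K B I)).
Local Notation pI := (hmap projI).

Lemma pB_iB x : pB (iB x) = x.
Proof. by apply: hel_eq => //; rewrite (vec_hmap proj_deg) (vec_hmap inclB_deg). Qed.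
Lemma pI_iI x : pI (iI x) = x.
Proof. by apply: hel_eq => //; rewrite (vec_hmap projI_deg) (vec_hmap incl_deg). Qed.
Lemma pB_iI x : vec (pB (iI x)) = 0.
Proof. by rewrite (vec_hmap proj_deg) (vec_hmap incl_deg). Qed.
Lemma pI_iB x : vec (pI (iB x)) = 0.
Proof. by rewrite (vec_hmap projI_deg) (vec_hmap inclB_deg). Qed.

Lemma map_pB_iB a : map pB (map iB a) = a.
Proof. by rewrite -map_comp -[RHS]map_id; apply: eq_map => x; exact: pB_iB. Qed.
Lemma map_pI_iI b : map pI (map iI b) = b.
Proof. by rewrite -map_comp -[RHS]map_id; apply: eq_map => x; exact: pI_iI. Qed.

Lemma iB_mkhel n (m : B) : iB (mkhel n m) = @mkhel K X n (m, 0).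
Proof. by apply: hel_eq => //; rewrite (vec_hmap inclB_deg) /vec /= gproj0. Qed.
Lemma iI_mkhel n (i : I) : iI (mkhel n i) = @mkhel K X n (0, i).
Proof. by apply: hel_eq => //; rewrite (vec_hmap incl_deg) /vec /= gproj0. Qed.

(** The identification of [S(B x I)] with [SB (x) SI], with a word as first
    factor. *)
Definition mu a v : Sym X := pre (map iB a) (smap (@incl K B I) v).

Lemma mu_lin a : linear (mu a).
Proof. exact: lin_comp (pre_lin _) (smap_lin _). Qed.

Lemma mu_sgen a b : mu a (sgen b) = sgen (map iB a ++ map iI b).
Proof. by rewrite /mu (smap_sgen incl_deg) pre_sgen. Qed.

Lemma mu_nil v : mu [::] v = smap (@incl K B I) v.
Proof.
move: v; apply: Sym_linext; [exact: mu_lin | exact: smap_lin | move=> b].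
by rewrite mu_sgen (smap_sgen incl_deg).
Qed.

Lemma mu_kills v : skills (mu^~ v).
Proof.
move=> r Rr; rewrite /lincomb; move: v; apply: Sym_linext.
- by apply: lin_bigsum => t; apply: lin_scale; exact: mu_lin.
- exact: lin_zero.
move=> b; under eq_bigr => t _ do rewrite mu_sgen.
have k : skills (fun a => sgen (map iB a ++ map iI b)).
  exact: (kills_hmap inclB_deg (kills_append (map iI b) (@sgen_kills K X))).
exact: k.
Qed.

Lemma mu_multilin v : multilin (mu^~ v).
Proof. by have [] := (sym_killsP _).1 (mu_kills v). Qed.

Lemma mu_zero a x a' v : vec x = 0 -> mu (a ++ x :: a') v = 0.
Proof. exact: (multilin_zero _ _ (mu_multilin v)). Qed.

(** Every letter is the sum of its parts in the base and in the fibre; the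
    signs come from moving the base letters to the front. *)
Lemma mu_split w : sgen w = usum w (fun a b : word X => mu (map pB a) (sgen (map pI b))).
Proof.
elim: w => [|x w IH]; first by rewrite usum_nil mu_sgen.
have -> : sgen (x :: w) = pre [:: iB (pB x)] (sgen w) + pre [:: iI (pI x)] (sgen w).
  rewrite !pre_sgen /= -[X in X + _]scale1r.
  apply: (@sgen_multilin K X 1 _ _ x [::] w) => //.
  rewrite (vec_hmap inclB_deg) (vec_hmap proj_deg) (vec_hmap incl_deg) (vec_hmap projI_deg).
  rewrite scale1r; case: (vec x) => m i.
  by rewrite -[RHS]/(m + 0, 0 + i) addr0 add0r.
rewrite usum_cons {1 2}IH !(lin_usum _ _ (pre_lin _)); congr (_ + _).
  by apply: eq_usum => a b; rewrite !mu_sgen pre_sgen.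
apply: eq_usum => a b; rewrite !mu_sgen pre_sgen /= sgen_move ksignZ.
rewrite !wdeg_map // -[X in X = _]scale1r; congr (_ *: _).
by rewrite (@ksign_par K _ 0 (deg x * wdeg a)) //; rewrite /hmap /deg /=; ring.
Qed.

Lemma prod_linext (W : lmodType K) (F G : Sym X -> W) : linear F -> linear G ->
  (forall a v, F (mu a v) = G (mu a v)) -> forall u, F u = G u.
Proof.
move=> lF lG e; apply: Sym_linext => // w.
by rewrite mu_split !(lin_usum _ _ lF, lin_usum _ _ lG); apply: eq_usum => a b; exact: e.
Qed.

Lemma smap_proj_mu a v : smap (@proj K B I) (mu a v) = (scounit v : K) *: sgen a.
Proof.
move: v; apply: Sym_linext.
- exact: lin_comp (smap_lin _) (mu_lin a).
- by move=> c u v; rewrite (@scounit_lin K I) scalerDl -scalerA.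
move=> b; rewrite mu_sgen (smap_sgen proj_deg) scounit_sgen map_cat map_pB_iB.
case: b => [|x b] /=; first by rewrite cats0 scale1r.
by rewrite scale0r sgen_zero // pB_iI.
Qed.

Lemma scounit_mu a v : scounit (mu a v) = if a is [::] then scounit v else 0.
Proof.
move: v; apply: Sym_linext.
- exact: lin_comp (@scounit_lin K X) (mu_lin a).
- by case: a => [|x a]; [exact: scounit_lin | exact: lin_zero].
by move=> b; rewrite mu_sgen !scounit_sgen; case: a => [|x a] //; case: b.
Qed.

Lemma sproj1_mu2 a v : (sproj1 (mu a v)).2 = if a is [::] then sproj1 v else 0.
Proof.
have l2 : linear (fun u : Sym X => (sproj1 u).2).
  by move=> c u v'; rewrite (@sproj1_lin K X).
move: v; apply: Sym_linext.
- exact: lin_comp l2 (mu_lin a).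
- by case: a => [|x a]; [exact: sproj1_lin | exact: lin_zero].
move=> b; rewrite mu_sgen !sproj1_sgen; case: a => [|x [|y a]] /=.
- by case: b => [|x [|y b]] //; rewrite -[LHS]/((vec (iI x)).2) (vec_hmap incl_deg).
- by case: b => [|y b] //; rewrite -[LHS]/((vec (iB x)).2) (vec_hmap inclB_deg).
by [].
Qed.

Lemma sproj1_fst (u : Sym X) : (sproj1 u).1 = sproj1 (smap (@proj K B I) u).
Proof.
move: u; apply: Sym_linext.
- by move=> c u v; rewrite (@sproj1_lin K X).
- exact: lin_comp (@sproj1_lin K B) (smap_lin _).
move=> w; rewrite (smap_sgen proj_deg) !sproj1_sgen; case: w => [|x [|y w]] //=.
by rewrite (vec_hmap proj_deg).
Qed.

Lemma mu_sdeg a : sdeg_map (wdeg a) (mu a).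
Proof.
apply: sdegP; first exact: mu_lin.
move=> b; rewrite mu_sgen; apply: shomog_sgen.
by rewrite wdeg_cat !wdeg_map // addrC.
Qed.

(** ** Extension of an endomorphism of the fibre *)

(** The tensor product of the identity of the base coalgebra with [F], read
    through [mu]. *)
Definition extF (F : Sym I -> Sym I) : Sym X -> Sym X :=
  plin (fun w => usum w (fun a b : word X => mu (map pB a) (F (sgen (map pI b))))).

Lemma extF_lin F : linear (extF F). Proof. exact: plin_linear. Qed.

Lemma extF_sgen F w : linear F ->
  extF F (sgen w) = usum w (fun a b : word X => mu (map pB a) (F (sgen (map pI b)))).
Proof.
move=> lF; rewrite /extF plin_gen //; apply: usum_kills => [b|a].
  exact: (kills_hmap proj_deg (mu_kills _)).
apply: (kills_lin (lin_comp (mu_lin _) lF)).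
exact: (kills_hmap projI_deg (@sgen_kills K I)).
Qed.

Lemma extF_mu F a v : linear F -> extF F (mu a v) = mu a (F v).
Proof.
move=> lF; move: v; apply: Sym_linext.
- exact: lin_comp (extF_lin F) (mu_lin a).
- exact: lin_comp (mu_lin a) lF.
move=> b; rewrite mu_sgen extF_sgen // usum_cat !usum_map // usum_rnil.
  rewrite usum_map // usum_lnil.
    by rewrite wdeg_nil mul0r ksign0 scale1r /= cats0 map_pB_iB map_pI_iI.
  by move=> [//|x b1] b2 _; rewrite map_cat /= mu_zero ?scaler0 // pB_iI.
move=> a1 [//|x a2] _; apply: usum0 => b1 b2.
rewrite map_cat /= (sgen_zero [::]) ?pI_iB // (lin0 lF).
by rewrite (lin0 (mu_lin _)) scaler0.
Qed.

Lemma smap_proj_extF F u : linear F -> (forall v, scounit (F v) = scounit v) ->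
  smap (@proj K B I) (extF F u) = smap (@proj K B I) u.
Proof.
move=> lF cF; move: u; apply: prod_linext.
- exact: lin_comp (smap_lin _) (extF_lin F).
- exact: smap_lin.
by move=> a v; rewrite extF_mu // !smap_proj_mu cF.
Qed.

Lemma extF_incl F v : linear F ->
  extF F (smap (@incl K B I) v) = smap (@incl K B I) (F v).
Proof. by move=> lF; rewrite -!mu_nil extF_mu. Qed.

Lemma extF_can F G : linear F -> linear G -> cancel F G -> cancel (extF F) (extF G).
Proof.
move=> lF lG FG; apply: prod_linext.
- exact: lin_comp (extF_lin G) (extF_lin F).
- exact: lin_id.
by move=> a v; rewrite !extF_mu // FG.
Qed.

(* The coproduct of [mu a v] is a linear function of that of [v]; the twist is
   the sign of exchanging the two inner factors. *)
Let theta_fun a (u v : Sym I) : tens (Sym X) (Sym X) :=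
  usum a (fun a1 a2 => ten (mu a1 (stwist (wdeg a2) u)) (mu a2 v)).

Let theta_l a v : linear (theta_fun a ^~ v).
Proof.
apply: lin_bigsum => t; apply: lin_scale.
exact: lin_comp (ten_linl _) (lin_comp (mu_lin _) (stwist_lin _)).
Qed.

Let theta_r a u : linear (theta_fun a u).
Proof.
apply: lin_bigsum => t; apply: lin_scale.
exact: lin_comp (ten_linr _) (mu_lin _).
Qed.

Let theta a := plin (fun t => theta_fun a t.1 t.2) : tens (Sym I) (Sym I) -> tens (Sym X) (Sym X).

Let theta_lin a : linear (theta a). Proof. exact: plin_linear. Qed.

Let theta_ten a u v : theta a (ten u v) = theta_fun a u v.
Proof. by apply: plin_ten; [exact: theta_l | exact: theta_r]. Qed.

Let Delta_mu a v : Delta (mu a v) = theta a (Delta v).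
Proof.
move: v; apply: Sym_linext.
- exact: lin_comp (@Delta_lin K X) (mu_lin a).
- exact: lin_comp (theta_lin a) (@Delta_lin K I).
move=> b; rewrite mu_sgen !Delta_sgen usum_cat !usum_map //.
rewrite (lin_usum _ _ (theta_lin a)).
rewrite [RHS](eq_usum _ (G := fun b1 b2 => usum a (fun a1 a2 =>
   ten (mu a1 (stwist (wdeg a2) (sgen b1))) (mu a2 (sgen b2)))));
  last by move=> b1 b2; exact: theta_ten.
rewrite [RHS]usumC; apply: eq_usum => a1 a2; rewrite usum_map //; apply: eq_usum => b1 b2.
rewrite stwist_sgen (linZ (mu_lin _)) !mu_sgen (linZ (ten_linl _)).
by rewrite !wdeg_map.
Qed.

Lemma extF_coalg F : is_coalg_mor F -> is_coalg_mor (extF F).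
Proof.
move=> hF; have lF := coalg_lin hF; have [dF cF eF uF] := hF; split.
- apply: sdegP; first exact: extF_lin.
  move=> w; rewrite extF_sgen // addr0; apply: shomog_usum => a b <-.
  rewrite addrC -(wdeg_map (h := pB) a) //; apply: (mu_sdeg _).2.
  by rewrite -[wdeg b]addr0; apply: dF.2; apply: shomog_sgen; rewrite wdeg_map.
- apply: prod_linext.
  + exact: lin_comp (@Delta_lin K X) (extF_lin F).
  + exact: lin_comp (tmap_lin _ _) (@Delta_lin K X).
  move=> a v; rewrite extF_mu // !Delta_mu cF; move: (Delta v); apply: tens_linext.
  + exact: lin_comp (theta_lin a) (tmap_lin _ _).
  + exact: lin_comp (tmap_lin _ _) (theta_lin a).
  move=> s t; rewrite tmap_ten // !theta_ten /theta_fun (lin_usum _ _ (tmap_lin _ _)).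
  apply: eq_usum => a1 a2; rewrite (tmap_ten (extF_lin F) (extF_lin F)).
  by rewrite !extF_mu // (sdeg_twist0 _ _ dF).
- apply: prod_linext.
  + exact: lin_comp (@scounit_lin K X) (extF_lin F).
  + exact: scounit_lin.
  by move=> a v; rewrite extF_mu // !scounit_mu eF.
have e : sone X = mu [::] (sone I) by rewrite mu_sgen.
by rewrite e extF_mu // uF.
Qed.

Lemma taylor_extF F w : is_coalg_mor F ->
  taylor (extF F) w = (if w is [:: x] then (vec x).1 else 0, taylor F (map pI w)).
Proof.
move=> hF; have lF := coalg_lin hF; have [_ _ eF _] := hF.
rewrite /taylor [LHS]surjective_pairing; congr (_, _).
  rewrite sproj1_fst smap_proj_extF // (smap_sgen proj_deg) sproj1_sgen.
  by case: w => [|x [|y w]] //=; rewrite (vec_hmap proj_deg).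
have l2 : linear (fun u : Sym X => (sproj1 u).2).
  by move=> c u v'; rewrite (@sproj1_lin K X).
rewrite extF_sgen //.
transitivity (usum w (fun a b : word X => (sproj1 (mu (map pB a) (F (sgen (map pI b))))).2)).
  exact: (lin_usum _ _ l2).
rewrite usum_lnil => [|[//|x a] b _]; last by rewrite sproj1_mu2.
by rewrite sproj1_mu2.
Qed.

End ProductSpace.

(** ** The extension classified by an action *)

Section Extension.
Variables (K : fieldType) (M : dgl K) (I : gspace K).
Hypotheses (char0 : [pchar K] =i pred0) (hM : is_dgl M).
Local Notation B := (shift M 1).
Local Notation X := (gprod B I).
Local Notation iB := (hmap (@inclB K B I)).
Local Notation iI := (hmap (@incl K B I)).
Local Notation pB := (hmap (@proj K B I)).
Local Notation pI := (hmap (@projI K B I)).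

Record is_action (Q : Sym I -> Sym I) (f : hel M -> Sym I -> Sym I) : Prop := IsAction {
  action_coder : forall m, is_coder (deg m) (f m);
  action_linl : forall c (x y z : hel M) u, deg x = deg z -> deg y = deg z ->
    vec z = c *: vec x + vec y -> f z u = c *: f x u + f y u;
  action_d : forall m u, f (d_hel m) u = Q (f m u) - ksign K (deg m) *: f m (Q u);
  action_br : forall m m' u, f (br_hel m m') u
    = f m (f m' u) - ksign K (deg m * deg m') *: f m' (f m u)
}.

Variables (Q : Sym I -> Sym I) (f : hel M -> Sym I -> Sym I).
Hypotheses (hQ : is_Linf Q) (hf : is_action Q f).
Local Notation QX := (ext_Linf Q f).

Let cQ : is_coder 1 Q. Proof. by case: hQ. Qed.
Let lQ : linear Q. Proof. exact: is_coder_lin cQ. Qed.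
Let lf m : linear (f m). Proof. exact: is_coder_lin (action_coder hf m). Qed.

Let f_scale c (x z : hel M) u : deg x = deg z -> vec z = c *: vec x -> f z u = c *: f x u.
Proof.
move=> hx hz.
have z0 (p : hel M) : vec p = 0 -> f p u = 0.
  move=> p0; have := @action_linl _ _ hf (-1) p p p u erefl erefl.
  by rewrite p0 scaler0 addr0 scaleN1r addNr; apply.
pose o : hel M := mkhel (deg z) 0.
have vo : vec o = 0 by rewrite /o /vec /= gproj0.
have e : vec z = c *: vec x + vec o by rewrite vo addr0.
by rewrite (@action_linl _ _ hf c x o z u hx erefl e) (z0 o vo) addr0.
Qed.

Let f_zero (p : hel M) u : vec p = 0 -> f p u = 0.
Proof. by move=> p0; rewrite (@f_scale 0 p p u) ?scale0r // p0 scaler0. Qed.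

Let act (x : hel X) (b : word X) : I := taylor (f (unshift (pB x))) (map pI b).

Let ext_coefE w : ext_coef Q f w
  = (dgl_coef (map pB w), taylor Q (map pI w) + psum w act).
Proof.
rewrite /ext_coef; congr (_, _ + _); apply: eq_bigr => -[[e a] b] _ /=.
by case: a => [|x [|y a]]; rewrite ?scaler0.
Qed.

Let kills_pair (V : gspace K) (W Z : lmodType K) (g : word V -> W) (h : word V -> Z) :
  skills g -> skills h -> skills (fun w => (g w, h w) : (W * Z)%type).
Proof.
move=> kg kh.
have l1 : linear (fun t : W => (t, 0) : (W * Z)%type).
  by move=> c s t; rewrite -[RHS]/(c *: s + t, c *: 0 + 0) scaler0 addr0.
have l2 : linear (fun t : Z => (0, t) : (W * Z)%type).
  by move=> c s t; rewrite -[RHS]/(c *: 0 + 0, c *: s + t) scaler0 addr0.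
apply: kills_ext (kills_add (kills_lin l1 kg) (kills_lin l2 kh)) => w.
by rewrite -[LHS]/(g w + 0, 0 + h w) addr0 add0r.
Qed.

Let ltaylor (P : Sym I -> Sym I) : linear P -> skills (taylor P).
Proof. by move=> lP; exact: (kills_pgen (R := @sym_rel K I) (lin_comp (@sproj1_lin K I) lP)). Qed.

Let kills_act : skills (fun w => psum w act).
Proof.
apply: psum_kills => [c x y z b hx hy hz|x].
  rewrite /act /taylor -(@sproj1_lin K I); congr (sproj1 _).
  apply: (action_linl hf).
  - by rewrite !deg_unshift; congr (1 + _).
  - by rewrite !deg_unshift; congr (1 + _).
  by rewrite !vec_unshift !(vec_hmap (@proj_deg K B I)) hz.
exact: (kills_hmap (@projI_deg K B I) (ltaylor (lf _))).
Qed.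

Lemma ext_coefs : coefs 1 (ext_coef Q f).
Proof.
rewrite (funext ext_coefE); split.
  apply: kills_pair; first exact: (kills_hmap (@proj_deg K B I) (dgl_coefs hM).1).
  apply: kills_add kills_act.
  exact: (kills_hmap (@projI_deg K B I) (ltaylor lQ)).
move=> w; rewrite homog_pair; apply/andP; split.
  by rewrite -(wdeg_map (h := pB) w) //; exact: (dgl_coefs hM).2.
apply: homogD.
  by rewrite -(wdeg_map (h := pI) w) //; exact: (taylor_coefs cQ).2.
rewrite /homog (lin_psum _ _ (@gproj_linear K I _)); apply/eqP.
apply: eq_psum_deg => x b _ dw; apply/eqP.
have := (taylor_coefs (action_coder hf (unshift (pB x)))).2 (map pI b).
rewrite wdeg_map // deg_unshift -dw addrA; exact.
Qed.

Lemma ext_coder : is_coder 1 QX.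
Proof. exact: coder_is_coder ext_coefs. Qed.

Let lQX : linear QX. Proof. exact: is_coder_lin ext_coder. Qed.

Let ext_coef_mix a1 b1 : ext_coef Q f (map iB a1 ++ map iI b1) =
  (if b1 is [::] then dgl_coef a1 else 0,
   (if a1 is [::] then taylor Q b1 else 0)
   + (if a1 is [:: m] then taylor (f (unshift m)) b1 else 0)).
Proof.
rewrite ext_coefE; congr (_, _ + _).
- rewrite map_cat map_pB_iB; case: b1 => [|y b1] /=; first by rewrite cats0.
  have [ml _] := (sym_killsP _).1 (dgl_coefs hM).1.
  by apply: multilin_zero ml _; exact: pB_iI.
- rewrite map_cat map_pI_iI; case: a1 => [|x a1] //=.
  have [ml _] := (sym_killsP _).1 (ltaylor lQ).
  by apply: (multilin_zero [::] _ ml); exact: pI_iB.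
rewrite psum_cat !psum_map // [X in _ + X]psum0 ?addr0; last first.
  move=> x b; rewrite /act /taylor f_zero ?(lin0 (@sproj1_lin K I)) ?scaler0 //.
  by rewrite vec_unshift pB_iI.
case: a1 => [|x [|y a1]].
- by rewrite psum_nil.
- by rewrite psum_cons psum_nil addr0 /act pB_iB /= map_pI_iI.
rewrite (@eq_psum_deg _ _ _ _ _ (fun _ _ => 0)) ?psum0 // => z [|t b] // _ _.
have [ml _] := (sym_killsP _).1 (ltaylor (lf (unshift (pB (iB z))))).
by apply: (multilin_zero [::] _ ml); exact: pI_iB.
Qed.

Let mk a : hel B := mkhel (1 + wdeg a) (dgl_coef a).

Let mkhel_split n (m : B) (i j : I) (w : word X) :
  sgen ((@mkhel K X n (m, i + j)) :: w)
  = sgen (iB (mkhel n m) :: w) + (sgen (iI (mkhel n i) :: w) + sgen (iI (mkhel n j) :: w)).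
Proof.
rewrite iB_mkhel !iI_mkhel.
have l : linear (fun t : X => sgen (@mkhel K X n t :: w)).
  exact: (multilin_mkhel n [::] w (@sgen_multilin K X)).
rewrite -!(linD l); congr (sgen (mkhel _ _ :: _)).
by rewrite -[RHS]/(m + (0 + 0), 0 + (i + j)) !addr0 add0r.
Qed.

(** On words that contain letters of both kinds, the only Taylor coefficients of
    the extension are those with exactly one base letter; summed over the
    unshuffles of the fibre letters, they make up the action of that letter. *)
Lemma ext_mu a v : QX (mu a v) = usum a (fun a1 a2 => mu (mk a1 :: a2) v)
   + ksign K (wdeg a) *: mu a (Q v)
   + psum a (fun m a2 => ksign K ((deg m + 1) * wdeg a2) *: mu a2 (f (unshift m) v)).
Proof.
move: v; apply: Sym_linext.
- exact: lin_comp lQX (mu_lin a).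
- apply: lin_add; first apply: lin_add.
  + by apply: lin_bigsum => t; apply: lin_scale; exact: mu_lin.
  + by apply: lin_scale; exact: lin_comp (mu_lin a) lQ.
  apply: lin_bigsum => t; apply: lin_scale; case: t.1.2 => [|m [|m' a']];
    try exact: lin_zero.
  by apply: lin_scale; exact: lin_comp (mu_lin _) (lf _).
move=> b; rewrite mu_sgen {1}/ext_Linf coder_sgen; last exact: ext_coefs.1.
have moveI n (i : I) a2 b2 : sgen (iI (mkhel n i) :: map iB a2 ++ map iI b2)
    = ksign K (n * wdeg a2) *: mu a2 (sgen (mkhel n i :: b2)).
  rewrite mu_sgen /= sgen_move ksignZ wdeg_map //.
  by rewrite (@ksign_par K _ 0 (n * wdeg a2)) ?scale1r // /hmap /deg /=; ring.
rewrite usum_cat !usum_map //.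
transitivity (usum a (fun a1 a2 => usum b (fun b1 b2 =>
     (if b1 is [::] then mu (mk a1 :: a2) (sgen b2) else 0)
   + ((if a1 is [::] then ksign K (wdeg a2) *:
          mu a2 (sgen (mkhel (1 + wdeg b1) (taylor Q b1) :: b2)) else 0)
   + (if a1 is [:: m] then ksign K ((deg m + 1) * wdeg a2) *:
          mu a2 (sgen (mkhel (deg (unshift m) + wdeg b1) (taylor (f (unshift m)) b1) :: b2))
      else 0))))).
  apply: eq_usum => a1 a2; rewrite usum_map //; apply: eq_usum => b1 b2.
  rewrite ext_coef_mix mkhel_split !moveI !wdeg_cat !wdeg_map // !scalerDr !ksignZ.
  congr (_ + (_ + _)).
  - case: b1 => [|y b1]; last by rewrite iB_mkhel (sgen_zero [::]) ?scaler0 // /vec /= !gproj0.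
    by rewrite wdeg_nil mulr0 ksign0 scale1r addr0 mu_sgen.
  - case: a1 => [|x a1]; last first.
      suff -> : sgen (mkhel (1 + (wdeg (x :: a1) + wdeg b1)) 0 :: b2) = 0 :> Sym I.
        by rewrite (lin0 (mu_lin _)) scaler0.
      by rewrite (sgen_zero [::]) // /vec /= gproj0.
    rewrite wdeg_nil add0r; congr (_ *: _).
    by apply: (@ksign_par _ _ _ (wdeg a2 * wdeg b1)); ring.
  case: a1 => [|x [|y a1]].
  - rewrite (sgen_zero [::]) ?(lin0 (mu_lin _)) ?scaler0 // /vec /= gproj0 //.
  - rewrite deg_unshift !wdeg_cons wdeg_nil addr0 addrA; congr (_ *: _).
    by apply: (@ksign_par _ _ _ (wdeg a2 * wdeg b1)); ring.
  by rewrite (sgen_zero [::]) ?(lin0 (mu_lin _)) ?scaler0 // /vec /= gproj0.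
rewrite (eq_usum _ (G := fun a1 a2 => mu (mk a1 :: a2) (sgen b)
  + ((if a1 is [::] then ksign K (wdeg a2) *: mu a2 (Q (sgen b)) else 0)
   + (if a1 is [:: m] then ksign K ((deg m + 1) * wdeg a2) *:
          mu a2 (f (unshift m) (sgen b)) else 0)))).
  rewrite !usumD addrA; congr (_ + _ + _).
  by rewrite usum_lnil // => -[].
move=> a1 a2; rewrite !usumD; congr (_ + (_ + _)).
- by rewrite usum_lnil // => -[].
- case: a1 => [|x a1]; last by rewrite usum0.
  rewrite (coder_taylor char0 (sgen b) cQ) coder_sgen; last exact: (taylor_coefs cQ).1.
  by rewrite usumZ (lin_usum _ _ (mu_lin _)).
case: a1 => [|x [|y a1]]; try by rewrite usum0.
rewrite (coder_taylor char0 (sgen b) (action_coder hf _)).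
rewrite coder_sgen; last exact: (taylor_coefs (action_coder hf _)).1.
by rewrite usumZ (lin_usum _ _ (mu_lin _)).
Qed.

Let p2 (u : Sym X) : I := (sproj1 u).2.

Let l2 : linear p2.
Proof. by move=> c u v'; rewrite /p2 (@sproj1_lin K X). Qed.

Let p2_mu a v : p2 (mu a v) = if a is [::] then sproj1 v else 0.
Proof. exact: sproj1_mu2. Qed.

Let p2QE a v : p2 (QX (mu a v)) = match a with
  | [::] => sproj1 (Q v) | [:: m] => sproj1 (f (unshift m) v) | _ => 0 end.
Proof.
rewrite ext_mu (linD l2) (linD l2) (linZ l2) (lin_usum _ _ l2) (lin_psum _ _ l2).
rewrite usum0 ?add0r => [|a1 a2]; last by rewrite p2_mu.
rewrite p2_mu (eq_psum _ (g := fun m a2 => if a2 is [::] then sproj1 (f (unshift m) v) else 0)).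
  case: a => [|m [|m' a]].
  - by rewrite wdeg_nil ksign0 scale1r psum_nil addr0.
  - by rewrite scaler0 add0r psum_cons psum_nil addr0.
  rewrite scaler0 add0r.
  by rewrite (@eq_psum_deg _ _ _ _ _ (fun _ _ => 0)) ?psum0 // => x [|y b].
move=> m a2; rewrite (linZ l2) p2_mu; case: a2 => [|y a2]; last by rewrite scaler0.
by rewrite wdeg_nil mulr0 ksign0 scale1r.
Qed.

Lemma smap_proj_ext u : smap (@proj K B I) (QX u) = dgl_Linf M (smap (@proj K B I) u).
Proof.
apply: (smap_coder (@proj_deg K B I) ext_coefs (dgl_coefs hM)) => w.
by rewrite ext_coefE.
Qed.

Let f_mk1 m v : f (unshift (mk [:: m])) v
  = - (Q (f (unshift m) v) - ksign K (deg (unshift m)) *: f (unshift m) (Q v)).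
Proof.
rewrite -(action_d hf) -scaleN1r; apply: f_scale.
  rewrite !deg_unshift /mk -[deg (mkhel _ _)]/(1 + wdeg [:: m]) wdeg_cons wdeg_nil.
  by rewrite -[deg (d_hel _)]/(1 + deg m + 1); ring.
by rewrite vec_unshift vec_mkhel ?(dgl_coefs hM).2 // (vec_d_hel hM) scaleN1r /= vec_unshift.
Qed.

Let f_mk2 m m' v : f (unshift (mk [:: m; m'])) v = ksign K (deg (unshift m)) *:
  (f (unshift m) (f (unshift m') v)
   - ksign K (deg (unshift m) * deg (unshift m')) *: f (unshift m') (f (unshift m) v)).
Proof.
rewrite -(action_br hf); apply: f_scale.
  rewrite !deg_unshift /mk -[deg (mkhel _ _)]/(1 + wdeg [:: m; m']) !wdeg_cons wdeg_nil.
  by rewrite -[deg (br_hel _ _)]/(1 + deg m + (1 + deg m')); ring.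
rewrite vec_unshift vec_mkhel ?(dgl_coefs hM).2 // vec_mkhel //; exact: dgl_br_homog.
Qed.

Let f_mk0 a v : dgl_coef a = 0 -> f (unshift (mk a)) v = 0.
Proof. by move=> a0; apply: f_zero; rewrite vec_unshift /mk a0 /vec /= gproj0. Qed.

(** Only words with at most one letter in the base have a corestriction to the
    fibre, so the square is controlled by words with at most two letters. *)
Let p2_sq u : p2 (QX (QX u)) = 0.
Proof.
move: u; apply: prod_linext.
- exact: lin_comp l2 (lin_comp lQX lQX).
- exact: lin_zero.
move=> a v; rewrite ext_mu !(linD lQX) !(linD l2) (lin_usum _ _ lQX) (lin_usum _ _ l2).
rewrite (linZ lQX) (linZ l2) (lin_psum _ _ lQX) (lin_psum _ _ l2).
rewrite (eq_psum _ (g := fun m a2 =>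
  ksign K ((deg m + 1) * wdeg a2) *: p2 (QX (mu a2 (f (unshift m) v))))); last first.
  by move=> m a2; rewrite (linZ lQX) (linZ l2).
have QQ : Q (Q v) = 0 by case: hQ.
have lp := @sproj1_lin K I.
case: a => [|x [|y [|z a]]].
- rewrite usum_nil psum_nil addr0 !p2QE f_mk0 // QQ (lin0 lp) scaler0 addr0 //.
- rewrite usum_cons !usum_nil psum_cons psum_nil !p2QE f_mk1 scaler0 !addr0.
  rewrite !wdeg_cons wdeg_nil mulr0 ksign0 scale1r (linN lp) (linB lp) (linZ lp).
  by rewrite addr0 deg_unshift [1 + _]addrC ksignS scaleNr opprK opprD subrK addNr.
- rewrite !usum_cons !usum_nil !psum_cons psum_nil !p2QE f_mk2 !scaler0 !addr0.
  rewrite (linZ lp) (linB lp) (linZ lp) scalerBr !ksignZ -scaleN1r -ksign1 !ksignZ.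
  rewrite [X in _ + X]addrC addrACA -!scalerDl !wdeg_cons wdeg_nil !deg_unshift.
  rewrite (@ksign_cancel _ _ _ (deg x * deg y - 1)); last by ring.
  by rewrite (@ksign_cancel _ _ _ (- deg x - 2)) ?scale0r ?addr0 //; ring.
have u0 : usum [:: x, y, z & a] (fun a1 a2 => p2 (QX (mu (mk a1 :: a2) v))) = 0.
  rewrite -[RHS](@usum0 K B I [:: x, y, z & a] (fun _ _ => 0)) //.
  apply: eq_usum_deg => a1 [|b1 a2] sab _; rewrite p2QE //.
  by rewrite f_mk0 ?(lin0 lp) //; case: a1 sab => [|a1 [|a2 [|a3 a']]].
rewrite p2QE scaler0 addr0 u0 add0r.
rewrite -[RHS](@psum0 K B I [:: x, y, z & a] (fun _ _ => 0)) //.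
by apply: eq_psum_deg => m [|b1 [|b2 b]] // _ _; rewrite p2QE scaler0.
Qed.

Lemma ext_is_Linf : is_Linf QX.
Proof.
split; first exact: ext_coder.
  rewrite (taylor_coder _ ext_coefs) ext_coefE psum_nil addr0.
  by case: hQ => _ -> _.
apply: (sq_coder_eq0 char0 ext_coder) => w.
rewrite [LHS]surjective_pairing -[RHS]/(0 : B, 0 : I); congr (_, _).
  rewrite sproj1_fst !smap_proj_ext.
  have [_ _ ->] := dgl_Linf_is_Linf char0 hM; exact: lin0 (@sproj1_lin K B).
exact: p2_sq.
Qed.

Lemma ext_incl v : smap (@incl K B I) (Q v) = QX (smap (@incl K B I) v).
Proof.
rewrite -!mu_nil ext_mu usum_nil psum_nil addr0 wdeg_nil ksign0 scale1r.
by rewrite (mu_zero [::]) ?add0r // /mk /vec /= gproj0.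
Qed.

Lemma ext_is_extension : is_Linf_extension Q QX (dgl_Linf M).
Proof.
split=> //; [exact: ext_is_Linf | exact: dgl_Linf_is_Linf | split | split].
- exact: smap_coalg (@incl_deg K B I).
- exact: ext_incl.
- exact: smap_coalg (@proj_deg K B I).
- exact: smap_proj_ext.
Qed.

End Extension.

(** Both differentials are given by [ext_mu], whose terms are linear in the fibre
    factor and involve it only through the operators that [F] intertwines. *)
Lemma extF_intertwine (K : fieldType) (M : dgl K) (I : gspace K)
    (Q Q' : Sym I -> Sym I) (f f' : hel M -> Sym I -> Sym I) (F : Sym I -> Sym I) :
  [pchar K] =i pred0 -> is_dgl M -> is_Linf Q -> is_action Q f ->
  is_Linf Q' -> is_action Q' f' -> linear F ->
  (forall v, F (Q v) = Q' (F v)) -> (forall m v, F (f m v) = f' m (F v)) ->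
  forall u, extF F (ext_Linf Q f u) = ext_Linf Q' f' (@extF K (shift M 1) I F u).
Proof.
move=> char0 hM hQ hf hQ' hf' lF FQ Ff; apply: prod_linext.
- exact: lin_comp (extF_lin F) (coder_lin _ _).
- exact: lin_comp (coder_lin _ _) (extF_lin F).
move=> a v; rewrite extF_mu // (ext_mu char0 hM hQ hf) (ext_mu char0 hM hQ' hf').
rewrite !(linD (extF_lin F)) (linZ (extF_lin F)) (lin_usum _ _ (extF_lin F)).
rewrite (lin_psum _ _ (extF_lin F)) extF_mu // FQ; congr (_ + _ + _).
  by apply: eq_usum => a1 a2; rewrite extF_mu.
by apply: eq_psum => m a2; rewrite (linZ (extF_lin F)) extF_mu // Ff.
Qed.

(** * The two extensions of a pre-Lie algebra *)

Section Transport.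
Variables (K : fieldType) (M : dgl K) (I : gspace K).
Variables (Q Q' : Sym I -> Sym I) (f f' : hel M -> Sym I -> Sym I).
Variables (F G : Sym I -> Sym I).
Hypotheses (char0 : [pchar K] =i pred0).
Hypotheses (hF : is_coalg_mor F) (FG : cancel F G) (GF : cancel G F).
Hypothesis FQ : forall v, F (Q v) = Q' (F v).
Hypothesis Ff : forall m v, F (f m v) = f' m (F v).

Let lF : linear F. Proof. exact: coalg_lin hF. Qed.

Lemma Linf_transport : is_Linf Q -> is_Linf Q'.
Proof.
case=> cQ t0 QQ; have e : Q' = fun u => F (Q (G u)).
  by apply/funext => u; rewrite FQ GF.
have cQ' : is_coder 1 Q' by rewrite e; exact: coder_conj hF FG GF cQ.
split=> //; last by move=> u; rewrite -[u]GF -!FQ QQ (lin0 lF).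
have F1 : F (sone I) = sone I by case: hF.
rewrite /taylor -/(sone I) -F1 -FQ (coder_sone cQ) // (lin0 lF).
exact: lin0 (@sproj1_lin K I).
Qed.

Lemma action_transport : is_action Q f -> is_action Q' f'.
Proof.
case=> cf fl fd fb; split.
- move=> m; have -> : f' m = fun u => F (f m (G u)).
    by apply/funext => u; rewrite Ff GF.
  exact: coder_conj hF FG GF (cf m).
- by move=> c x y z u hx hy hz; rewrite -[u]GF -!Ff -lF (fl c x y z).
- by move=> m u; rewrite -[u]GF -!Ff -!FQ -!Ff fd (linB lF) (linZ lF).
by move=> m m' u; rewrite -[u]GF -!Ff fb (linB lF) (linZ lF).
Qed.

End Transport.

Section Final.
Variables (K : fieldType) (L : preLie K) (d : L -> L).
Hypotheses (char0 : [pchar K] =i pred0) (hd : is_dg_derivation d).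
Implicit Types (x y z : hel L) (m : hel (gprod L L)).

(** An element is recovered from its operator [s] by evaluation at the unit, and
    operators satisfy the Jacobi identity. *)
Lemma lbr_jacobi x y z : lbr x (hbr y z)
  = lbr (hbr x y) z + ksign K (deg x * deg y) *: lbr y (hbr x z).
Proof.
have vE t : vec t = sproj1 (s t (sone L)).
  by rewrite -[RHS]/(taylor (s t) [::]) (taylor_coder _ (s_coefs t)).
have ls t := linB (s_lin t); have lz t := linZ (s_lin t).
rewrite -!vec_hbr !vE -(linZ (@sproj1_lin K L)) -(linD (@sproj1_lin K L)).
congr sproj1; rewrite !(s_hbr char0) !ls !lz !deg_hbr !scalerBr !ksignZ.
set A := s x (s y (s z _)); set A1 := s x (s z (s y _)).
set A2 := s y (s z (s x _)); set A3 := s z (s y (s x _)).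
set A4 := s y (s x (s z _)); set A5 := s z (s x (s y _)).
rewrite (@ksign_par K (deg x * deg y + deg y * (deg x + deg z)) (deg y * deg z) (deg x * deg y));
  last by ring.
rewrite (@ksign_par K (deg x * deg y + deg y * (deg x + deg z) + deg x * deg z)
  ((deg x + deg y) * deg z) (deg x * deg y)); last by ring.
rewrite (@ksign_par K ((deg x + deg y) * deg z + deg x * deg y)
  (deg x * (deg y + deg z) + deg y * deg z) 0); last by ring.
rewrite -mulrDr !opprB [RHS]addrACA !subrKA addrACA [RHS]addrACA.
by congr (_ + _); rewrite addrC.
Qed.

Let d1 : deg_map 1 d. Proof. by case: hd. Qed.
Let fst_deg : deg_map 0 (fun v : gprod L L => v.1). Proof. exact: (@proj_deg K L L). Qed.
Let snd_deg : deg_map 0 (fun v : gprod L L => v.2). Proof. exact: (@projI_deg K L L). Qed.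

Lemma vec_hfst m : vec (hfst m) = (vec m).1. Proof. exact: vec_hmap fst_deg m. Qed.
Lemma vec_hsnd m : vec (hsnd m) = (vec m).2. Proof. exact: vec_hmap snd_deg m. Qed.

Let homog_fst m : homog (deg m) (vec m).1.
Proof. rewrite -vec_hfst; exact: (homog_vec (hfst m)). Qed.
Let homog_snd m : homog (deg m) (vec m).2.
Proof. rewrite -vec_hsnd; exact: (homog_vec (hsnd m)). Qed.

Lemma vec_d_LxL m : vec (@d_hel K (LxL d) m) = (d (vec m).1, d (vec m).2).
Proof. by apply: vec_mkhel; rewrite homog_pair !(d1.2) ?homog_fst ?homog_snd. Qed.

Lemma hfst_d m : hfst (@d_hel K (LxL d) m) = dhel d (hfst m).
Proof. by apply: hel_eq => //; rewrite vec_hfst [RHS](vec_dhel hd) vec_hfst vec_d_LxL. Qed.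

Lemma hsnd_d m : hsnd (@d_hel K (LxL d) m) = dhel d (hsnd m).
Proof. by apply: hel_eq => //; rewrite vec_hsnd [RHS](vec_dhel hd) vec_hsnd vec_d_LxL. Qed.

Let br_homog m m' : @homog K (gprod L L) (deg m + deg m')
  (lbr (hfst m) (hfst m'), lbr (hsnd m) (hsnd m')).
Proof.
rewrite homog_pair; apply/andP; split; first exact: (lbr_homog (hfst m) (hfst m')).
exact: (lbr_homog (hsnd m) (hsnd m')).
Qed.

Lemma hfst_br m m' : hfst (@br_hel K (LxL d) m m') = hbr (hfst m) (hfst m').
Proof.
by apply: hel_eq => //; rewrite vec_hfst vec_hbr vec_mkhel //; exact: br_homog.
Qed.

Lemma hsnd_br m m' : hsnd (@br_hel K (LxL d) m m') = hbr (hsnd m) (hsnd m').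
Proof.
by apply: hel_eq => //; rewrite vec_hsnd vec_hbr vec_mkhel //; exact: br_homog.
Qed.

Lemma LxL_is_dgl : is_dgl (LxL d).
Proof.
have [_ dl dd] := hd; split.
- split=> [c u v|i [u v]].
    by rewrite /= !(d1.1).
  by rewrite !homog_pair => /andP[hu hv]; rewrite !(d1.2).
- by move=> [u v]; rewrite /= !dd.
- exact: br_homog.
- move=> c x y z t hx hy hz.
  have e1 : vec (hfst z) = c *: vec (hfst x) + vec (hfst y) by rewrite !vec_hfst hz.
  have e2 : vec (hsnd z) = c *: vec (hsnd x) + vec (hsnd y) by rewrite !vec_hsnd hz.
  exact: (congr2 pair (@lbr_linl K L c (hfst x) (hfst y) (hfst z) (hfst t) hx hy e1)
    (@lbr_linl K L c (hsnd x) (hsnd y) (hsnd z) (hsnd t) hx hy e2)).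
- move=> x y.
  exact: (congr2 pair (lbr_anti (hfst x) (hfst y)) (lbr_anti (hsnd x) (hsnd y))).
- move=> x y; rewrite [dgl_d _]/= !dl; have e1 := hfst_d; have e2 := hsnd_d.
  rewrite -[RHS]/(lbr (hfst (d_hel x)) (hfst y) + ksign K (deg x) *: lbr (hfst x) (hfst (d_hel y)),
    lbr (hsnd (d_hel x)) (hsnd y) + ksign K (deg x) *: lbr (hsnd x) (hsnd (d_hel y))).
  by rewrite !e1 !e2.
move=> x y z.
rewrite -[LHS]/(lbr (hfst x) (hfst (br_hel y z)), lbr (hsnd x) (hsnd (br_hel y z))).
rewrite hfst_br hsnd_br (lbr_jacobi (hfst x)) (lbr_jacobi (hsnd x)) -!hfst_br -!hsnd_br.
by [].
Qed.

Lemma lin_coder_is_Linf : is_Linf (lin_coder d).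
Proof.
have t w : taylor (lin_coder d) w = lincoef d w by exact: taylor_coder (lincoef_coefs hd).
split; [exact: lin_coder_coder | exact: t | apply: (sq_coder_eq0 char0)].
  exact: lin_coder_coder.
move=> w; rewrite !(sproj1_lin_coder hd); by case: hd.
Qed.

Lemma Lie_action : @is_action K (LxL d) L (lin_coder d) (@Lie_map K L).
Proof.
split.
- by move=> m; apply: is_coder_sub; [exact: (Phi_coder (hfst m)) | exact: (Phi_bot_coder (hsnd m))].
- move=> c x y z u hx hy hz; rewrite /Lie_map.
  have e1 : vec (hfst z) = c *: vec (hfst x) + vec (hfst y) by rewrite !vec_hfst hz.
  have e2 : vec (hsnd z) = c *: vec (hsnd x) + vec (hsnd y) by rewrite !vec_hsnd hz.
  rewrite (@Phi_linl K L char0 c (hfst x) (hfst y) (hfst z) u hx hy e1).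
  rewrite (@Phi_bot_linl K L char0 c (hsnd x) (hsnd y) (hsnd z) u hx hy e2).
  by rewrite scalerBr opprD addrACA.
- move=> m u; rewrite /Lie_map hfst_d hsnd_d !(Phi_derivation char0 hd).
  rewrite (Phi_bot_derivation char0 hd) (linB (is_coder_lin (lin_coder_coder hd))).
  rewrite scalerBr !opprB addrACA [RHS]addrACA; congr (_ + _); exact: addrC.
move=> m m' u; rewrite /Lie_map hfst_br hsnd_br (Phi_hbr char0) (Phi_bot_hbr char0).
rewrite !(linB (Phi_lin _)) !(linB (Phi_bot_lin _)) !scalerBr.
rewrite (Phi_Phi_bot char0 (hfst m)) (Phi_Phi_bot char0 (hfst m')).
have df t : deg (hfst t) = deg t by [].
have ds t : deg (hsnd t) = deg t by [].
rewrite !df !ds [deg m' * _]mulrC ksignZK !opprB [RHS]addrACA !subrKA.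
by rewrite addrACA [RHS]addrACA; congr (_ + _); exact: addrC.
Qed.

Let GF : cancel (inverse_map (@E K L)) (@E K L).
Proof. exact: inverse_mapK (E_surj char0). Qed.
Let FG : cancel (@E K L) (inverse_map (@E K L)).
Proof. exact: inverse_map_can (E_inj char0). Qed.

Let E_calK u : E (lin_coder d u) = calK d (E u).
Proof. by rewrite /calK FG. Qed.

Let E_Lie_map m u : E (Lie_map m u) = pLie_map m (E u).
Proof. by rewrite /Lie_map /pLie_map (linB (@E_lin K L)) (E_Phi char0) (E_Phi_bot char0). Qed.

Lemma calK_is_Linf : is_Linf (calK d).
Proof. exact: Linf_transport char0 (E_coalg L char0) FG GF E_calK lin_coder_is_Linf. Qed.

Lemma pLie_action : @is_action K (LxL d) L (calK d) (@pLie_map K L).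
Proof. exact: (@action_transport K (LxL d) L _ _ _ _ _ _ (E_coalg L char0) FG GF
  E_calK E_Lie_map Lie_action). Qed.

Lemma extension_iso : exists Etilde : Sym (cochains L) -> Sym (cochains L),
  (forall w : word (cochains L), taylor Etilde w = Etilde_coef w) /\
  is_extension_iso (lin_coder d) (cochains_Lie d) (dgl_Linf (LxL d))
    (calK d) (cochains_pLie d) (@E K L) Etilde.
Proof.
have hE := E_coalg L char0; have lE := @E_lin K L.
have hG := coalg_inv hE FG GF; have lG := coalg_lin hG.
have hM := LxL_is_dgl.
pose extL F := @extF K (shift (LxL d) 1) L F.
have inter := extF_intertwine char0 hM lin_coder_is_Linf Lie_action calK_is_Linf pLie_action
  lE E_calK E_Lie_map.
exists (extL (@E K L)); split; first by move=> w; exact: taylor_extF.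
have EK : cancel (extL (@E K L)) (extL (inverse_map (@E K L))) by exact: extF_can.
have KE : cancel (extL (inverse_map (@E K L))) (extL (@E K L)) by exact: extF_can.
split.
- split; first exact: (ext_is_extension char0 hM lin_coder_is_Linf Lie_action).
  exact: (ext_is_extension char0 hM calK_is_Linf pLie_action).
- split; first by split.
  exists (inverse_map (@E K L)); split=> //; split=> // u.
  by rewrite -[u in LHS]GF -E_calK !FG.
- split; first by split; [exact: extF_coalg | exact: inter].
  exists (extL (inverse_map (@E K L))); split=> //; split; first exact: extF_coalg.
  by move=> u; rewrite -[u in LHS]KE -[cochains_pLie d _]inter EK.
- by move=> u; exact: extF_incl.
by move=> u; apply: smap_proj_extF => //; case: hE.
Qed.

End Final.

Theorem theorem3p16 (K : fieldType) (char0 : [pchar K] =i pred0)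
    (L : preLie K) (d : L -> L) (hd : is_dg_derivation d) :
  exists Etilde : Sym (cochains L) -> Sym (cochains L),
    (forall w : word (cochains L), taylor Etilde w = Etilde_coef w) /\
    is_extension_iso
      (lin_coder d) (cochains_Lie d) (dgl_Linf (LxL d))
      (calK d) (cochains_pLie d)
      (@E K L) Etilde.
Proof. exact: extension_iso. Qed.
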